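(* (Version of Ramanujan's master theorem) Let $\phi\in\mathcal E_3$ satisfy $h_\phi(\theta)<\infty$ for all $\theta\in[-\frac\pi2,\frac\pi2]$ and $h_\phi\left(\pm\frac\pi2\right)<\pi$. Let $f$ be the analytic continuation of the power series $\sum_{n=0}^\infty\phi(n)z^n$ to $\mathbb C\setminus\exp(-\mathcal K_\phi^\dagger)$ (this continuation exists and its domain contains $(-\infty,0]$). For $N\in\mathbb Z$ set $f_N:=f-S_N$, where $$S_N(z)=\begin{cases}\displaystyle\sum_{n=0}^{N-1}\phi(n)z^n&\text{if }N\ge0,\\[2mm]\displaystyle-\sum_{n=1}^{-N}\phi(-n)z^{-n}&\text{if }N\le0.\end{cases}$$ Then for every $N\in\mathbb Z$ and every $s\in\mathbb C$ with $-N<\operatorname{Re}s<-N+1$, $$\int_0^\infty f_N(-x)\,x^{s-1}\,dx=\frac{\pi}{\sin(\pi s)}\,\phi(-s).$$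
   Context: Angles: $\Theta=\mathbb R/2\pi\mathbb Z$; intervals of $\Theta$ are $\Theta$ itself and the arcs (open, closed, half-open) run counterclockwise from $\alpha$ to $\beta$, with $[\alpha,\alpha]=\{\alpha\}$. $h_\phi(\theta)=\limsup_{r\to\infty}\frac{\log|\phi(re^{i\theta})|}{r}\in[-\infty,\infty]$, $\operatorname{dom}h_\phi=\{\theta\in\Theta:h_\phi(\theta)<\infty\}$. $\mathcal E_3$ is the set of entire functions $\phi$ of order $\le1$ for which $\operatorname{dom}h_\phi$ is a nonempty interval of $\Theta$. The indicator diagram $\mathcal K_\phi$ is a closed convex subset of an extension $\bar{\mathbb C}$ of $\mathbb C$ by points at infinity; only its finite part matters here: $\mathcal K_\phi\cap\mathbb C=\{p\in\mathbb C:\operatorname{Re}(pe^{-i\theta})\le h_\phi(\theta)\ \forall\theta\in\Theta\}$. Its complex conjugate is $\mathcal K_\phi^\dagger=\{\bar p:p\in\mathcal K_\phi\}$, and the finite part of $\exp(-\mathcal K_\phi^\dagger)$ is $\{e^{-p}:p\in\mathcal K_\phi^\dagger\cap\mathbb C\}$. *)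

(* Defs.v *)
(* Rocq's Stdlib reals, with Coquelicot for complex numbers, derivatives,
   power series and integrals. *)
From Stdlib Require Import Reals ZArith.
From Coquelicot Require Import Coquelicot.
Open Scope R_scope.

Definition Cexp (z : C) : C := (exp (Re z) * cos (Im z), exp (Re z) * sin (Im z)).

Definition Csin (z : C) : C :=
  ((Cexp (Ci * z) - Cexp (- (Ci * z))) / (2 * Ci))%C.

(* The principal power x^s; it is used only for x > 0. *)
Definition Rcpow (x : R) (s : C) : C := Cexp (s * RtoC (ln x))%C.

(* Complex differentiability at a point. *)
Definition C_differentiable (f : C -> C) (z : C) : Prop :=
  ex_derive (K := C_AbsRing) (V := C_NormedModule) f z.

Definition entire (phi : C -> C) : Prop := forall z : C, C_differentiable phi z.

(* The order of growth: the infimum of the exponents rho for which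
   |phi z| <= exp (|z|^rho) as soon as |z| is large. *)
Definition order (phi : C -> C) : Rbar :=
  Glb_Rbar (fun rho => 0 <= rho /\
    exists r0 : R, 0 < r0 /\
      forall z : C, r0 < Cmod z -> Cmod (phi z) <= exp (Rpower (Cmod z) rho)).

(* Logarithm of a nonnegative real, with log 0 = -oo. *)
Definition Rbar_log (x : R) : Rbar :=
  if Req_EM_T x 0 then m_infty else Finite (ln x).

(* Limit superior at +oo of an extended-real-valued function. *)
Definition LimSup_infty (g : R -> Rbar) : Rbar :=
  Rbar_glb (fun y => exists r0 : R,
    y = Rbar_lub (fun v => exists r : R, r0 < r /\ v = g r)).

(* Angles are given by real representatives; functions and sets of angles are
   2 PI-periodic in the representative. *)
Definition indicator (phi : C -> C) (theta : R) : Rbar :=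
  LimSup_infty (fun r =>
    Rbar_div (Rbar_log (Cmod (phi (RtoC r * Cexp (Ci * RtoC theta))%C)))
             (Finite r)).

Definition dom_indicator (phi : C -> C) (theta : R) : Prop :=
  Rbar_lt (indicator phi theta) p_infty.

(* The real interval from a to b; the booleans tell whether each endpoint
   belongs to it. *)
Definition real_interval (closed_l closed_r : bool) (a b t : R) : Prop :=
  (if closed_l then a <= t else a < t) /\ (if closed_r then t <= b else t < b).

(* Intervals of R / 2 PI Z: the whole circle, and the counterclockwise arcs
   from (the class of) a to (the class of) b.  The arc from a to itself has
   length 0. *)
Definition angle_interval (D : R -> Prop) : Prop :=
  (forall t : R, D t) \/
  exists (closed_l closed_r : bool) (a b : R),
    a <= b < a + 2 * PI /\
    forall t : R,
      D t <-> exists k : Z,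
        real_interval closed_l closed_r a b (t + 2 * PI * IZR k).

Definition class_E3 (phi : C -> C) : Prop :=
  entire phi /\
  Rbar_le (order phi) 1 /\
  (exists theta : R, dom_indicator phi theta) /\
  angle_interval (dom_indicator phi).

(* Finite part of the indicator diagram. *)
Definition indicator_diagram (phi : C -> C) (p : C) : Prop :=
  forall theta : R,
    Rbar_le (Re (p * Cexp (- (Ci * RtoC theta)))%C) (indicator phi theta).

Definition conj_diagram (phi : C -> C) (q : C) : Prop :=
  exists p : C, indicator_diagram phi p /\ q = Cconj p.

(* C minus exp (- K^dagger). *)
Definition continuation_domain (phi : C -> C) (z : C) : Prop :=
  ~ exists q : C, conj_diagram phi q /\ z = Cexp (- q)%C.

(* f is holomorphic on continuation_domain phi and its germ at 0 is the power
   series with coefficients phi 0, phi 1, phi 2, and so on.  The values of f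
   outside continuation_domain phi are irrelevant. *)
Definition is_continuation (phi f : C -> C) : Prop :=
  (forall z : C, continuation_domain phi z -> C_differentiable f z) /\
  exists r : R, 0 < r /\ forall z : C, Cmod z < r ->
    is_pseries (K := C_AbsRing) (V := C_NormedModule)
      (fun n => phi (RtoC (INR n))) z (f z).

(* sum_n a m has m + 1 terms, hence the predecessor when N > 0. *)
Definition S_ (phi : C -> C) (N : Z) (z : C) : C :=
  match N with
  | Z0 => RtoC 0
  | Zpos m =>
      sum_n (fun n => phi (RtoC (INR n)) * z ^ n)%C (pred (Pos.to_nat m))
  | Zneg m =>
      (- sum_n_m (fun n => phi (- RtoC (INR n)) * / z ^ n)%C 1 (Pos.to_nat m))%C
  end.

(* The integral of g over (0, +oo), as an absolutely convergent improper
   Riemann integral: for g continuous on (0, +oo) this is the Lebesgue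
   integral. *)
Definition is_integral_0_infty (g : R -> C) (l : C) : Prop :=
  ex_RInt_gen (fun x => Cmod (g x)) (at_right 0) (Rbar_locally p_infty) /\
  is_RInt_gen (V := C_R_NormedModule) g (at_right 0) (Rbar_locally p_infty) l.

(* Main.v *)
Require Import Defs.
From Stdlib Require Import Reals ZArith Lra Lia Psatz Classical ClassicalEpsilon.
From Coquelicot Require Import Coquelicot.
Open Scope R_scope.

(** The proof follows Hardy: the power series becomes a Mellin-Barnes integral, and
    Mellin inversion gives back its coefficient function.

    Growth.  From the order and the indicator at 0 and at +- PI / 2 alone,
    Phragmen-Lindelof arguments give |phi (x + i y)| <= K e^(a x + b |y|) for x >= 0
    (right_half_plane_bound) and type b in every vertical strip further left
    (left_strip_bound), with some b < PI.  So phi v e^(v zeta) / sin (PI v) decays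
    exponentially along vertical lines when |Im zeta| < PI - b.  Let Mell phi c zeta be
    its integral along Re v = c.  Moving the line across an integer n adds the residue
    2 phi n (- e^zeta)^n (Mell_shift_pole).  Hence - 1/2 Mell phi (-1/2) zeta is the sum
    of the power series at - e^zeta when Re zeta < - a (Mell_pseries), and subtracting
    S_N replaces the line -1/2 by N - 1/2 (barnes_minus_partial).

    Continuation.  Write z = e^(- w).  For b < |Im w| < 2 PI - b the Mell integral is
    turned into an Abel-Plana formula (Mell_plana): a part that is holomorphic for
    |Im w| < 2 PI - b, plus the integral of phi v e^(- v w) along a ray from 0.  The ray
    may be any one on which the integrand decays.  There is such a ray when w is outside
    the conjugate diagram (good_ray_of_diagram), and all of them give the same integral
    (ray_transform_indep); for two opposite rays this uses that phi is of exponential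
    type on a ray between them (opposite_decay).  The formula agrees with the power
    series for large Re w by the identity theorem (pser_plana) and takes equal values at
    w and w + 2 PI i (plana_wrap), so it defines the continuation (continuation_exists).
    In the sector of the points - e^zeta with |Im zeta| < PI - b, which contains the
    negative real axis and lies in the domain (sector_in_domain), every continuation is
    equal to - 1/2 Mell phi (-1/2) zeta, again by the identity theorem
    (continuation_barnes).

    Mellin transform.  With x = e^t and u = - s, the integrand is
    - 1/2 e^(- u t) Mell phi c t for any c between N - 1 and N.  Integrating under the
    integral sign divides the kernel by v - u (primitive_deriv).  The resulting
    primitive tends to 0 at + oo if c < Re u and at - oo if c > Re u (primitive_bound).
    The integral over (0, oo) is therefore the difference of two such primitives at
    t = 0, and Cauchy's formula in the strip between c1 < Re u < c2 evaluates it
    (primitive_jump). *)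

(** * Complex derivatives by increments *)

Lemma Ceq (x y : C) : Re x = Re y -> Im x = Im y -> x = y.
Proof. destruct x, y; simpl; congruence. Qed.

Ltac cring := apply Ceq; unfold Cminus, Cplus, Cmult, Copp, RtoC, Ci, Re, Im; simpl; ring.

Lemma Cmod_minus_sym (x y : C) : Cmod (x - y) = Cmod (y - x).
Proof. rewrite <- Cmod_opp. f_equal. ring. Qed.

Lemma Cminus_eq_0 (x y : C) : (x - y)%C = 0 -> x = y.
Proof. intros H. replace x with ((x - y) + y)%C by ring. rewrite H. ring. Qed.

Lemma Cmult_reg_l (a x y : C) : a <> 0 -> (a * x = a * y)%C -> x = y.
Proof.
  intros Ha H. replace x with (/ a * (a * x))%C by (field; auto). rewrite H. field; auto.
Qed.

Lemma RtoC_neq_0 (r : R) : r <> 0 -> RtoC r <> 0.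
Proof. intros H E. apply H. exact (f_equal Re E). Qed.

Lemma C2_neq_0 : RtoC 2 <> 0.
Proof. apply RtoC_neq_0. lra. Qed.

Lemma lt_Rmin (x a b : R) : x < Rmin a b -> x < a /\ x < b.
Proof. intros H. split; eapply Rlt_le_trans; [apply H|apply Rmin_l|apply H|apply Rmin_r]. Qed.

Ltac lt_Rmin H := apply lt_Rmin in H; destruct H as [? ?].

Lemma Im_le_Cmod (c : C) : Rabs (Im c) <= Cmod c.
Proof. eapply Rle_trans; [apply Rmax_r | apply (Rmax_Cmod c)]. Qed.

Lemma Im_near (z w : C) r : Cmod (z - w) < r - Rabs (Im w) -> Rabs (Im z) < r.
Proof.
  intros H. assert (X := Im_le_Cmod (z - w)). change (Im (z - w)) with (Im z - Im w) in X.
  assert (Y := Rabs_triang (Im z - Im w) (Im w)). replace (Im z - Im w + Im w) with (Im z) in Y by ring. lra.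
Qed.

Lemma Rabs_le_sum x a b : a <= x <= b -> Rabs x <= Rabs a + Rabs b.
Proof. unfold Rabs. repeat destruct Rcase_abs; lra. Qed.

Lemma Cmod_le_sum (c : C) : Cmod c <= Rabs (Re c) + Rabs (Im c).
Proof.
  destruct c as [x y]; simpl.
  replace (x, y) with (RtoC x + Ci * RtoC y)%C by (apply Ceq; simpl; ring).
  eapply Rle_trans; [apply Cmod_triangle|].
  rewrite Cmod_mult, Cmod_Ci, !Cmod_R. lra.
Qed.

Lemma Cmod_triangle_minus (x y : C) : Cmod (x - y) <= Cmod x + Cmod y.
Proof. unfold Cminus. rewrite <- (Cmod_opp y). apply Cmod_triangle. Qed.

(** Derivatives and continuity are handled through increments, for complex and for
    real variables alike; cderiv_is_derive, rderiv_is_derive and rcont_continuous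
    identify these notions with the usual ones. *)
Definition cderiv (f : C -> C) (z L : C) : Prop :=
  forall eps, 0 < eps -> exists d, 0 < d /\ forall h, Cmod h < d ->
    Cmod (f (z + h) - f z - h * L)%C <= eps * Cmod h.

Definition rderiv (g : R -> C) (t : R) (L : C) : Prop :=
  forall eps, 0 < eps -> exists d, 0 < d /\ forall h, Rabs h < d ->
    Cmod (g (t + h)%R - g t - RtoC h * L)%C <= eps * Rabs h.

Definition ccont (f : C -> C) (z : C) : Prop :=
  forall eps, 0 < eps -> exists d, 0 < d /\ forall h, Cmod h < d ->
    Cmod (f (z + h) - f z)%C < eps.

Definition rcont (g : R -> C) (t : R) : Prop :=
  forall eps, 0 < eps -> exists d, 0 < d /\ forall h, Rabs h < d ->
    Cmod (g (t + h)%R - g t)%C < eps.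

Lemma is_derive_eps {K : AbsRing} {V : NormedModule K} (f : K -> V) (x : K) (l : V) :
  is_derive f x l <->
  (forall eps, 0 < eps -> exists d, 0 < d /\ forall y, norm (minus y x) < d ->
    norm (minus (minus (f y) (f x)) (scal (minus y x) l)) <= eps * norm (minus y x)).
Proof.
  split.
  - intros [_ H] eps Heps.
    specialize (H x (fun P H => H) (mkposreal eps Heps)).
    simpl in H. apply (locally_le_locally_norm (V := AbsRing_NormedModule K)) in H.
    destruct H as [d Hd]. exists d. split; [apply cond_pos|].
    intros y Hy. apply (Hd y Hy).
  - intros H. split.
    + apply is_linear_scal_l.
    + intros y Hy. apply (is_filter_lim_locally_unique (V := AbsRing_NormedModule K)) in Hy. subst y.
      intros [eps Heps]. simpl.
      destruct (H eps Heps) as [d [Hd H']].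
      apply (locally_norm_le_locally (V := AbsRing_NormedModule K)). exists (mkposreal d Hd).
      intros y Hy. apply (H' y Hy).
Qed.

Lemma cderiv_is_derive f z L :
  cderiv f z L <-> is_derive (K := C_AbsRing) (V := C_NormedModule) f z L.
Proof.
  rewrite is_derive_eps. split; intros H eps Heps;
   destruct (H eps Heps) as [d [Hd H']]; exists d; split; auto.
  - intros y Hy. specialize (H' (y - z)%C Hy).
    assert (E : @eq C (z + (y - z))%C y) by ring. rewrite E in H'.
    exact H'.
  - intros h Hh. specialize (H' (z + h)%C).
    assert (E : ((z + h) - z = h)%C) by ring.
    change (minus (G := C_AbsRing) (z + h)%C z) with (z + h - z)%C in H'.
    rewrite E in H'. apply H'. exact Hh.
Qed.

Lemma rderiv_is_derive g t L :
  rderiv g t L <-> is_derive (K := R_AbsRing) (V := C_R_NormedModule) g t L.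
Proof.
  assert (S : forall (h : R), scal (V := C_R_NormedModule) h L = (RtoC h * L)%C).
  { intros h. apply Ceq; simpl; unfold scal; simpl; unfold mult; simpl; ring. }
  rewrite is_derive_eps. split; intros H eps Heps;
   destruct (H eps Heps) as [d [Hd H']]; exists d; split; auto.
  - intros y Hy. specialize (H' (y - t) Hy).
    rewrite S.
    assert (E : @eq R (t + (y - t)) y) by ring. rewrite E in H'.
    rewrite Cmod_norm in H'. exact H'.
  - intros h Hh. specialize (H' (t + h)).
    assert (E : (t + h) - t = h) by ring.
    change (minus (G := R_AbsRing) (t + h) t) with (t + h - t) in H'.
    rewrite E, S in H'. rewrite Cmod_norm. apply H'. exact Hh.
Qed.

Lemma rcont_continuous g t :
  rcont g t <-> continuous (U := C_R_NormedModule) g t.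
Proof.
  split.
  - intros H. apply filterlim_locally. intros [eps Heps].
    destruct (H eps Heps) as [d [Hd H']].
    exists (mkposreal d Hd). intros y Hy.
    specialize (H' (y - t) Hy). assert (E : @eq R (t + (y - t)) y) by ring. rewrite E in H'.
    apply (norm_compat1 (V := C_R_NormedModule)). rewrite <- Cmod_norm. exact H'.
  - intros H eps Heps.
    assert (H1 := proj1 (filterlim_locally_ball_norm (U := C_R_NormedModule) (F := locally t) g (g t)) H (mkposreal eps Heps)).
    destruct H1 as [d Hd]. exists d. split; [apply cond_pos|].
    intros h Hh. specialize (Hd (t + h)).
    unfold ball_norm in Hd. rewrite <- Cmod_norm in Hd. apply Hd.
    unfold ball; simpl. unfold AbsRing_ball; simpl. unfold abs, minus, plus, opp; simpl.
    replace (t + h + - t) with h by ring. exact Hh.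
Qed.

Lemma cderiv_is_derive' f z L :
  cderiv f z L <-> is_derive (K := C_AbsRing) (V := AbsRing_NormedModule C_AbsRing) f z L.
Proof. rewrite cderiv_is_derive, !is_derive_eps. split; auto. Qed.

Lemma cderiv_ext f g z L : (forall x, f x = g x) -> cderiv f z L -> cderiv g z L.
Proof. intros E H eps He. destruct (H eps He) as [d [Hd H']]. exists d; split; auto.
  intros h Hh. rewrite <- !E. auto. Qed.

Lemma cderiv_ext_loc f g z L : (exists r, 0 < r /\ forall x, Cmod (x - z) < r -> f x = g x) ->
  cderiv f z L -> cderiv g z L.
Proof. intros [r [Hr E]] H eps He. destruct (H eps He) as [d [Hd H']]. exists (Rmin d r); split.
  apply Rmin_pos; auto.
  intros h Hh. lt_Rmin Hh. rewrite <- !E; auto.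
  - replace (z - z)%C with (RtoC 0) by ring. rewrite Cmod_0; auto.
  - replace (z + h - z)%C with h by ring. auto.
Qed.

Lemma cderiv_plus f g z L M : cderiv f z L -> cderiv g z M ->
  cderiv (fun x => f x + g x)%C z (L + M)%C.
Proof. rewrite !cderiv_is_derive. apply @is_derive_plus. Qed.

Lemma cderiv_mult f g z L M : cderiv f z L -> cderiv g z M ->
  cderiv (fun x => f x * g x)%C z (L * g z + f z * M)%C.
Proof. rewrite !cderiv_is_derive'. intros H1 H2.
  apply (is_derive_mult (K := C_AbsRing) f g z L M H1 H2).
  intros; apply Cmult_comm. Qed.

Lemma cderiv_comp f g z L M : cderiv f (g z) L -> cderiv g z M ->
  cderiv (fun x => f (g x))%C z (M * L)%C.
Proof. rewrite (cderiv_is_derive f), (cderiv_is_derive' g), cderiv_is_derive. intros H1 H2.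
  apply (is_derive_comp (K := C_AbsRing) (V := C_NormedModule) f g z L M H1 H2). Qed.

Lemma cderiv_const (c z : C) : cderiv (fun _ => c) z 0.
Proof. rewrite cderiv_is_derive. apply @is_derive_const. Qed.

Lemma cderiv_id (z : C) : cderiv (fun x => x) z 1.
Proof. rewrite cderiv_is_derive'. apply @is_derive_id. Qed.

Lemma cderiv_shift (z0 z : C) : cderiv (fun x => x - z0)%C z 1.
Proof.
  replace (RtoC 1) with (1 + 0)%C by ring.
  apply (cderiv_plus (fun x => x) (fun _ => - z0)%C); auto using cderiv_id, cderiv_const.
Qed.

Lemma cderiv_scal (c : C) f z L : cderiv f z L -> cderiv (fun x => c * f x)%C z (c * L)%C.
Proof.
  intros H. replace (c * L)%C with (0 * f z + c * L)%C by ring.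
  apply (cderiv_mult (fun _ => c)); auto using cderiv_const.
Qed.

(** A remainder of second order: in this form the exponential, power series and
    integrals with a parameter are differentiated. *)
Lemma cderiv_quadratic f z L d K : 0 < d -> 0 <= K ->
  (forall h, Cmod h < d -> Cmod (f (z + h) - f z - h * L)%C <= K * (Cmod h * Cmod h)) ->
  cderiv f z L.
Proof.
  intros Hd HK H eps He. exists (Rmin d (eps / (K + 1))).
  assert (0 < eps / (K + 1)) by (apply Rdiv_lt_0_compat; lra).
  split; [apply Rmin_pos; auto|]. intros h Hh. lt_Rmin Hh.
  eapply Rle_trans; [apply H; auto|].
  assert (0 <= Cmod h) by apply Cmod_ge_0.
  rewrite <- Rmult_assoc. apply Rmult_le_compat_r; auto.
  assert ((K + 1) * Cmod h <= eps).
  { apply Rle_trans with ((K + 1) * (eps / (K + 1))).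
    apply Rmult_le_compat_l; lra. right; field; lra. }
  nra.
Qed.

Lemma cderiv_inv_id (z : C) : z <> 0 -> cderiv (fun x => / x)%C z (- / (z * z))%C.
Proof.
  intros Hz. assert (P := proj1 (Cmod_gt_0 z) Hz).
  assert (P3 : 0 < Cmod z * Cmod z * Cmod z) by (repeat apply Rmult_lt_0_compat; auto).
  apply cderiv_quadratic with (Cmod z / 2) (2 / (Cmod z * Cmod z * Cmod z)).
  lra. apply Rlt_le, Rdiv_lt_0_compat; lra.
  intros h Hh.
  assert (T : Cmod z / 2 <= Cmod (z + h)).
  { assert (X := Cmod_triangle_minus (z + h) h). replace (z + h - h)%C with z in X by ring. lra. }
  assert (N : (z + h <> 0)%C) by (apply Cmod_gt_0; lra).
  replace (/ (z + h) - / z - h * - / (z * z))%C with (h * h / (z * z * (z + h)))%C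
    by (field; auto).
  rewrite Cmod_div, !Cmod_mult by (repeat apply Cmult_neq_0; auto).
  assert (0 <= Cmod h * Cmod h) by (assert (0 <= Cmod h) by apply Cmod_ge_0; nra).
  unfold Rdiv at 1. rewrite Rmult_comm. apply Rmult_le_compat_r; auto.
  replace (2 / (Cmod z * Cmod z * Cmod z)) with (/ (Cmod z * Cmod z * (Cmod z / 2))) by (field; lra).
  apply Rinv_le_contravar; [|apply Rmult_le_compat_l; nra].
  apply Rmult_lt_0_compat; nra.
Qed.

Lemma cderiv_inv (f : C -> C) z L : f z <> 0 -> cderiv f z L ->
  cderiv (fun x => / f x)%C z (L * (- / (f z * f z)))%C.
Proof. intros. apply (cderiv_comp Cinv f); [apply cderiv_inv_id|]; auto. Qed.

Lemma cderiv_increment f z L : cderiv f z L ->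
  exists d, 0 < d /\ forall h, Cmod h < d -> Cmod (f (z + h) - f z)%C <= (Cmod L + 1) * Cmod h.
Proof.
  intros H. destruct (H 1 Rlt_0_1) as [d [Hd H']]. exists d; split; auto.
  intros h Hh. specialize (H' h Hh).
  replace (f (z + h) - f z)%C with ((f (z + h) - f z - h * L) + h * L)%C by ring.
  eapply Rle_trans; [apply Cmod_triangle|]. rewrite Cmod_mult. nra.
Qed.

Lemma small_mult K eps : 0 <= K -> 0 < eps -> exists d, 0 < d /\ forall x, 0 <= x -> x < d -> K * x < eps.
Proof.
  intros HK He. exists (eps / (K + 1)). split. apply Rdiv_lt_0_compat; lra.
  intros x Hx Hxd.
  assert ((K + 1) * x < eps).
  { apply Rlt_le_trans with ((K + 1) * (eps / (K + 1))).
    apply Rmult_lt_compat_l; lra. right; field; lra. }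
  nra.
Qed.

Lemma cderiv_ccont f z L : cderiv f z L -> ccont f z.
Proof.
  intros H eps He. destruct (cderiv_increment f z L H) as [d [Hd H']].
  destruct (small_mult (Cmod L + 1) eps) as [d2 [Hd2 H2]]; auto.
  { assert (0 <= Cmod L) by apply Cmod_ge_0. lra. }
  exists (Rmin d d2); split. apply Rmin_pos; auto.
  intros h Hh. lt_Rmin Hh. eapply Rle_lt_trans; [apply H'|apply H2]; auto using Cmod_ge_0.
Qed.

Definition holo (f : C -> C) (z : C) : Prop := exists L, cderiv f z L.

Lemma holo_differentiable f z : holo f z <-> C_differentiable f z.
Proof. split; intros [L H]; exists L; apply cderiv_is_derive; auto. Qed.

Lemma holo_ccont f z : holo f z -> ccont f z.
Proof. intros [L H]. eapply cderiv_ccont; eauto. Qed.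

Lemma holo_ext f g z : (forall x, f x = g x) -> holo f z -> holo g z.
Proof. intros E [L H]. exists L. eapply cderiv_ext; eauto. Qed.
Lemma holo_ext_loc f g z : (exists r, 0 < r /\ forall x, Cmod (x - z) < r -> f x = g x) ->
  holo f z -> holo g z.
Proof. intros E [L H]. exists L. eapply cderiv_ext_loc; eauto. Qed.
Lemma holo_const c z : holo (fun _ => c) z.
Proof. eexists; apply cderiv_const. Qed.
Lemma holo_id z : holo (fun x => x) z.
Proof. eexists; apply cderiv_id. Qed.
Lemma holo_plus f g z : holo f z -> holo g z -> holo (fun x => f x + g x)%C z.
Proof. intros [L H] [M K]. eexists; eapply cderiv_plus; eauto. Qed.
Lemma holo_mult f g z : holo f z -> holo g z -> holo (fun x => f x * g x)%C z.
Proof. intros [L H] [M K]. eexists; eapply cderiv_mult; eauto. Qed.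
Lemma holo_opp f z : holo f z -> holo (fun x => - f x)%C z.
Proof. intros H. apply holo_ext with (fun x => (- (1)) * f x)%C. intros; ring.
  apply holo_mult; auto using holo_const. Qed.
Lemma holo_minus f g z : holo f z -> holo g z -> holo (fun x => f x - g x)%C z.
Proof. intros. apply holo_plus; auto using holo_opp. Qed.
Lemma holo_inv (f : C -> C) z : f z <> 0 -> holo f z -> holo (fun x => / f x)%C z.
Proof. intros N [L H]. eexists; eapply cderiv_inv; eauto. Qed.
Lemma holo_div (f g : C -> C) z : g z <> 0 -> holo f z -> holo g z -> holo (fun x => f x / g x)%C z.
Proof. intros. apply holo_mult; auto using holo_inv. Qed.
Lemma holo_comp f g z : holo f (g z) -> holo g z -> holo (fun x => f (g x)) z.
Proof. intros [L H] [M K]. eexists; eapply cderiv_comp; eauto. Qed.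
Lemma holo_pow f n z : holo f z -> holo (fun x => f x ^ n)%C z.
Proof. intros H. induction n; simpl; auto using holo_const, holo_mult. Qed.

Lemma rderiv_increment g t L : rderiv g t L ->
  exists d, 0 < d /\ forall h, Rabs h < d -> Cmod (g (t + h)%R - g t)%C <= (Cmod L + 1) * Rabs h.
Proof.
  intros H. destruct (H 1 Rlt_0_1) as [d [Hd H']]. exists d; split; auto.
  intros h Hh. specialize (H' h Hh).
  replace (g (t + h)%R - g t)%C with ((g (t + h)%R - g t - h * L) + h * L)%C by ring.
  eapply Rle_trans; [apply Cmod_triangle|]. rewrite Cmod_mult, Cmod_R. nra.
Qed.

Lemma rderiv_rcont g t L : rderiv g t L -> rcont g t.
Proof.
  intros H eps He. destruct (rderiv_increment g t L H) as [d [Hd H']].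
  destruct (small_mult (Cmod L + 1) eps) as [d2 [Hd2 H2]]; auto.
  { assert (0 <= Cmod L) by apply Cmod_ge_0. lra. }
  exists (Rmin d d2); split. apply Rmin_pos; auto.
  intros h Hh. lt_Rmin Hh. eapply Rle_lt_trans; [apply H'|apply H2]; auto using Rabs_pos.
Qed.

Lemma rderiv_comp F g t L m : cderiv F (g t) L -> rderiv g t m -> rderiv (fun x => F (g x)) t (m * L)%C.
Proof.
  intros HF Hg eps He.
  assert (Lp := Cmod_ge_0 L). assert (mp := Cmod_ge_0 m).
  destruct (HF (eps / 2 / (Cmod m + 1))) as [d1 [Hd1 H1]].
  { repeat apply Rdiv_lt_0_compat; lra. }
  destruct (Hg (eps / 2 / (Cmod L + 1))) as [d2 [Hd2 H2]].
  { repeat apply Rdiv_lt_0_compat; lra. }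
  destruct (rderiv_increment g t m Hg) as [d3 [Hd3 H3]].
  destruct (small_mult (Cmod m + 1) d1) as [d4 [Hd4 H4]]; auto. lra.
  exists (Rmin (Rmin d2 d3) d4). split. repeat apply Rmin_pos; auto.
  intros h Hh.
  apply lt_Rmin in Hh. destruct Hh as [Hh h4]. apply lt_Rmin in Hh. destruct Hh as [h2 h3].
  set (k := (g (t + h)%R - g t)%C).
  assert (E : g (t + h) = (g t + k)%C) by (unfold k; ring).
  specialize (H2 h h2). specialize (H3 h h3). fold k in H2, H3.
  rewrite E.
  replace (F (g t + k) - F (g t) - h * (m * L))%C
    with ((F (g t + k) - F (g t) - k * L) + (k - h * m) * L)%C by ring.
  eapply Rle_trans; [apply Cmod_triangle|]. rewrite (Cmod_mult _ L).
  assert (Hp := Rabs_pos h).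
  assert (H1' := H1 k (Rle_lt_trans _ _ _ H3 (H4 _ Hp h4))).
  assert (A : eps / 2 / (Cmod m + 1) * Cmod k <= eps / 2 * Rabs h).
  { apply Rle_trans with (eps / 2 / (Cmod m + 1) * ((Cmod m + 1) * Rabs h)).
    apply Rmult_le_compat_l; auto. apply Rlt_le; repeat apply Rdiv_lt_0_compat; lra.
    right; field; lra. }
  assert (B : Cmod (k - h * m) * Cmod L <= eps / 2 * Rabs h).
  { apply Rle_trans with (eps / 2 / (Cmod L + 1) * Rabs h * (Cmod L + 1)).
    apply Rmult_le_compat; auto using Cmod_ge_0. lra.
    right; field; lra. }
  lra.
Qed.

Lemma rderiv_pair (x y : R -> R) t a b : is_derive x t a -> is_derive y t b ->
  rderiv (fun s => (x s, y s)) t (a, b).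
Proof.
  rewrite !is_derive_eps. intros H1 H2 eps He.
  destruct (H1 (eps / 2)) as [d1 [Hd1 H1']]. lra.
  destruct (H2 (eps / 2)) as [d2 [Hd2 H2']]. lra.
  exists (Rmin d1 d2). split. apply Rmin_pos; auto.
  intros h Hh.
  apply lt_Rmin in Hh. destruct Hh as [h1 h2].
  specialize (H1' (t + h)). specialize (H2' (t + h)).
  change (minus (G := R_AbsRing) (t + h) t) with (t + h - t) in *.
  replace (t + h - t) with h in * by ring.
  specialize (H1' h1). specialize (H2' h2).
  eapply Rle_trans; [apply Cmod_le_sum|]. simpl.
  replace (x (t + h) + - x t + - (h * a - 0 * b)) with (x (t + h) - x t - h * a) by ring.
  replace (y (t + h) + - y t + - (h * b + 0 * a)) with (y (t + h) - y t - h * b) by ring.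
  unfold norm in *; simpl in *. unfold abs, minus, plus, opp, scal, mult in *; simpl in *.
  unfold mult in *; simpl in *. unfold Rminus. lra.
Qed.

Lemma rderiv_ext g g' t L : (forall x, g x = g' x) -> rderiv g t L -> rderiv g' t L.
Proof. intros E H eps He. destruct (H eps He) as [d [Hd H']]. exists d; split; auto.
  intros h Hh. rewrite <- !E. auto. Qed.

Lemma rderiv_line (p d : C) t : rderiv (fun s => p + RtoC s * d)%C t d.
Proof.
  apply rderiv_ext with (fun s => (Re p + s * Re d, Im p + s * Im d)%R).
  { intros x. cring. }
  assert (X : rderiv (fun s => (Re p + s * Re d, Im p + s * Im d)%R) t (Re d, Im d)).
  { apply rderiv_pair; auto_derive; auto; ring. }
  destruct d; exact X.
Qed.

Lemma rcont_comp F g t : ccont F (g t) -> rcont g t -> rcont (fun x => F (g x)) t.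
Proof.
  intros HF Hg eps He. destruct (HF eps He) as [d1 [Hd1 H1]].
  destruct (Hg d1 Hd1) as [d2 [Hd2 H2]]. exists d2; split; auto.
  intros h Hh. specialize (H1 _ (H2 h Hh)).
  replace (g t + (g (t + h)%R - g t))%C with (g (t + h)) in H1 by ring. auto.
Qed.

Lemma rcont_line (p d : C) t : rcont (fun s => p + RtoC s * d)%C t.
Proof. eapply rderiv_rcont, rderiv_line. Qed.

Lemma rcont_ext g g' t : (forall x, g x = g' x) -> rcont g t -> rcont g' t.
Proof. intros E H eps He. destruct (H eps He) as [d [Hd H']]. exists d; split; auto.
  intros h Hh. rewrite <- !E. auto. Qed.

Lemma rcont_const c t : rcont (fun _ => c) t.
Proof. intros eps He. exists 1. split. lra. intros. replace (c - c)%C with (RtoC 0) by ring. rewrite Cmod_0; auto. Qed.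

Lemma rcont_plus f g t : rcont f t -> rcont g t -> rcont (fun x => f x + g x)%C t.
Proof. rewrite !rcont_continuous. intros. apply (continuous_plus (V := C_R_NormedModule)); auto. Qed.

Lemma Cmult_near (F G : C) eps : 0 < eps -> exists d, 0 < d /\ forall u v, Cmod u < d -> Cmod v < d ->
  Cmod ((F + u) * (G + v) - F * G) < eps.
Proof.
  intros Heps.
  assert (Fp := Cmod_ge_0 F). assert (Gp := Cmod_ge_0 G).
  assert (Hpos : 0 < eps / (Cmod F + Cmod G + 2)) by (apply Rdiv_lt_0_compat; lra).
  exists (Rmin 1 (eps / (Cmod F + Cmod G + 2))). split. apply Rmin_pos; lra.
  set (e := Rmin 1 (eps / (Cmod F + Cmod G + 2))).
  assert (e1 : e <= 1) by apply Rmin_l.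
  assert (e2 : e * (Cmod F + Cmod G + 2) <= eps).
  { apply Rle_trans with (eps / (Cmod F + Cmod G + 2) * (Cmod F + Cmod G + 2)).
    apply Rmult_le_compat_r. lra. apply Rmin_r. right; field; lra. }
  intros u v Hu Hv.
  replace ((F + u) * (G + v) - F * G)%C with (u * G + F * v + u * v)%C by ring.
  eapply Rle_lt_trans; [apply Cmod_triangle|].
  eapply Rle_lt_trans; [apply Rplus_le_compat_r, Cmod_triangle|].
  rewrite !Cmod_mult.
  assert (up := Cmod_ge_0 u). assert (vp := Cmod_ge_0 v). nra.
Qed.

Lemma rcont_mult f g t : rcont f t -> rcont g t -> rcont (fun x => f x * g x)%C t.
Proof.
  intros Hf Hg eps He. destruct (Cmult_near (f t) (g t) eps He) as [d [Hd H]].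
  destruct (Hf d Hd) as [d1 [Hd1 H1]]. destruct (Hg d Hd) as [d2 [Hd2 H2]].
  exists (Rmin d1 d2). split. apply Rmin_pos; auto.
  intros h Hh. lt_Rmin Hh. specialize (H (f (t + h)%R - f t)%C (g (t + h)%R - g t)%C ltac:(auto) ltac:(auto)).
  replace (f (t + h)%R * g (t + h)%R)%C with ((f t + (f (t + h)%R - f t)) * (g t + (g (t + h)%R - g t)))%C by ring.
  auto.
Qed.

Lemma rcont_RtoC (x : R -> R) t : continuous x t -> rcont (fun s => RtoC (x s)) t.
Proof.
  intros H eps He.
  assert (H1 := proj1 (filterlim_locally (F := locally t) x (x t)) H (mkposreal eps He)).
  destruct H1 as [d Hd]. exists d. split; [apply cond_pos|].
  intros h Hh. rewrite <- RtoC_minus, Cmod_R. apply (Hd (t + h)).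
  change (Rabs (t + h - t) < d). replace (t + h - t) with h by ring. auto.
Qed.

Lemma rcont_Cmod g t : rcont g t -> continuous (fun s => Cmod (g s)) t.
Proof.
  intros H. apply filterlim_locally. intros [eps He].
  destruct (H eps He) as [d [Hd H']]. exists (mkposreal d Hd).
  intros y Hy. change (Rabs (y - t) < d) in Hy. specialize (H' _ Hy).
  assert (E : @eq R (t + (y - t)) y) by ring. rewrite E in H'.
  change (Rabs (Cmod (g y) - Cmod (g t)) < eps).
  eapply Rle_lt_trans; [|apply H'].
  assert (X := Cmod_triangle (g y - g t) (g t)). replace (g y - g t + g t)%C with (g y) in X by ring.
  assert (Y := Cmod_triangle (g t - g y) (g y)). replace (g t - g y + g y)%C with (g t) in Y by ring.
  rewrite (Cmod_minus_sym (g t)) in Y.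
  apply Rabs_le. lra.
Qed.

(** * The complex exponential *)

Lemma Cexp_add x y : Cexp (x + y) = (Cexp x * Cexp y)%C.
Proof.
  destruct x as [a b], y as [c d]. unfold Cexp; simpl.
  rewrite exp_plus, cos_plus, sin_plus. cring.
Qed.

Lemma Cexp_0 : Cexp 0 = 1.
Proof. unfold Cexp; simpl. rewrite exp_0, cos_0, sin_0. cring. Qed.

Lemma Cmod_Cexp z : Cmod (Cexp z) = exp (Re z).
Proof.
  replace (Cexp z) with (RtoC (exp (Re z)) * (cos (Im z), sin (Im z)))%C by (unfold Cexp; cring).
  rewrite Cmod_mult, Cmod_R, Rabs_pos_eq by apply Rlt_le, exp_pos.
  unfold Cmod; simpl. rewrite !Rmult_1_r.
  replace (cos (Im z) * cos (Im z) + sin (Im z) * sin (Im z)) with 1.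
  rewrite sqrt_1; ring.
  generalize (sin2_cos2 (Im z)); unfold Rsqr; lra.
Qed.

Lemma Cexp_neq_0 z : Cexp z <> 0.
Proof. apply Cmod_gt_0. rewrite Cmod_Cexp. apply exp_pos. Qed.

Lemma Cexp_opp_mult z : (Cexp (- z) * Cexp z = 1)%C.
Proof. rewrite <- Cexp_add. replace (- z + z)%C with (RtoC 0) by ring. apply Cexp_0. Qed.

Lemma Cexp_opp z : Cexp (- z) = (/ Cexp z)%C.
Proof.
  assert (H := Cexp_neq_0 z). rewrite <- (Cmult_1_r (Cexp (- z))).
  rewrite <- (Cinv_r (Cexp z)) by auto. rewrite Cmult_assoc, Cexp_opp_mult. ring.
Qed.

Lemma Cexp_RtoC x : Cexp (RtoC x) = RtoC (exp x).
Proof. unfold Cexp; simpl. rewrite cos_0, sin_0. cring. Qed.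

Lemma Cexp_nat_mult n z : Cexp (RtoC (INR n) * z) = (Cexp z ^ n)%C.
Proof.
  induction n.
  - simpl. rewrite <- Cexp_0. f_equal. ring.
  - rewrite S_INR, Cpow_S, <- IHn, <- Cexp_add. f_equal. rewrite RtoC_plus. ring.
Qed.

Lemma rderiv_Cexp_line p u t : rderiv (fun s => Cexp (p + RtoC s * u)) t (u * Cexp (p + RtoC t * u))%C.
Proof.
  destruct p as [p q], u as [a b].
  apply rderiv_ext with (fun s => (exp (p + s * a) * cos (q + s * b), exp (p + s * a) * sin (q + s * b))%R).
  { intros x. unfold Cexp; simpl.
    replace (p + (x * a - 0 * b)) with (p + x * a) by ring.
    replace (q + (x * b + 0 * a)) with (q + x * b) by ring. auto. }
  unfold Cexp; simpl.
  replace (p + (t * a - 0 * b)) with (p + t * a) by ring.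
  replace (q + (t * b + 0 * a)) with (q + t * b) by ring.
  unfold Cmult; simpl.
  apply rderiv_pair; auto_derive; auto; ring.
Qed.

(** * Integrals of complex-valued functions of a real variable *)

Definition CInt (g : R -> C) (a b : R) : C := RInt (V := C_R_CompleteNormedModule) g a b.

Definition cont_seg (g : R -> C) (a b : R) : Prop := forall t, a <= t <= b -> rcont g t.

Lemma cont_seg_ex g a b : a <= b -> cont_seg g a b -> ex_RInt (V := C_R_CompleteNormedModule) g a b.
Proof.
  intros Hab H. apply ex_RInt_continuous. intros z Hz.
  rewrite Rmin_left, Rmax_right in Hz by auto.
  apply rcont_continuous, H, Hz.
Qed.

Lemma cont_seg_sub g a b c d : cont_seg g a b -> a <= c -> d <= b -> cont_seg g c d.
Proof. intros H ? ? t Ht. apply H. lra. Qed.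

Lemma CInt_ext f g a b : a <= b -> (forall t, a <= t <= b -> f t = g t) -> CInt f a b = CInt g a b.
Proof. intros Hab H. apply (RInt_ext (V := C_R_CompleteNormedModule)). intros x Hx. rewrite Rmin_left, Rmax_right in Hx by auto.
  apply H. lra. Qed.

Lemma CInt_point g a : CInt g a a = 0.
Proof. apply (RInt_point (V := C_R_CompleteNormedModule)). Qed.

Lemma CInt_Chasles g a b c : a <= b -> b <= c -> cont_seg g a c ->
  (CInt g a b + CInt g b c = CInt g a c)%C.
Proof.
  intros. apply (RInt_Chasles (V := C_R_CompleteNormedModule)); apply cont_seg_ex; auto;
    eapply cont_seg_sub; eauto; lra.
Qed.

Lemma CInt_plus f g a b : a <= b -> cont_seg f a b -> cont_seg g a b ->
  (CInt (fun t => f t + g t)%C a b = CInt f a b + CInt g a b)%C.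
Proof. intros. apply (RInt_plus (V := C_R_CompleteNormedModule)); apply cont_seg_ex; auto. Qed.

Lemma is_CInt_cmul (c : C) g a b l : is_RInt (V := C_R_NormedModule) g a b l ->
  is_RInt (V := C_R_NormedModule) (fun t => c * g t)%C a b (c * l)%C.
Proof.
  intros H.
  assert (H1 := is_RInt_fct_extend_fst _ _ _ _ H).
  assert (H2 := is_RInt_fct_extend_snd _ _ _ _ H).
  replace (c * l)%C with ((Re c * fst l - Im c * snd l, Re c * snd l + Im c * fst l)%R : C) by reflexivity.
  apply is_RInt_fct_extend_pair; simpl.
  - apply (is_RInt_minus (V := R_NormedModule)).
    apply (is_RInt_scal (V := R_NormedModule) _ _ _ (Re c) _ H1).
    apply (is_RInt_scal (V := R_NormedModule) _ _ _ (Im c) _ H2).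
  - apply (is_RInt_plus (V := R_NormedModule)).
    apply (is_RInt_scal (V := R_NormedModule) _ _ _ (Re c) _ H2).
    apply (is_RInt_scal (V := R_NormedModule) _ _ _ (Im c) _ H1).
Qed.

Lemma CInt_correct g a b : a <= b -> cont_seg g a b -> is_RInt (V := C_R_NormedModule) g a b (CInt g a b).
Proof. intros. apply (RInt_correct (V := C_R_CompleteNormedModule)). apply cont_seg_ex; auto. Qed.

Lemma CInt_cmul c g a b : a <= b -> cont_seg g a b ->
  (CInt (fun t => c * g t)%C a b = c * CInt g a b)%C.
Proof.
  intros. apply (is_RInt_unique (V := C_R_CompleteNormedModule)).
  apply is_CInt_cmul, CInt_correct; auto.
Qed.

Lemma cont_seg_cmul c g a b : cont_seg g a b -> cont_seg (fun t => c * g t)%C a b.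
Proof. intros H t Ht. apply rcont_mult; auto using rcont_const. Qed.

Lemma CInt_opp g a b : a <= b -> cont_seg g a b -> (CInt (fun t => - g t)%C a b = - CInt g a b)%C.
Proof.
  intros. rewrite (CInt_ext _ (fun t => (- (1)) * g t)%C); auto. rewrite CInt_cmul; auto. ring.
  intros; ring.
Qed.

Lemma CInt_minus f g a b : a <= b -> cont_seg f a b -> cont_seg g a b ->
  (CInt (fun t => f t - g t)%C a b = CInt f a b - CInt g a b)%C.
Proof.
  intros. unfold Cminus. rewrite (CInt_plus f (fun t => - g t)%C), CInt_opp; auto.
  intros t Ht. apply rcont_ext with (fun t => (- (1)) * g t)%C. intros; ring. apply cont_seg_cmul with a b; auto.
Qed.

Lemma CInt_bound g k a b l : a <= b -> cont_seg g a b -> (forall t, a <= t <= b -> Cmod (g t) <= k t) ->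
  is_RInt k a b l -> Cmod (CInt g a b) <= l.
Proof.
  intros. rewrite Cmod_norm.
  apply (norm_RInt_le (V := C_R_NormedModule) g k a b); auto.
  - intros. rewrite <- Cmod_norm. auto.
  - apply CInt_correct; auto.
Qed.

Lemma CInt_bound_const g M a b : a <= b -> cont_seg g a b -> (forall t, a <= t <= b -> Cmod (g t) <= M) ->
  Cmod (CInt g a b) <= M * (b - a).
Proof.
  intros. apply CInt_bound with (fun _ => M); auto.
  rewrite Rmult_comm. apply (is_RInt_const (V := R_NormedModule) a b M).
Qed.

Lemma CInt_FTC F f a b : a <= b -> (forall t, a <= t <= b -> rderiv F t (f t)) -> cont_seg f a b ->
  CInt f a b = (F b - F a)%C.
Proof.
  intros Hab HF Hf. apply (is_RInt_unique (V := C_R_CompleteNormedModule)).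
  apply (is_RInt_derive (V := C_R_CompleteNormedModule)); intros x Hx;
  rewrite Rmin_left, Rmax_right in Hx by auto.
  - apply rderiv_is_derive; auto.
  - apply rcont_continuous; auto.
Qed.

Lemma Cmod_increment F f M a b : a <= b -> (forall t, a <= t <= b -> rderiv F t (f t)) -> cont_seg f a b ->
  (forall t, a <= t <= b -> Cmod (f t) <= M) -> Cmod (F b - F a)%C <= M * (b - a).
Proof. intros. rewrite <- (CInt_FTC F f); auto. apply CInt_bound_const; auto. Qed.

Lemma rcont_Cexp_line p u t : rcont (fun s => Cexp (p + RtoC s * u)) t.
Proof. eapply rderiv_rcont, rderiv_Cexp_line. Qed.

(** * The derivative of the exponential *)

Lemma exp_le x y : x <= y -> exp x <= exp y.
Proof. intros [H|H]. left; apply exp_increasing; auto. subst; lra. Qed.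

Lemma exp_le_1 x : x <= 0 -> exp x <= 1.
Proof. intros. rewrite <- exp_0. apply exp_le; auto. Qed.

Lemma exp_half_ln t : 0 < t -> exp (ln t / 2) = sqrt t.
Proof.
  intros Ht. assert (Hs : 0 < sqrt t) by (apply sqrt_lt_R0; auto).
  rewrite <- (exp_ln (sqrt t)) by auto. f_equal.
  assert (X : ln t = ln (sqrt t) + ln (sqrt t)) by (rewrite <- ln_mult, sqrt_sqrt by lra; auto).
  lra.
Qed.

Lemma linear_le_exp k e t : 0 < k -> 0 < e -> t <= k / e * exp (e / k * t).
Proof.
  intros Hk He. apply Rle_trans with (k / e * (e / k * t)). right; field; lra.
  apply Rmult_le_compat_l. apply Rlt_le, Rdiv_lt_0_compat; auto.
  generalize (exp_ineq1_le (e / k * t)); lra.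
Qed.

(** This estimate and the next one integrate the derivative along the segment from 0
    to u. *)
Lemma Cexp_minus_1 u : Cmod (Cexp u - 1)%C <= Cmod u * exp (Cmod u).
Proof.
  assert (H := Cmod_increment (fun s => Cexp (0 + RtoC s * u)) (fun s => u * Cexp (0 + RtoC s * u))%C
    (Cmod u * exp (Cmod u)) 0 1 Rle_0_1). cbv beta in H.
  replace (0 + 1 * u)%C with u in H by ring. replace (0 + 0 * u)%C with (RtoC 0) in H by ring.
  rewrite Cexp_0 in H. rewrite Rminus_0_r, Rmult_1_r in H. apply H.
  - intros. apply rderiv_Cexp_line.
  - intros t Ht. apply rcont_mult; auto using rcont_const, rcont_Cexp_line.
  - intros t Ht. rewrite Cmod_mult, Cmod_Cexp. apply Rmult_le_compat_l. apply Cmod_ge_0.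
    apply exp_le. replace (Re (0 + t * u)) with (t * Re u) by (destruct u; simpl; ring).
    assert (A := re_le_Cmod u). assert (B := Rle_abs (Re u)). assert (D := Cmod_ge_0 u). nra.
Qed.

Lemma Cexp_taylor1 u : Cmod (Cexp u - 1 - u)%C <= Cmod u * Cmod u * exp (Cmod u).
Proof.
  assert (H := Cmod_increment (fun s => Cexp (0 + RtoC s * u) - (0 + RtoC s * u))%C
    (fun s => u * (Cexp (RtoC s * u) - 1))%C
    (Cmod u * Cmod u * exp (Cmod u)) 0 1 Rle_0_1).
  cbv beta in H.
  replace (0 + 1 * u)%C with u in H by ring. replace (0 + 0 * u)%C with (RtoC 0) in H by ring.
  rewrite Cexp_0 in H. rewrite Rminus_0_r, Rmult_1_r in H.
  replace (Cexp u - 1 - u)%C with (Cexp u - u - (1 - 0))%C by ring. apply H.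
  - intros t Ht.
    replace (u * (Cexp (t * u) - 1))%C with (u * Cexp (0 + t * u) + (- (1)) * u)%C
      by (replace (0 + t * u)%C with (t * u)%C by ring; ring).
    intros eps He.
    destruct (rderiv_Cexp_line 0 u t eps He) as [d [Hd H']]. exists d; split; auto.
    intros h Hh. specialize (H' h Hh).
    replace (Cexp (0 + (t + h)%R * u) - (0 + (t + h)%R * u) - (Cexp (0 + t * u) - (0 + t * u)) -
      h * (u * Cexp (0 + t * u) + - (1) * u))%C with
     (Cexp (0 + (t + h)%R * u) - Cexp (0 + t * u) - h * (u * Cexp (0 + t * u)))%C; auto.
    rewrite RtoC_plus. ring.
  - intros t Ht. apply rcont_mult; auto using rcont_const.
    apply rcont_ext with (fun s => Cexp (0 + RtoC s * u) + (- (1)))%C.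
    intros. replace (0 + x * u)%C with (x * u)%C by ring. ring.
    apply rcont_plus; auto using rcont_const, rcont_Cexp_line.
  - intros t Ht. rewrite Cmod_mult, Rmult_assoc. apply Rmult_le_compat_l. apply Cmod_ge_0.
    eapply Rle_trans; [apply Cexp_minus_1|]. rewrite Cmod_mult, Cmod_R, Rabs_pos_eq by lra.
    assert (D := Cmod_ge_0 u).
    apply Rmult_le_compat. nra. apply Rlt_le, exp_pos. nra. apply exp_le. nra.
Qed.

Lemma cderiv_Cexp z : cderiv Cexp z (Cexp z).
Proof.
  apply cderiv_quadratic with 1 (exp (Re z) * exp 1). lra.
  apply Rmult_le_pos; apply Rlt_le, exp_pos.
  intros h Hh. rewrite Cexp_add.
  replace (Cexp z * Cexp h - Cexp z - h * Cexp z)%C with (Cexp z * (Cexp h - 1 - h))%C by ring.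
  rewrite Cmod_mult, Cmod_Cexp.
  rewrite Rmult_assoc. apply Rmult_le_compat_l. apply Rlt_le, exp_pos.
  eapply Rle_trans; [apply Cexp_taylor1|]. rewrite Rmult_comm.
  apply Rmult_le_compat_r. apply Rmult_le_pos; apply Cmod_ge_0. apply exp_le; lra.
Qed.

Lemma cderiv_Cexp_scal c z : cderiv (fun z => Cexp (c * z)) z (c * Cexp (c * z))%C.
Proof.
  assert (X := cderiv_comp Cexp _ z _ _ (cderiv_Cexp (c * z)%C) (cderiv_scal c _ z _ (cderiv_id z))).
  cbv beta in X. rewrite Cmult_1_r in X. exact X.
Qed.

Lemma holo_Cexp z : holo Cexp z.
Proof. eexists; apply cderiv_Cexp. Qed.

Lemma holo_Cexp_comp f z : holo f z -> holo (fun x => Cexp (f x)) z.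
Proof. intros. apply (holo_comp Cexp); auto using holo_Cexp. Qed.

Create HintDb hol.
#[export] Hint Resolve holo_const holo_id holo_plus holo_minus holo_mult holo_opp holo_pow holo_Cexp_comp holo_ccont : hol.

(** * Goursat's theorem for rectangles *)

(** Counterclockwise along the boundary of the rectangle with sides Re z = a,
    Re z = b, Im z = c, Im z = d. *)
Definition rect_int (f : C -> C) (a b c d : R) : C :=
  (CInt (fun x => f (x, c)) a b + Ci * CInt (fun y => f (b, y)) c d
   - CInt (fun x => f (x, d)) a b - Ci * CInt (fun y => f (a, y)) c d)%C.

Definition in_rect (a b c d : R) (z : C) : Prop := a <= Re z <= b /\ c <= Im z <= d.

Lemma rderiv_hor c t : rderiv (fun x => (x, c)) t 1.
Proof. apply (rderiv_pair (fun x => x) (fun _ => c)); auto_derive; auto. Qed.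
Lemma rderiv_ver b t : rderiv (fun y => (b, y)) t Ci.
Proof. apply (rderiv_pair (fun _ => b) (fun y => y)); auto_derive; auto. Qed.

Lemma rcont_hor f c t : ccont f (t, c) -> rcont (fun x => f (x, c)) t.
Proof. intros. apply (rcont_comp f (fun x => (x, c))); auto. eapply rderiv_rcont, rderiv_hor. Qed.
Lemma rcont_ver f b t : ccont f (b, t) -> rcont (fun y => f (b, y)) t.
Proof. intros. apply (rcont_comp f (fun y => (b, y))); auto. eapply rderiv_rcont, rderiv_ver. Qed.

Definition cont_rect (f : C -> C) a b c d := forall z, in_rect a b c d z -> ccont f z.

Lemma cont_rect_hor f a b c d y : cont_rect f a b c d -> c <= y <= d -> cont_seg (fun x => f (x, y)) a b.
Proof. intros H Hy t Ht. apply rcont_hor, H. split; simpl; auto. Qed.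
Lemma cont_rect_ver f a b c d x : cont_rect f a b c d -> a <= x <= b -> cont_seg (fun y => f (x, y)) c d.
Proof. intros H Hy t Ht. apply rcont_ver, H. split; simpl; auto. Qed.

Lemma cont_rect_sub f a b c d a' b' c' d' : cont_rect f a b c d -> a <= a' -> b' <= b -> c <= c' -> d' <= d ->
  cont_rect f a' b' c' d'.
Proof. intros H ? ? ? ? z [? ?]. apply H. split; lra. Qed.

#[export] Hint Extern 4 (_ <= _) => lra : rect.
#[export] Hint Extern 4 (_ <= _ <= _) => lra : rect.
#[export] Hint Resolve cont_rect_hor cont_rect_ver : rect.

Lemma rect_int_split_v f a m b c d : a <= m <= b ->
  cont_seg (fun x => f (x, c)) a b -> cont_seg (fun x => f (x, d)) a b ->
  (rect_int f a b c d = rect_int f a m c d + rect_int f m b c d)%C.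
Proof.
  intros. unfold rect_int. rewrite <- (CInt_Chasles (fun x => f (x, c)) a m b), <- (CInt_Chasles (fun x => f (x, d)) a m b)
    by (auto; lra). ring.
Qed.

Lemma rect_int_split_h f a b c m d : c <= m <= d ->
  cont_seg (fun y => f (a, y)) c d -> cont_seg (fun y => f (b, y)) c d ->
  (rect_int f a b c d = rect_int f a b c m + rect_int f a b m d)%C.
Proof.
  intros. unfold rect_int. rewrite <- (CInt_Chasles (fun y => f (a, y)) c m d), <- (CInt_Chasles (fun y => f (b, y)) c m d)
    by (auto; lra). ring.
Qed.

Definition cont_boundary (f : C -> C) a b c d :=
  cont_seg (fun x => f (x, c)) a b /\ cont_seg (fun x => f (x, d)) a b /\
  cont_seg (fun y => f (a, y)) c d /\ cont_seg (fun y => f (b, y)) c d.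

Lemma cont_rect_boundary f a b c d : a <= b -> c <= d -> cont_rect f a b c d -> cont_boundary f a b c d.
Proof. intros. repeat split; eauto with rect. Qed.

Lemma rect_int_minus f g a b c d : a <= b -> c <= d -> cont_boundary f a b c d -> cont_boundary g a b c d ->
  rect_int (fun z => f z - g z)%C a b c d = (rect_int f a b c d - rect_int g a b c d)%C.
Proof.
  intros Hab Hcd [F1 [F2 [F3 F4]]] [G1 [G2 [G3 G4]]]. unfold rect_int.
  rewrite !(CInt_minus (fun x => f (x, _)) (fun x => g (x, _))) by auto.
  rewrite !(CInt_minus (fun x => f (_, x)) (fun x => g (_, x))) by auto.
  ring.
Qed.

Lemma rect_int_bound f M a b c d : a <= b -> c <= d ->
  cont_boundary f a b c d ->
  (forall x, a <= x <= b -> Cmod (f (x, c)) <= M /\ Cmod (f (x, d)) <= M) ->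
  (forall y, c <= y <= d -> Cmod (f (a, y)) <= M /\ Cmod (f (b, y)) <= M) ->
  Cmod (rect_int f a b c d) <= 2 * M * ((b - a) + (d - c)).
Proof.
  intros Hab Hcd [H1 [H2 [H3 H4]]] B1 B2. unfold rect_int.
  assert (X1 := CInt_bound_const _ M _ _ Hab H1 (fun t Ht => proj1 (B1 t Ht))).
  assert (X2 := CInt_bound_const _ M _ _ Hab H2 (fun t Ht => proj2 (B1 t Ht))).
  assert (X3 := CInt_bound_const _ M _ _ Hcd H3 (fun t Ht => proj1 (B2 t Ht))).
  assert (X4 := CInt_bound_const _ M _ _ Hcd H4 (fun t Ht => proj2 (B2 t Ht))).
  eapply Rle_trans; [apply Cmod_triangle_minus|]. rewrite Cmod_mult, Cmod_Ci.
  eapply Rle_trans; [apply Rplus_le_compat_r, Cmod_triangle_minus|].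
  eapply Rle_trans; [apply Rplus_le_compat_r, Rplus_le_compat_r, Cmod_triangle|].
  rewrite Cmod_mult, Cmod_Ci. lra.
Qed.

Lemma CInt_hor_primitive F f a b c : a <= b -> (forall x, a <= x <= b -> cderiv F (x, c) (f (x, c))) ->
  cont_seg (fun x => f (x, c)) a b -> CInt (fun x => f (x, c)) a b = (F (b, c) - F (a, c))%C.
Proof.
  intros. apply (CInt_FTC (fun x => F (x, c))); auto.
  intros. replace (f (t, c)) with (1 * f (t, c))%C by ring.
  apply (rderiv_comp F (fun x => (x, c))); auto. apply rderiv_hor.
Qed.

Lemma CInt_ver_primitive F f a c d : c <= d -> (forall y, c <= y <= d -> cderiv F (a, y) (f (a, y))) ->
  cont_seg (fun y => f (a, y)) c d -> (Ci * CInt (fun y => f (a, y)) c d = F (a, d) - F (a, c))%C.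
Proof.
  intros. rewrite <- CInt_cmul by auto. apply (CInt_FTC (fun x => F (a, x))); auto.
  intros.
  apply (rderiv_comp F (fun x => (a, x))); auto. apply rderiv_ver. apply cont_seg_cmul; auto.
Qed.

Lemma rect_int_primitive F f a b c d : a <= b -> c <= d -> cont_rect f a b c d ->
  (forall z, in_rect a b c d z -> cderiv F z (f z)) -> rect_int f a b c d = 0.
Proof.
  intros Hab Hcd Hc HF. unfold rect_int.
  rewrite !(CInt_hor_primitive F), !(CInt_ver_primitive F); eauto with rect; try ring;
  intros; apply HF; split; simpl; lra.
Qed.

(** Bisect twice; each time one half carries at least half of the integral. *)
Lemma goursat_step f a b c d : a <= b -> c <= d -> cont_rect f a b c d ->
  exists a' b' c' d', a <= a' /\ a' <= b' /\ b' <= b /\ c <= c' /\ c' <= d' /\ d' <= d /\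
   b' - a' = (b - a) / 2 /\ d' - c' = (d - c) / 2 /\
   Cmod (rect_int f a b c d) <= 4 * Cmod (rect_int f a' b' c' d').
Proof.
  intros Hab Hcd Hc.
  assert (Hv : exists a' b', a <= a' /\ a' <= b' /\ b' <= b /\ b' - a' = (b - a) / 2 /\
     Cmod (rect_int f a b c d) <= 2 * Cmod (rect_int f a' b' c d)).
  { rewrite (rect_int_split_v f a ((a + b) / 2) b c d) by eauto with rect.
    assert (T := Cmod_triangle (rect_int f a ((a + b) / 2) c d) (rect_int f ((a + b) / 2) b c d)).
    destruct (Rle_dec (Cmod (rect_int f a ((a + b) / 2) c d)) (Cmod (rect_int f ((a + b) / 2) b c d))).
    - exists ((a + b) / 2), b. repeat split; lra.
    - exists a, ((a + b) / 2). repeat split; lra. }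
  destruct Hv as [a' [b' [H1 [H2 [H3 [H4 H5]]]]]].
  assert (Hc' : cont_rect f a' b' c d) by (eapply cont_rect_sub; eauto; lra).
  assert (Hh : exists c' d', c <= c' /\ c' <= d' /\ d' <= d /\ d' - c' = (d - c) / 2 /\
     Cmod (rect_int f a' b' c d) <= 2 * Cmod (rect_int f a' b' c' d')).
  { rewrite (rect_int_split_h f a' b' c ((c + d) / 2) d) by eauto with rect.
    assert (T := Cmod_triangle (rect_int f a' b' c ((c + d) / 2)) (rect_int f a' b' ((c + d) / 2) d)).
    destruct (Rle_dec (Cmod (rect_int f a' b' c ((c + d) / 2))) (Cmod (rect_int f a' b' ((c + d) / 2) d))).
    - exists ((c + d) / 2), d. repeat split; lra.
    - exists c, ((c + d) / 2). repeat split; lra. }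
  destruct Hh as [c' [d' [K1 [K2 [K3 [K4 K5]]]]]].
  exists a', b', c', d'. repeat split; auto. lra.
Qed.

Record rct := Rct { ra : R; rb : R; rc : R; rd : R }.

Lemma nested_common_point (a b : nat -> R) :
  (forall n, a n <= a (S n)) -> (forall n, b (S n) <= b n) -> (forall n, a n <= b n) ->
  exists x, forall n, a n <= x <= b n.
Proof.
  intros Ha Hb Hab.
  assert (Ha' : forall n k, a n <= a (n + k)%nat).
  { intros n k. induction k. rewrite Nat.add_0_r; lra. rewrite Nat.add_succ_r. eapply Rle_trans; eauto. }
  assert (Hb' : forall n k, b (n + k)%nat <= b n).
  { intros n k. induction k. rewrite Nat.add_0_r; lra. rewrite Nat.add_succ_r. eapply Rle_trans; eauto. }
  assert (Hc : forall n m, a n <= b m).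
  { intros n m. destruct (Nat.le_ge_cases n m).
    - replace m with (n + (m - n))%nat by lia. eapply Rle_trans; [apply Ha'|apply Hab].
    - replace n with (m + (n - m))%nat by lia. eapply Rle_trans; [apply Hab|apply Hb']. }
  destruct (completeness (fun x => exists n, x = a n)) as [x [H1 H2]].
  - exists (b O). intros y [n ->]. auto.
  - exists (a O), O; auto.
  - exists x. intros n. split. apply H1. eauto. apply H2. intros y [k ->]. auto.
Qed.

(** In the n-th rectangle around the common point the linear part of f has a
    primitive and the rest is at most eps times the diameter, so its integral is
    O (eps / 4^n), which the factor 4^n from the bisections compensates. *)
Theorem goursat f a b c d : a <= b -> c <= d ->
  (forall z, in_rect a b c d z -> holo f z) -> rect_int f a b c d = 0.
Proof.
  intros Hab Hcd Hol.
  assert (Hc : cont_rect f a b c d) by (intros z Hz; apply holo_ccont; auto).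
  set (good := fun q => a <= ra q /\ ra q <= rb q /\ rb q <= b /\ c <= rc q /\ rc q <= rd q /\ rd q <= d).
  assert (step : forall q, exists q', good q -> good q' /\ ra q <= ra q' /\ rb q' <= rb q /\ rc q <= rc q' /\ rd q' <= rd q /\
     rb q' - ra q' = (rb q - ra q) / 2 /\ rd q' - rc q' = (rd q - rc q) / 2 /\
     Cmod (rect_int f (ra q) (rb q) (rc q) (rd q)) <= 4 * Cmod (rect_int f (ra q') (rb q') (rc q') (rd q'))).
  { intros q. destruct (classic (good q)) as [G|G]; [|exists q; tauto].
    destruct G as [G1 [G2 [G3 [G4 [G5 G6]]]]].
    destruct (goursat_step f (ra q) (rb q) (rc q) (rd q)) as [a' [b' [c' [d' H]]]]; auto.
    eapply cont_rect_sub; eauto.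
    exists (Rct a' b' c' d'). intros _. simpl. unfold good; simpl.
    decompose [and] H. repeat split; lra. }
  set (nxt := fun q => proj1_sig (constructive_indefinite_description _ (step q))).
  set (sq := fix sq n := match n with O => Rct a b c d | S n => nxt (sq n) end).
  assert (Hn : forall q, good q -> good (nxt q) /\ ra q <= ra (nxt q) /\ rb (nxt q) <= rb q /\ rc q <= rc (nxt q) /\ rd (nxt q) <= rd q /\
     rb (nxt q) - ra (nxt q) = (rb q - ra q) / 2 /\ rd (nxt q) - rc (nxt q) = (rd q - rc q) / 2 /\
     Cmod (rect_int f (ra q) (rb q) (rc q) (rd q)) <= 4 * Cmod (rect_int f (ra (nxt q)) (rb (nxt q)) (rc (nxt q)) (rd (nxt q)))).
  { intros q. unfold nxt. destruct (constructive_indefinite_description _ (step q)); auto. }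
  assert (Hg : forall n, good (sq n)).
  { induction n. unfold good; simpl. repeat split; lra. simpl. apply Hn; auto. }
  assert (S' : forall n, sq (S n) = nxt (sq n)) by auto.
  destruct (nested_common_point (fun n => ra (sq n)) (fun n => rb (sq n))) as [x Hx].
  { intros n. rewrite S'. apply Hn; auto. } { intros n. rewrite S'. apply Hn; auto. } { intros n. apply Hg. }
  destruct (nested_common_point (fun n => rc (sq n)) (fun n => rd (sq n))) as [y Hy].
  { intros n. rewrite S'. apply Hn; auto. } { intros n. rewrite S'. apply Hn; auto. } { intros n. apply Hg. }
  set (W := (b - a) + (d - c)). assert (HW : 0 <= W) by (unfold W; lra).
  assert (Hw : forall n, (rb (sq n) - ra (sq n)) + (rd (sq n) - rc (sq n)) = W * (/ 2) ^ n).
  { induction n. simpl. unfold W; ring. rewrite S'.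
    destruct (Hn _ (Hg n)) as [_ [_ [_ [_ [_ [E1 [E2 _]]]]]]]. rewrite E1, E2. simpl. lra. }
  assert (HR : forall n, Cmod (rect_int f a b c d) <= 4 ^ n * Cmod (rect_int f (ra (sq n)) (rb (sq n)) (rc (sq n)) (rd (sq n)))).
  { induction n. simpl; lra. rewrite S'.
    destruct (Hn _ (Hg n)) as [_ [_ [_ [_ [_ [_ [_ E3]]]]]]].
    eapply Rle_trans; [apply IHn|]. simpl. assert (0 < 4 ^ n) by (apply pow_lt; lra). nra. }
  set (z0 := (x, y) : C).
  destruct (Hol z0) as [L HL].
  { split; simpl. generalize (Hx O); simpl; lra. generalize (Hy O); simpl; lra. }
  assert (Key : forall eps, 0 < eps -> Cmod (rect_int f a b c d) <= 2 * eps * (W * W)).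
  { intros eps He. destruct (HL eps He) as [dl [Hd H']].
    destruct (small_mult W dl HW Hd) as [r [Hr Hr']].
    destruct (pow_lt_1_zero (/ 2)) with r as [n Hn']. rewrite Rabs_pos_eq; lra. auto.
    specialize (Hn' n (le_n n)). rewrite Rabs_pos_eq in Hn' by (apply pow_le; lra).
    assert (P2 : 0 <= (/ 2) ^ n) by (apply pow_le; lra).
    specialize (Hr' _ P2 Hn').
    eapply Rle_trans; [apply (HR n)|].
    specialize (Hw n). specialize (Hx n). specialize (Hy n). specialize (Hg n).
    clear Hn S'. destruct (sq n) as [a' b' c' d']; simpl in *.
    unfold good in Hg; simpl in Hg.
    (* the affine part of f at the common point z0 integrates to 0 *)
    set (A := fun z => (f z0 + (z - z0) * L)%C).
    assert (HA : rect_int A a' b' c' d' = 0).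
    { apply rect_int_primitive with (fun z => f z0 * z + (/ 2 * L) * ((z - z0) * (z - z0)))%C; try lra.
      - intros z _. apply holo_ccont. unfold A. auto 10 with hol.
      - intros z _. unfold A.
        assert (D1 := cderiv_scal (/ 2 * L) _ _ _ (cderiv_mult _ _ _ _ _ (cderiv_shift z0 z) (cderiv_shift z0 z))).
        assert (D2 := cderiv_plus _ _ _ _ _ (cderiv_scal (f z0) _ _ _ (cderiv_id z)) D1). cbv beta in D2.
        replace (f z0 + (z - z0) * L)%C with (f z0 * 1 + / 2 * L * (1 * (z - z0) + (z - z0) * 1))%C by field. exact D2. }
    assert (CA : cont_rect A a' b' c' d').
    { intros z _. apply holo_ccont. unfold A. auto 10 with hol. }
    assert (Cf : cont_rect f a' b' c' d') by (eapply cont_rect_sub; eauto; lra).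
    replace (rect_int f a' b' c' d') with (rect_int (fun z => f z - A z)%C a' b' c' d').
    2:{ rewrite rect_int_minus; try apply cont_rect_boundary; auto; try lra. rewrite HA. ring. }
    assert (CD : cont_rect (fun z => f z - A z)%C a' b' c' d').
    { intros z Hz. apply holo_ccont. apply holo_minus. apply Hol. destruct Hz; split; lra. unfold A. auto 10 with hol. }
    assert (B : forall z, in_rect a' b' c' d' z -> Cmod (f z - A z) <= eps * (W * (/ 2) ^ n)).
    { intros z [Z1 Z2]. assert (M : Cmod (z - z0) <= W * (/ 2) ^ n).
      { eapply Rle_trans; [apply Cmod_le_sum|]. unfold z0. destruct z; simpl in *.
        rewrite <- Hw. apply Rplus_le_compat; apply Rabs_le; lra. }
      unfold A. replace (f z - (f z0 + (z - z0) * L))%C with (f (z0 + (z - z0)) - f z0 - (z - z0) * L)%C.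
      eapply Rle_trans; [apply H'; lra|]. apply Rmult_le_compat_l; lra.
      replace (z0 + (z - z0))%C with z by ring. ring. }
    assert (RB : Cmod (rect_int (fun z => f z - A z)%C a' b' c' d') <= 2 * (eps * (W * (/ 2) ^ n)) * ((b' - a') + (d' - c'))).
    { apply rect_int_bound; try lra. apply cont_rect_boundary; try lra. exact CD.
      - intros x' Hx'. split; apply B; split; simpl; lra.
      - intros y' Hy'. split; apply B; split; simpl; lra. }
    apply Rle_trans with (4 ^ n * (2 * (eps * (W * (/ 2) ^ n)) * (W * (/ 2) ^ n))).
    apply Rmult_le_compat_l. apply pow_le; lra. rewrite <- Hw at 2. auto.
    replace (4 ^ n * (2 * (eps * (W * (/ 2) ^ n)) * (W * (/ 2) ^ n))) with
      ((4 ^ n * ((/ 2) ^ n * (/ 2) ^ n)) * (2 * eps * (W * W))) by ring.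
    rewrite <- !Rpow_mult_distr. replace (4 * (/ 2 * / 2)) with 1 by field. rewrite pow1. lra. }
  apply Cmod_eq_0. apply Rle_antisym; [|apply Cmod_ge_0].
  apply le_epsilon. intros e He. rewrite Rplus_0_l.
  eapply Rle_trans; [apply (Key (e / (2 * (W * W) + 1)))|].
  apply Rdiv_lt_0_compat; auto; nra.
  assert (0 <= W * W) by nra.
  replace (2 * (e / (2 * (W * W) + 1)) * (W * W)) with (e * (2 * (W * W) / (2 * (W * W) + 1))) by (field; lra).
  rewrite <- (Rmult_1_r e) at 2. apply Rmult_le_compat_l. lra.
  apply Rle_div_l; lra.
Qed.

(** * The logarithm and the residue theorem for rectangles *)

(** The principal branch, on the right half-plane only; other half-planes are
    reached by a rotation of the argument. *)
Definition Clog (z : C) : C := (ln (Re z * Re z + Im z * Im z) / 2, atan (Im z / Re z)).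

Lemma Cexp_Clog z : 0 < Re z -> Cexp (Clog z) = z.
Proof.
  destruct z as [x y]; unfold Cexp, Clog; simpl; intros Hx.
  assert (Hr : 0 < x * x + y * y) by nra.
  assert (Hs : 0 < sqrt (x * x + y * y)) by (apply sqrt_lt_R0; auto).
  assert (E := exp_half_ln _ Hr).
  assert (S : sqrt (1 + Rsqr (y / x)) = sqrt (x * x + y * y) / x).
  { replace (1 + Rsqr (y / x)) with ((x * x + y * y) / (x * x)) by (unfold Rsqr; field; lra).
    rewrite sqrt_div_alt, sqrt_square by nra. auto. }
  rewrite E, cos_atan, sin_atan, S. f_equal; field; lra.
Qed.

Lemma ccont_pair (u v : C -> R) z :
  continuous (T := C_UniformSpace) (U := R_UniformSpace) u z ->
  continuous (T := C_UniformSpace) (U := R_UniformSpace) v z -> ccont (fun z => (u z, v z)) z.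
Proof.
  intros Hu Hv eps He.
  assert (H1 := proj1 (filterlim_locally (F := locally z) u (u z)) Hu (mkposreal (eps / 2) ltac:(lra))).
  assert (H2 := proj1 (filterlim_locally (F := locally z) v (v z)) Hv (mkposreal (eps / 2) ltac:(lra))).
  destruct H1 as [d1 H1], H2 as [d2 H2].
  exists (Rmin d1 d2). split. apply Rmin_pos; apply cond_pos.
  assert (B : forall (h : C) (d : posreal), Cmod h < d -> ball z d (z + h)%C).
  { intros h d Hh. destruct z as [x y], h as [p q]. split; simpl.
    change (Rabs (x + p - x) < d). replace (x + p - x) with p by ring.
    eapply Rle_lt_trans; [apply (re_le_Cmod (p, q))|auto].
    change (Rabs (y + q - y) < d). replace (y + q - y) with q by ring.
    eapply Rle_lt_trans; [apply (Im_le_Cmod (p, q))|auto]. }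
  intros h Hh. apply lt_Rmin in Hh. destruct Hh as [h1 h2].
  specialize (H1 _ (B _ _ h1)). specialize (H2 _ (B _ _ h2)).
  eapply Rle_lt_trans; [apply Cmod_le_sum|]. simpl.
  change (Rabs (u (z + h)%C - u z) < eps / 2) in H1.
  change (Rabs (v (z + h)%C - v z) < eps / 2) in H2. unfold Rminus in *. lra.
Qed.

Lemma ccont_Clog z : 0 < Re z -> ccont Clog z.
Proof.
  intros Hz. apply ccont_pair.
  - apply (continuous_comp (U := C_UniformSpace) (V := R_UniformSpace) (W := R_UniformSpace)
     (fun z => Re z * Re z + Im z * Im z) (fun r => ln r / 2)).
    + apply (continuous_plus (U := C_UniformSpace) (V := R_NormedModule)); apply (continuous_mult (U := C_UniformSpace) (K := R_AbsRing));
      first [apply (continuous_fst (U := R_UniformSpace) (V := R_UniformSpace)) | apply (continuous_snd (U := R_UniformSpace) (V := R_UniformSpace))].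
    + assert (0 < Re z * Re z + Im z * Im z) by nra.
      apply (ex_derive_continuous (K := R_AbsRing) (V := R_NormedModule)). auto_derive. auto.
  - apply (continuous_comp (U := C_UniformSpace) (V := R_UniformSpace) (W := R_UniformSpace)
     (fun z => Im z / Re z) atan).
    + apply (continuous_mult (U := C_UniformSpace) (K := R_AbsRing)).
      apply (continuous_snd (U := R_UniformSpace) (V := R_UniformSpace)).
      apply (continuous_comp (U := C_UniformSpace) (V := R_UniformSpace) (W := R_UniformSpace) Re Rinv).
      apply (continuous_fst (U := R_UniformSpace) (V := R_UniformSpace)).
      apply continuous_Rinv. lra.
    + apply (ex_derive_continuous (K := R_AbsRing) (V := R_NormedModule)). auto_derive. auto.
Qed.

(** The logarithm inherits its derivative from the exponential: with
    k the increment of g, h = exp (g z) (exp k - 1). *)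
Lemma cderiv_log_branch g (z : C) : z <> 0 -> ccont g z ->
  (exists r, 0 < r /\ forall h, Cmod h < r -> Cexp (g (z + h)%C) = (z + h)%C) ->
  cderiv g z (/ z)%C.
Proof.
  intros Hz Hc [r [Hr E]].
  destruct (Hc (/ 8)) as [d [Hd H']]. lra.
  assert (Pz := proj1 (Cmod_gt_0 z) Hz).
  apply cderiv_quadratic with (Rmin r d) (12 / (Cmod z * Cmod z)).
  apply Rmin_pos; auto. apply Rlt_le, Rdiv_lt_0_compat; nra.
  intros h Hh. apply lt_Rmin in Hh. destruct Hh as [h1 h2].
  specialize (H' h h2). set (k := (g (z + h) - g z)%C) in *.
  assert (E0 : Cexp (g z) = z).
  { rewrite <- (Cplus_0_r z) at 1. rewrite E. ring. rewrite Cmod_0; auto. }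
  assert (Eh : (h / z = Cexp k - 1)%C).
  { apply Cmult_reg_l with z; auto.
    replace (z * (h / z))%C with h by (field; auto).
    replace (z * (Cexp k - 1))%C with (Cexp k * z - z)%C by ring.
    rewrite <- E0 at 1. rewrite <- Cexp_add. unfold k.
    replace (g (z + h) - g z + g z)%C with (g (z + h)%C) by ring. rewrite E by auto. ring. }
  assert (T := Cexp_taylor1 k). rewrite <- Eh in T.
  assert (e3 : exp (Cmod k) <= 3).
  { eapply Rle_trans; [|apply exp_le_3]. apply exp_le. lra. }
  assert (kp := Cmod_ge_0 k).
  assert (T' : Cmod (h / z - k) <= 3 * (Cmod k * Cmod k)).
  { eapply Rle_trans; [apply T|]. rewrite Rmult_comm. apply Rmult_le_compat_r; nra. }
  assert (K : Cmod k <= 2 * Cmod (h / z)).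
  { assert (X := Cmod_triangle (h / z) (- (h / z - k))). rewrite Cmod_opp in X.
    replace (h / z + - (h / z - k))%C with k in X by ring. nra. }
  rewrite Cmod_minus_sym in T'.
  replace (k - h * / z)%C with (k - h / z)%C by (unfold Cdiv; ring).
  eapply Rle_trans; [apply T'|].
  rewrite Cmod_div in K by auto.
  assert (0 <= Cmod h / Cmod z) by (apply Rmult_le_pos; [apply Cmod_ge_0| apply Rlt_le, Rinv_0_lt_compat; auto]).
  replace (12 / (Cmod z * Cmod z) * (Cmod h * Cmod h)) with (3 * ((2 * (Cmod h / Cmod z)) * (2 * (Cmod h / Cmod z)))) by (field; lra).
  apply Rmult_le_compat_l. lra. apply Rmult_le_compat; auto.
Qed.

Lemma cderiv_Clog z : 0 < Re z -> cderiv Clog z (/ z)%C.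
Proof.
  intros Hz. apply cderiv_log_branch.
  - intros ->. simpl in Hz. lra.
  - apply ccont_Clog; auto.
  - exists (Re z). split; auto. intros h Hh. apply Cexp_Clog.
    assert (X := re_le_Cmod h). apply Rabs_le_between in X.
    replace (Re (z + h)) with (Re z + Re h) by reflexivity. lra.
Qed.

Lemma ccont_inv_shift (z0 z : C) : z <> z0 -> ccont (fun z => / (z - z0))%C z.
Proof.
  intros Hz. apply holo_ccont, holo_inv; auto with hol. apply Cminus_eq_contra; auto.
Qed.

Lemma cderiv_Clog_rot (u z0 z : C) : 0 < Re (u * (z - z0)) ->
  cderiv (fun z => Clog (u * (z - z0)))%C z (/ (z - z0))%C.
Proof.
  intros H.
  assert (N : (u * (z - z0) <> 0)%C) by (intros E; rewrite E in H; simpl in H; lra).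
  assert (N1 : u <> 0) by (intros E; apply N; rewrite E; ring).
  assert (N2 : (z - z0)%C <> 0) by (intros E; apply N; rewrite E; ring).
  assert (D := cderiv_comp Clog _ z _ _ (cderiv_Clog _ H) (cderiv_scal u _ _ _ (cderiv_shift z0 z))). cbv beta in D.
  replace (/ (z - z0))%C with (u * 1 * / (u * (z - z0)))%C by (field; auto). exact D.
Qed.

Lemma cont_boundary_inv_shift z0 dl : 0 < dl ->
  cont_boundary (fun z => / (z - z0))%C (Re z0 - dl) (Re z0 + dl) (Im z0 - dl) (Im z0 + dl).
Proof.
  intros Hd. repeat split; intros t Ht; (apply (rcont_hor (fun z => / (z - z0))%C) || apply (rcont_ver (fun z => / (z - z0))%C)); apply ccont_inv_shift;
   intros E; assert (E1 := f_equal Re E); assert (E2 := f_equal Im E); simpl in E1, E2; lra.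
Qed.

(** On each side a rotation u brings u (z - z0) into the right half-plane, where its
    logarithm is a primitive of 1 / (z - z0); every side contributes i PI / 2. *)
Lemma rect_int_inv_square z0 dl : 0 < dl ->
  rect_int (fun z => / (z - z0))%C (Re z0 - dl) (Re z0 + dl) (Im z0 - dl) (Im z0 + dl) = (2 * PI * Ci)%C.
Proof.
  intros Hd. destruct (cont_boundary_inv_shift z0 dl Hd) as [H1 [H2 [H3 H4]]].
  unfold rect_int. destruct z0 as [x0 y0]; simpl in *.
  rewrite (CInt_hor_primitive (fun z => Clog (Ci * (z - (x0, y0))))%C (fun z => / (z - (x0, y0)))%C); auto; try lra.
  2:{ intros. apply cderiv_Clog_rot. simpl. lra. }
  rewrite (CInt_hor_primitive (fun z => Clog (- Ci * (z - (x0, y0))))%C (fun z => / (z - (x0, y0)))%C); auto; try lra.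
  2:{ intros. apply cderiv_Clog_rot. simpl. lra. }
  rewrite (CInt_ver_primitive (fun z => Clog (1 * (z - (x0, y0))))%C (fun z => / (z - (x0, y0)))%C); auto; try lra.
  2:{ intros. apply cderiv_Clog_rot. simpl. lra. }
  rewrite (CInt_ver_primitive (fun z => Clog (- (1) * (z - (x0, y0))))%C (fun z => / (z - (x0, y0)))%C); auto; try lra.
  2:{ intros. apply cderiv_Clog_rot. simpl. lra. }
  assert (L : forall p q : C, Re p = dl -> Im p = dl -> Re q = dl -> Im q = - dl ->
     (Clog p - Clog q)%C = (0, PI / 2)).
  { intros p q E1 E2 E3 E4. unfold Clog. rewrite E1, E2, E3, E4.
    replace (dl / dl) with 1 by (field; lra). replace (- dl / dl) with (- (1)) by (field; lra).
    rewrite atan_opp, atan_1. apply Ceq; simpl; try field.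
    replace (- dl * - dl) with (dl * dl) by ring. ring. }
  rewrite (L (Ci * _)%C), (L (1 * _)%C); try (simpl; ring).
  replace (Clog (- Ci * (((x0 + dl)%R, (y0 + dl)%R) - (x0, y0))) - Clog (- Ci * (((x0 - dl)%R, (y0 + dl)%R) - (x0, y0))))%C
   with (- ((0, PI / 2)%R : C))%C.
  replace (Clog (- (1) * (((x0 - dl)%R, (y0 + dl)%R) - (x0, y0))) - Clog (- (1) * (((x0 - dl)%R, (y0 - dl)%R) - (x0, y0))))%C
   with (- ((0, PI / 2)%R : C))%C.
  - apply Ceq; simpl; field.
  - rewrite <- (L (- (1) * (((x0 - dl)%R, (y0 - dl)%R) - (x0, y0)))%C (- (1) * (((x0 - dl)%R, (y0 + dl)%R) - (x0, y0)))%C);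
     first [ring | simpl; ring].
  - rewrite <- (L (- Ci * (((x0 - dl)%R, (y0 + dl)%R) - (x0, y0)))%C (- Ci * (((x0 + dl)%R, (y0 + dl)%R) - (x0, y0)))%C);
     first [ring | simpl; ring].
Qed.

(** Goursat's theorem shrinks the rectangle to a square of half-side dl around z0.
    There f is within eps / dl of A / (z - z0), and the perimeter 8 dl cancels dl. *)
Theorem residue_rect (f : C -> C) (A : C) a b c d z0 :
  a < Re z0 < b -> c < Im z0 < d ->
  (forall z, in_rect a b c d z -> z <> z0 -> holo f z) ->
  (forall eps, 0 < eps -> exists dl, 0 < dl /\ forall z, z <> z0 -> Cmod (z - z0) < dl ->
     Cmod ((z - z0) * f z - A)%C <= eps) ->
  rect_int f a b c d = (2 * PI * Ci * A)%C.
Proof.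
  intros Ha Hc Hol Hlim.
  assert (Sq : forall dl, 0 < dl -> a < Re z0 - dl -> Re z0 + dl < b -> c < Im z0 - dl -> Im z0 + dl < d ->
    rect_int f a b c d = rect_int f (Re z0 - dl) (Re z0 + dl) (Im z0 - dl) (Im z0 + dl)).
  { intros dl H0 H1 H2 H3 H4.
    assert (cv : forall x y, a <= x <= b -> c <= y <= d -> (x <> Re z0 \/ y <> Im z0) -> ccont f (x, y)).
    { intros x y Hx Hy N. apply holo_ccont, Hol. split; auto. intros <-. simpl in N. lra. }
    rewrite (rect_int_split_v f a (Re z0 - dl) b).
    2: lra. 2: intros t Ht; apply rcont_hor, cv; auto; lra. 2: intros t Ht; apply rcont_hor, cv; auto; lra.
    rewrite (rect_int_split_v f (Re z0 - dl) (Re z0 + dl) b).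
    2: lra. 2: intros t Ht; apply rcont_hor, cv; auto; lra. 2: intros t Ht; apply rcont_hor, cv; auto; lra.
    rewrite (rect_int_split_h f (Re z0 - dl) (Re z0 + dl) c (Im z0 - dl) d).
    2: lra. 2: intros t Ht; apply rcont_ver, cv; auto; lra. 2: intros t Ht; apply rcont_ver, cv; auto; lra.
    rewrite (rect_int_split_h f (Re z0 - dl) (Re z0 + dl) (Im z0 - dl) (Im z0 + dl) d).
    2: lra. 2: intros t Ht; apply rcont_ver, cv; auto; lra. 2: intros t Ht; apply rcont_ver, cv; auto; lra.
    rewrite (goursat f a (Re z0 - dl)), (goursat f (Re z0 + dl) b), (goursat f _ _ c), (goursat f _ _ _ d); try lra.
    ring.
    all: intros z [Z1 Z2]; apply Hol; [split; lra|intros ->; lra]. }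
  assert (Key : forall eps, 0 < eps -> Cmod (rect_int f a b c d - 2 * PI * Ci * A) <= 8 * eps).
  { intros eps He. destruct (Hlim eps He) as [r [Hr Hlim']].
    set (dl := Rmin (r / 4) (Rmin (Rmin ((Re z0 - a) / 2) ((b - Re z0) / 2)) (Rmin ((Im z0 - c) / 2) ((d - Im z0) / 2)))).
    assert (Hdl : 0 < dl) by (unfold dl; repeat apply Rmin_pos; lra).
    assert (D : dl <= r / 4 /\ dl <= (Re z0 - a) / 2 /\ dl <= (b - Re z0) / 2 /\ dl <= (Im z0 - c) / 2 /\ dl <= (d - Im z0) / 2).
    { unfold dl. repeat split.
      apply Rmin_l.
      eapply Rle_trans; [apply Rmin_r|]. eapply Rle_trans; [apply Rmin_l|]. apply Rmin_l.
      eapply Rle_trans; [apply Rmin_r|]. eapply Rle_trans; [apply Rmin_l|]. apply Rmin_r.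
      eapply Rle_trans; [apply Rmin_r|]. eapply Rle_trans; [apply Rmin_r|]. apply Rmin_l.
      eapply Rle_trans; [apply Rmin_r|]. eapply Rle_trans; [apply Rmin_r|]. apply Rmin_r. }
    clearbody dl. rewrite (Sq dl) by lra.
    set (g := fun z => (A * / (z - z0))%C).
    assert (Bd : forall p, in_rect (Re z0 - dl) (Re z0 + dl) (Im z0 - dl) (Im z0 + dl) p ->
       (Rabs (Re p - Re z0) = dl \/ Rabs (Im p - Im z0) = dl) ->
       ccont f p /\ ccont (fun z => / (z - z0))%C p /\ Cmod (f p - g p) <= eps / dl).
    { intros p [P1 P2] Pb.
      assert (N : p <> z0).
      { intros ->. rewrite !Rminus_diag, Rabs_R0 in Pb. lra. }
      split; [|split].
      - apply holo_ccont, Hol; auto. split; lra.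
      - apply ccont_inv_shift; auto.
      - assert (M1 : dl <= Cmod (p - z0)).
        { destruct Pb as [<-|<-]. apply (re_le_Cmod (p - z0)). apply (Im_le_Cmod (p - z0)). }
        assert (M2 : Cmod (p - z0) < r).
        { eapply Rle_lt_trans; [apply Cmod_le_sum|].
          change (Re (p - z0)) with (Re p - Re z0). change (Im (p - z0)) with (Im p - Im z0).
          assert (Rabs (Re p - Re z0) <= dl) by (apply Rabs_le; lra).
          assert (Rabs (Im p - Im z0) <= dl) by (apply Rabs_le; lra). lra. }
        assert (N' : (p - z0)%C <> 0) by (apply Cminus_eq_contra; auto).
        unfold g. replace (f p - A * / (p - z0))%C with (((p - z0) * f p - A) / (p - z0))%C by (field; auto).
        rewrite Cmod_div by auto.
        apply Rmult_le_compat. apply Cmod_ge_0. apply Rlt_le, Rinv_0_lt_compat; lra. apply Hlim'; auto.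
        apply Rinv_le_contravar; auto. }
    assert (BH : forall x, Re z0 - dl <= x <= Re z0 + dl -> forall y, y = Im z0 - dl \/ y = Im z0 + dl ->
       ccont f (x, y) /\ ccont (fun z => / (z - z0))%C (x, y) /\ Cmod (f (x, y) - g (x, y)) <= eps / dl).
    { intros x Hx y Hy. apply Bd. split; simpl; auto. destruct Hy; lra. right; simpl.
      destruct Hy; subst y. replace (Im z0 - dl - Im z0) with (- dl) by ring. rewrite Rabs_Ropp. apply Rabs_pos_eq; lra.
      replace (Im z0 + dl - Im z0) with (dl) by ring. apply Rabs_pos_eq; lra. }
    assert (BV : forall y, Im z0 - dl <= y <= Im z0 + dl -> forall x, x = Re z0 - dl \/ x = Re z0 + dl ->
       ccont f (x, y) /\ ccont (fun z => / (z - z0))%C (x, y) /\ Cmod (f (x, y) - g (x, y)) <= eps / dl).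
    { intros y Hy x Hx. apply Bd. split; simpl; auto. destruct Hx; lra. left; simpl.
      destruct Hx; subst x. replace (Re z0 - dl - Re z0) with (- dl) by ring. rewrite Rabs_Ropp. apply Rabs_pos_eq; lra.
      replace (Re z0 + dl - Re z0) with (dl) by ring. apply Rabs_pos_eq; lra. }
    assert (Cf : cont_boundary f (Re z0 - dl) (Re z0 + dl) (Im z0 - dl) (Im z0 + dl)).
    { repeat split; intros t Ht; (apply rcont_hor, BH || apply rcont_ver, BV); auto. }
    assert (Cg : cont_boundary g (Re z0 - dl) (Re z0 + dl) (Im z0 - dl) (Im z0 + dl)).
    { unfold g. repeat split; intros t Ht; apply rcont_mult; try apply rcont_const;
       (apply (rcont_hor (fun z => / (z - z0))%C), BH || apply (rcont_ver (fun z => / (z - z0))%C), BV); auto. }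
    assert (RG : rect_int g (Re z0 - dl) (Re z0 + dl) (Im z0 - dl) (Im z0 + dl) = (2 * PI * Ci * A)%C).
    { rewrite <- (rect_int_inv_square z0 dl Hdl).
      destruct (cont_boundary_inv_shift z0 dl Hdl) as [X1 [X2 [X3 X4]]].
      unfold rect_int, g. rewrite !(CInt_cmul A) by (auto; lra). ring. }
    rewrite <- RG, <- rect_int_minus; auto; try lra.
    eapply Rle_trans; [apply rect_int_bound with (M := eps / dl); try lra|].
    - destruct Cf as [F1 [F2 [F3 F4]]], Cg as [G1 [G2 [G3 G4]]].
      repeat split; intros t Ht; apply rcont_plus; auto;
      match goal with |- rcont (fun x => - g ?q)%C _ => apply rcont_ext with (fun x => - (1) * g q)%C end;
      try (intros; ring); apply rcont_mult; auto using rcont_const.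
    - intros x Hx. split; apply BH; auto.
    - intros y Hy. split; apply BV; auto.
    - right. field. lra. }
  apply Cminus_eq_0, Cmod_eq_0, Rle_antisym; [|apply Cmod_ge_0].
  apply le_epsilon. intros e He. rewrite Rplus_0_l. replace e with (8 * (e / 8)) by field. apply Key. lra.
Qed.

(** * Maximum modulus and uniqueness *)

Lemma cont_seg_bounded g a b : cont_seg g a b -> exists M, 0 < M /\ forall t, a <= t <= b -> Cmod (g t) <= M.
Proof.
  intros H. destruct (bounded_continuity (V := C_R_NormedModule) g a b) as [M HM].
  - intros x Hx. apply rcont_continuous; auto.
  - exists (Rmax M 1). split. eapply Rlt_le_trans; [apply Rlt_0_1|apply Rmax_r].
    intros t Ht. rewrite Cmod_norm. left. eapply Rlt_le_trans; [apply HM; auto|apply Rmax_l].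
Qed.

Lemma cauchy_formula (F : C -> C) a b c d z0 : a < Re z0 < b -> c < Im z0 < d ->
  (forall z, in_rect a b c d z -> holo F z) ->
  rect_int (fun z => F z / (z - z0))%C a b c d = (2 * PI * Ci * F z0)%C.
Proof.
  intros Ha Hc Hol. apply residue_rect with z0; auto.
  - intros z Hz N. apply holo_div; auto with hol. apply Cminus_eq_contra; auto.
  - intros eps He. destruct (holo_ccont F z0) with eps as [dl [Hd H']]; auto.
    { apply Hol. split; lra. }
    exists dl. split; auto. intros z N Hz.
    replace ((z - z0) * (F z / (z - z0)) - F z0)%C with (F (z0 + (z - z0)) - F z0)%C.
    left; auto. replace (z0 + (z - z0))%C with z by ring. field. apply Cminus_eq_contra; auto.
Qed.

Definition on_boundary (a b c d : R) (z : C) : Prop := Re z = a \/ Re z = b \/ Im z = c \/ Im z = d.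

(** Applying the integral formula to the powers of F removes the constant
    perimeter / distance in the estimate. *)
Theorem max_modulus (F : C -> C) M a b c d : 0 < M ->
  (forall z, in_rect a b c d z -> holo F z) ->
  (forall z, in_rect a b c d z -> on_boundary a b c d z -> Cmod (F z) <= M) ->
  forall z, in_rect a b c d z -> Cmod (F z) <= M.
Proof.
  intros HM Hol HB z0 Hz0.
  destruct (classic (on_boundary a b c d z0)) as [Hb|Hb]; auto.
  assert (Ha : a < Re z0 < b) by (unfold on_boundary in Hb; destruct Hz0; split; apply Rnot_le_lt; intros ?; apply Hb; lra).
  assert (Hc : c < Im z0 < d) by (unfold on_boundary in Hb; destruct Hz0; split; apply Rnot_le_lt; intros ?; apply Hb; lra).
  apply Rnot_lt_le. intros Hlt.
  set (dl := Rmin (Rmin (Re z0 - a) (b - Re z0)) (Rmin (Im z0 - c) (d - Im z0))).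
  assert (Hdl : 0 < dl) by (unfold dl; repeat apply Rmin_pos; lra).
  assert (D : dl <= (Re z0 - a) /\ dl <= (b - Re z0) /\ dl <= (Im z0 - c) /\ dl <= (d - Im z0)).
  { unfold dl. repeat split.
      eapply Rle_trans; [apply Rmin_l|]. apply Rmin_l.
      eapply Rle_trans; [apply Rmin_l|]. apply Rmin_r.
      eapply Rle_trans; [apply Rmin_r|]. apply Rmin_l.
      eapply Rle_trans; [apply Rmin_r|]. apply Rmin_r. }
  clearbody dl.
  set (P := (b - a) + (d - c)).
  set (q := Cmod (F z0) / M).
  assert (Hq : 1 < q) by (unfold q; apply Rlt_div_r; lra).
  assert (Key : forall n, 2 * PI * q ^ n <= 2 * / dl * P).
  { intros n.
    assert (E := cauchy_formula (fun z => F z ^ n)%C a b c d z0 Ha Hc ltac:(auto with hol)).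
    assert (B : Cmod (rect_int (fun z => F z ^ n / (z - z0))%C a b c d) <= 2 * (M ^ n * / dl) * P).
    { assert (HH : forall z, in_rect a b c d z -> on_boundary a b c d z -> holo (fun z => F z ^ n / (z - z0))%C z
         /\ Cmod (F z ^ n / (z - z0)) <= M ^ n * / dl).
      { intros z Hz Hzb.
        assert (Hd : dl <= Cmod (z - z0)).
        { assert (A1 := re_le_Cmod (z - z0)). assert (A2 := Im_le_Cmod (z - z0)).
          change (Re (z - z0)) with (Re z - Re z0) in A1. change (Im (z - z0)) with (Im z - Im z0) in A2.
          apply Rabs_le_between in A1. apply Rabs_le_between in A2.
          destruct Hzb as [Hzb|[Hzb|[Hzb|Hzb]]]; lra. }
        assert (N : (z - z0)%C <> 0) by (apply Cmod_gt_0; lra).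
        split. apply holo_div; auto with hol.
        rewrite Cmod_div, Cmod_pow by auto. apply Rmult_le_compat.
        apply pow_le, Cmod_ge_0. apply Rlt_le, Rinv_0_lt_compat; lra.
        apply pow_incr. split; auto. apply Cmod_ge_0. apply Rinv_le_contravar; lra. }
      apply rect_int_bound; try lra.
      - repeat split; intros t Ht;
        (apply (rcont_hor (fun z => F z ^ n / (z - z0))%C) || apply (rcont_ver (fun z => F z ^ n / (z - z0))%C)); apply holo_ccont, HH;
         unfold on_boundary, in_rect; simpl; auto; split; lra.
      - intros x Hx. split; apply (HH (_, _)); unfold on_boundary, in_rect; simpl; auto; split; lra.
      - intros x Hx. split; apply (HH (_, _)); unfold on_boundary, in_rect; simpl; auto; split; lra. }
    rewrite E in B. rewrite !Cmod_mult, Cmod_Ci, !Cmod_R, Cmod_pow, !Rabs_pos_eq in B.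
    2: generalize PI_RGT_0; lra. 2: lra.
    assert (Mn : 0 < M ^ n) by (apply pow_lt; auto).
    unfold q, Rdiv. rewrite Rpow_mult_distr, pow_inv.
    apply Rmult_le_reg_r with (M ^ n); auto.
    replace (2 * PI * (Cmod (F z0) ^ n * / M ^ n) * M ^ n) with (2 * PI * 1 * Cmod (F z0) ^ n) by (field; lra).
    lra. }
  destruct (Pow_x_infinity q) with (2 * / dl * P + 1) as [N HN].
  { rewrite Rabs_pos_eq; lra. }
  specialize (HN N (le_n N)). specialize (Key N).
  rewrite Rabs_pos_eq in HN by (apply pow_le; lra).
  assert (X := PI2_3_2). assert (0 < q ^ N) by (apply pow_lt; lra). nra.
Qed.

Lemma mult_exp_unbounded r p M : 0 <= r -> 0 < p -> (forall n, r * exp (INR n * p) <= M) -> r = 0.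
Proof.
  intros Hr Hp H. apply Rle_antisym; auto. apply Rnot_lt_le. intros Hlt.
  destruct (INR_archimed (r * p) (M + 1)) as [n Hn]. nra.
  specialize (H n). assert (X := exp_ineq1_le (INR n * p)). nra.
Qed.

(** Multiply F by exp (n k), where k z = e^(- l (z - i y0)) - e^(- l x1) and
    l = PI / (2 d).  On the three sides where F need not vanish Re k <= 0, while Re k > 0 at
    the point; by the maximum principle F (x, y0) e^(n p) stays bounded. *)
Theorem identity_rect (F : C -> C) x0 x1 y0 d : 0 < d ->
  (forall z, in_rect x0 x1 (y0 - d) (y0 + d) z -> holo F z) ->
  (forall y, y0 - d <= y <= y0 + d -> F (x0, y) = 0) ->
  forall x, x0 < x < x1 -> F (x, y0) = 0.
Proof.
  intros Hd Hol H0 x Hx.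
  set (l := PI / (2 * d)).
  assert (Hpi := PI_RGT_0).
  assert (Hl : 0 < l) by (unfold l; apply Rdiv_lt_0_compat; lra).
  assert (Hld : l * d = PI / 2) by (unfold l; field; lra).
  set (e := exp (- l * x1)).
  set (p := exp (- l * x) - e).
  assert (Hp : 0 < p).
  { unfold p, e. assert (exp (- l * x1) < exp (- l * x)) by (apply exp_increasing; nra). lra. }
  assert (Hc : cont_rect F x0 x1 (y0 - d) (y0 + d)) by (intros z Hz; apply holo_ccont; auto).
  destruct (cont_seg_bounded (fun y => F (x1, y)) (y0 - d) (y0 + d)) as [M1 [HM1 B1]].
  { eapply cont_rect_ver; eauto; lra. }
  destruct (cont_seg_bounded (fun y => F (y, y0 - d)) x0 x1) as [M2 [HM2 B2]].
  { eapply cont_rect_hor; eauto; lra. }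
  destruct (cont_seg_bounded (fun y => F (y, y0 + d)) x0 x1) as [M3 [HM3 B3]].
  { eapply cont_rect_hor; eauto; lra. }
  set (M := M1 + M2 + M3).
  set (k := fun z => (Cexp (- RtoC l * (z - Ci * y0)) - e)%C).
  assert (Rk : forall z, Re (k z) = exp (- l * Re z) * cos (l * (Im z - y0)) - e).
  { intros [a b]. unfold k, Cexp; simpl.
    replace (- l * (a + - (0 * y0 - 1 * 0)) - - 0 * (b + - (0 * 0 + 1 * y0))) with (- l * a) by ring.
    replace (- l * (b + - (0 * 0 + 1 * y0)) + - 0 * (a + - (0 * y0 - 1 * 0))) with (- (l * (b - y0))) by ring.
    rewrite cos_neg. ring. }
  assert (Key : forall n, Cmod (F (x, y0)) * exp (INR n * p) <= M).
  { intros n.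
    assert (X := max_modulus (fun z => F z * Cexp (RtoC (INR n) * k z))%C M x0 x1 (y0 - d) (y0 + d)).
    assert (Mz : forall z, Cmod (F z * Cexp (RtoC (INR n) * k z))%C = Cmod (F z) * exp (INR n * Re (k z))).
    { intros z. rewrite Cmod_mult, Cmod_Cexp. do 2 f_equal. destruct (k z); simpl; ring. }
    replace (Cmod (F (x, y0)) * exp (INR n * p)) with (Cmod (F (x, y0) * Cexp (RtoC (INR n) * k (x, y0)))).
    2:{ rewrite Mz, Rk. simpl. rewrite Rminus_diag, Rmult_0_r, cos_0, Rmult_1_r. auto. }
    apply (X ltac:(unfold M; lra)); clear X.
    - intros z Hz. unfold k. auto 10 with hol.
    - intros z Hz Hb. rewrite Mz.
      destruct (Req_dec (Re z) x0) as [E|Nx0].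
      { replace (F z) with (RtoC 0). rewrite Cmod_0. unfold M; nra.
        destruct z; simpl in *; subst. symmetry; apply H0. apply Hz. }
      assert (E1 : exp (INR n * Re (k z)) <= 1).
      { rewrite <- exp_0. apply exp_le.
        assert (Re (k z) <= 0); [|assert (0 <= INR n) by apply pos_INR; nra].
        rewrite Rk. destruct Hz as [Hz1 Hz2].
        assert (cos (l * (Im z - y0)) <= 1) by apply COS_bound.
        assert (0 < exp (- l * Re z)) by apply exp_pos.
        destruct Hb as [Hb|[Hb|[Hb|Hb]]].
        - congruence.
        - rewrite Hb. fold e. assert (0 < e) by apply exp_pos. nra.
        - rewrite Hb. replace (l * (y0 - d - y0)) with (- (l * d)) by ring. rewrite cos_neg, Hld, cos_PI2.
          assert (0 < e) by apply exp_pos. lra.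
        - rewrite Hb. replace (l * (y0 + d - y0)) with ((l * d)) by ring. rewrite Hld, cos_PI2.
          assert (0 < e) by apply exp_pos. lra. }
      assert (E2 : Cmod (F z) <= M).
      { destruct z as [a b]. destruct Hz as [Hz1 Hz2]; simpl in *.
        destruct Hb as [Hb|[Hb|[Hb|Hb]]]; simpl in Hb; subst; unfold M.
        congruence. assert (X := B1 b Hz2); simpl in X; lra.
        assert (X := B2 a Hz1); simpl in X; lra. assert (X := B3 a Hz1); simpl in X; lra. }
      assert (0 <= Cmod (F z)) by apply Cmod_ge_0. assert (0 < exp (INR n * Re (k z))) by apply exp_pos. nra.
    - split; simpl; lra. }
  apply Cmod_eq_0. apply mult_exp_unbounded with p M; auto. apply Cmod_ge_0.
Qed.

(** * Primitives of entire functions *)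

Lemma rcont_ex_RInt g a b : (forall t, rcont g t) -> ex_RInt (V := C_R_CompleteNormedModule) g a b.
Proof. intros H. apply ex_RInt_continuous. intros z Hz. apply rcont_continuous, H. Qed.

Lemma CInt_swap g a b : (forall t, rcont g t) -> CInt g a b = (- CInt g b a)%C.
Proof. intros. symmetry. apply (opp_RInt_swap (V := C_R_CompleteNormedModule)). apply rcont_ex_RInt; auto. Qed.

Lemma CInt_Chasles_all g a b c : (forall t, rcont g t) -> (CInt g a b + CInt g b c = CInt g a c)%C.
Proof. intros. apply (RInt_Chasles (V := C_R_CompleteNormedModule)); apply rcont_ex_RInt; auto. Qed.

Lemma rect_int_entire f a b c d : (forall z, holo f z) -> rect_int f a b c d = 0.
Proof.
  intros H.
  assert (Hc : forall z, ccont f z) by (intros; apply holo_ccont; auto).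
  assert (Sab : forall a b c d, rect_int f a b c d = (- rect_int f b a c d)%C).
  { intros a' b' c' d'. unfold rect_int. rewrite (CInt_swap (fun x => f (x, c')) a' b'), (CInt_swap (fun x => f (x, d')) a' b').
    ring. all: intros; apply rcont_hor; auto. }
  assert (Scd : forall a b c d, rect_int f a b c d = (- rect_int f a b d c)%C).
  { intros a' b' c' d'. unfold rect_int. rewrite (CInt_swap (fun x => f (a', x)) c' d'), (CInt_swap (fun x => f (b', x)) c' d').
    ring. all: intros; apply rcont_ver; auto. }
  assert (P : forall a b c d, a <= b -> rect_int f a b c d = 0).
  { intros. destruct (Rle_dec c0 d0). apply goursat; auto. rewrite Scd, goursat; auto. ring. lra. }
  destruct (Rle_dec a b). apply P; auto. rewrite Sab, P. ring. lra.
Qed.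

Lemma CInt_bound_abs g M a b : (forall t, rcont g t) -> (forall t, Rmin a b <= t <= Rmax a b -> Cmod (g t) <= M) ->
  Cmod (CInt g a b) <= M * Rabs (b - a).
Proof.
  intros Hc HB. destruct (Rle_dec a b) as [H|H].
  - rewrite Rabs_pos_eq by lra. apply CInt_bound_const; auto. intros t _; auto.
    rewrite Rmin_left, Rmax_right in HB; auto.
  - rewrite CInt_swap, Cmod_opp, Rabs_minus_sym, Rabs_pos_eq by (auto; lra).
    apply CInt_bound_const; try lra. intros t _; auto.
    rewrite Rmin_right, Rmax_left in HB by lra; auto.
Qed.

Lemma CInt_const_all (k : C) a b : CInt (fun _ => k) a b = ((b - a)%R * k)%C.
Proof.
  unfold CInt. rewrite (RInt_const (V := C_R_CompleteNormedModule)).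
  unfold scal; simpl. unfold prod_scal; simpl. unfold scal; simpl. unfold mult; simpl. cring.
Qed.

Lemma CInt_minus_all f g a b : (forall t, rcont f t) -> (forall t, rcont g t) ->
  (CInt (fun t => f t - g t) a b = CInt f a b - CInt g a b)%C.
Proof.
  intros. apply (RInt_minus (V := C_R_CompleteNormedModule)); apply rcont_ex_RInt; auto.
Qed.

(** Integrate first horizontally, then vertically. The rectangle theorem rewrites
    the increment as an integral over the two short segments next to the end point. *)
Theorem entire_primitive (f : C -> C) : (forall z, holo f z) -> exists F, forall z, cderiv F z (f z).
Proof.
  intros H.
  assert (Hc : forall z, ccont f z) by (intros; apply holo_ccont; auto).
  assert (Hh : forall y t, rcont (fun x => f (x, y)) t) by (intros; apply rcont_hor; auto).
  assert (Hv : forall x t, rcont (fun y => f (x, y)) t) by (intros; apply rcont_ver; auto).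
  exists (fun z => CInt (fun x => f (x, 0)) 0 (Re z) + Ci * CInt (fun y => f (Re z, y)) 0 (Im z))%C.
  intros [x y] eps He. simpl.
  destruct (Hc (x, y) (eps / 2)) as [d [Hd H']]. lra.
  exists (d / 2). split. lra. intros [p q] Hpq. simpl.
  assert (Hp : Rabs p <= Cmod (p, q)) by apply (re_le_Cmod (p, q)).
  assert (Hq : Rabs q <= Cmod (p, q)) by apply (Im_le_Cmod (p, q)).
  assert (E := rect_int_entire f x (x + p) 0 y H). unfold rect_int in E.
  rewrite <- (CInt_Chasles_all (fun x => f (x, 0)) 0 x (x + p)) by auto.
  rewrite <- (CInt_Chasles_all (fun y => f (x + p, y)) 0 y (y + q)) by auto.
  match goal with |- Cmod ?A <= _ => replace A with
   (CInt (fun s => f (s, y) - f (x, y)) x (x + p) + Ci * CInt (fun s => f (x + p, s)%R - f (x, y)) y (y + q))%C end.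
  2:{ rewrite (CInt_minus_all (fun s => f (s, y)) (fun _ => f (x, y))), (CInt_minus_all (fun s => f ((x + p)%R, s)) (fun _ => f (x, y))),
    !CInt_const_all by auto using rcont_const.
    replace (x + p - x)%R with p by ring. replace (y + q - y)%R with q by ring.
    replace ((p, q) : C) with (RtoC p + Ci * RtoC q)%C by cring.
    match type of E with ?L = _ => transitivity (CInt (fun s => f (s, y)) x (x + p) - p * f (x, y) + Ci * (CInt (fun s : R => f ((x + p)%R, s)) y (y + q) - q * f (x, y)) + L)%C end.
    rewrite E; ring. ring. }
  assert (B1 : Cmod (CInt (fun s => f (s, y) - f (x, y))%C x (x + p)) <= eps / 2 * Rabs p).
  { replace (Rabs p) with (Rabs (x + p - x)) by (f_equal; ring).
    apply CInt_bound_abs.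
    - intros t. apply rcont_plus; auto using rcont_const.
    - intros t Ht. left.
      replace ((t, y) : C) with ((x, y) + ((t - x)%R, 0%R))%C by cring. apply H'.
      eapply Rle_lt_trans; [apply Cmod_le_sum|]. simpl. rewrite Rabs_R0.
      assert (Rabs (t - x) <= Rabs p); [|lra].
      revert Ht. unfold Rmin, Rmax, Rabs. destruct (Rle_dec x (x + p)); repeat destruct Rcase_abs; intros; lra. }
  assert (B2 : Cmod (CInt (fun s => f ((x + p)%R, s) - f (x, y))%C y (y + q)) <= eps / 2 * Rabs q).
  { replace (Rabs q) with (Rabs (y + q - y)) by (f_equal; ring).
    apply CInt_bound_abs.
    - intros t. apply rcont_plus; auto using rcont_const.
    - intros t Ht. left.
      replace (((x + p)%R, t) : C) with ((x, y) + (p, (t - y)%R))%C by cring. apply H'.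
      eapply Rle_lt_trans; [apply Cmod_le_sum|]. simpl.
      assert (Rabs (t - y) <= Rabs q); [|lra].
      revert Ht. unfold Rmin, Rmax, Rabs. destruct (Rle_dec y (y + q)); repeat destruct Rcase_abs; intros; lra. }
  eapply Rle_trans; [apply Cmod_triangle|]. rewrite Cmod_mult, Cmod_Ci.
  apply Rle_trans with (eps / 2 * Rabs p + eps / 2 * Rabs q). lra.
  apply Rle_trans with (eps / 2 * Cmod (p, q) + eps / 2 * Cmod (p, q)); [|lra].
  apply Rplus_le_compat; apply Rmult_le_compat_l; lra.
Qed.

Lemma entire_bounded_square (f : C -> C) r : (forall z, holo f z) ->
  exists M, 0 < M /\ forall z, Cmod z <= r -> Cmod (f z) <= M.
Proof.
  intros H.
  assert (Hc : cont_rect f (- r) r (- r) r) by (intros z Hz; apply holo_ccont; auto).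
  destruct (Rlt_dec r 0) as [Hr|Hr].
  { exists 1. split. lra. intros z Hz. generalize (Cmod_ge_0 z); lra. }
  destruct (cont_seg_bounded (fun y => f (r, y)) (- r) r) as [M1 [HM1 B1]].
  { eapply cont_rect_ver; eauto; lra. }
  destruct (cont_seg_bounded (fun y => f (- r, y)) (- r) r) as [M2 [HM2 B2]].
  { eapply cont_rect_ver; eauto; lra. }
  destruct (cont_seg_bounded (fun y => f (y, r)) (- r) r) as [M3 [HM3 B3]].
  { eapply cont_rect_hor; eauto; lra. }
  destruct (cont_seg_bounded (fun y => f (y, - r)) (- r) r) as [M4 [HM4 B4]].
  { eapply cont_rect_hor; eauto; lra. }
  exists (M1 + M2 + M3 + M4). split. lra.
  intros z Hz. apply max_modulus with (- r) r (- r) r; auto. lra.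
  - intros [x y] [H1 H2] Hb; simpl in *. destruct Hb as [Hb|[Hb|[Hb|Hb]]]; simpl in Hb; subst.
    specialize (B2 _ H2); lra. specialize (B1 _ H2); lra. specialize (B4 _ H1); lra. specialize (B3 _ H1); lra.
  - split; apply Rabs_le_between; eapply Rle_trans; eauto using re_le_Cmod, Im_le_Cmod.
Qed.

(** * Phragmen-Lindelof theorems *)

(** Growth of order at most rho, in the coordinate log z. *)
Definition double_exp_growth (rho : R) (g : C -> C) : Prop :=
  exists A, 0 <= A /\ forall u, Cmod (g u) <= exp (A * exp (rho * Rabs (Re u))).

Lemma double_exp_growth_mult rho f g : double_exp_growth rho f -> double_exp_growth rho g ->
  double_exp_growth rho (fun u => f u * g u)%C.
Proof.
  intros [A [HA H1]] [B [HB H2]]. exists (A + B). split. lra.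
  intros u. rewrite Cmod_mult, Rmult_plus_distr_r, exp_plus.
  apply Rmult_le_compat; auto using Cmod_ge_0.
Qed.

Lemma double_exp_growth_exp rho k (c : C) : Rabs k <= rho ->
  double_exp_growth rho (fun u => Cexp (c * Cexp (RtoC k * u))).
Proof.
  intros Hk. exists (Cmod c). split. apply Cmod_ge_0.
  intros u. rewrite Cmod_Cexp. apply exp_le.
  eapply Rle_trans; [apply Rle_abs|]. eapply Rle_trans; [apply re_le_Cmod|].
  rewrite Cmod_mult, Cmod_Cexp. apply Rmult_le_compat_l. apply Cmod_ge_0. apply exp_le.
  replace (Re (k * u)) with (k * Re u) by (destruct u; simpl; ring).
  eapply Rle_trans; [apply Rle_abs|]. rewrite Rabs_mult. apply Rmult_le_compat_r; auto. apply Rabs_pos.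
Qed.

Lemma le_of_exp_perturbation r M k : 0 < M -> (forall dl, 0 < dl -> r <= M * exp (dl * k)) -> r <= M.
Proof.
  intros HM H. apply Rnot_lt_le. intros Hlt.
  destruct (Rle_dec k 0) as [Hk|Hk].
  - specialize (H 1 Rlt_0_1). assert (exp (1 * k) <= 1) by (apply exp_le_1; lra). nra.
  - assert (L : 0 < ln (r / M)).
    { rewrite <- ln_1. apply ln_increasing. lra. apply Rlt_div_r; lra. }
    specialize (H (ln (r / M) / (2 * k))).
    replace (ln (r / M) / (2 * k) * k) with (ln (r / M) / 2) in H by (field; lra).
    assert (X : exp (ln (r / M) / 2) < exp (ln (r / M))) by (apply exp_increasing; lra).
    rewrite exp_ln in X by (apply Rdiv_lt_0_compat; lra).
    assert (r <= M * exp (ln (r / M) / 2)) by (apply H; apply Rdiv_lt_0_compat; lra).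
    assert (M * exp (ln (r / M) / 2) < M * (r / M)) by (apply Rmult_lt_compat_l; lra).
    replace (M * (r / M)) with r in * by (field; lra). lra.
Qed.

(** The weight exp (- dl K) with K = 2 cosh (r (u - i m)), m the middle height and
    rho < r < PI / (be - al), has modulus at most 1 in the strip and beats the
    growth of g far away in it, for every dl > 0; then dl tends to 0. *)
Theorem phragmen_lindelof_strip (g : C -> C) rho al be M :
  (forall z, holo g z) -> 0 <= rho -> al < be -> rho * (be - al) < PI -> 0 < M ->
  double_exp_growth rho g ->
  (forall x : R, Cmod (g (x, al)) <= M) -> (forall x : R, Cmod (g (x, be)) <= M) ->
  forall x y, al <= y <= be -> Cmod (g (x, y)) <= M.
Proof.
  intros Hol Hrho Hab Hop HM [A [HA Hg]] Bal Bbe x0 y0 Hy0.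
  assert (Hpi := PI_RGT_0).
  set (r := (rho + PI / (be - al)) / 2).
  assert (Hr0 : rho < PI / (be - al)) by (apply Rlt_div_r; lra).
  assert (Hr1 : rho < r) by (unfold r; lra).
  assert (Hr2 : r * (be - al) < PI).
  { apply Rlt_div_r. lra. unfold r; lra. }
  set (m := (al + be) / 2).
  set (ka := cos (r * ((be - al) / 2))).
  assert (Hka : 0 < ka).
  { unfold ka. apply cos_gt_0; nra. }
  set (K := fun u => (Cexp (RtoC r * (u - Ci * m)) + Cexp (- RtoC r * (u - Ci * m)))%C).
  assert (RK : forall x y, Re (K (x, y)) = (exp (r * x) + exp (- (r * x))) * cos (r * (y - m))).
  { intros x y. unfold K, Cexp; simpl.
    replace (r * (x + - (0 * m - 1 * 0)) - 0 * (y + - (0 * 0 + 1 * m))) with (r * x) by ring.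
    replace (r * (y + - (0 * 0 + 1 * m)) + 0 * (x + - (0 * m - 1 * 0))) with (r * (y - m)) by ring.
    replace (- r * (x + - (0 * m - 1 * 0)) - - 0 * (y + - (0 * 0 + 1 * m))) with (- (r * x)) by ring.
    replace (- r * (y + - (0 * 0 + 1 * m)) + - 0 * (x + - (0 * m - 1 * 0))) with (- (r * (y - m))) by ring.
    rewrite cos_neg. ring. }
  assert (BK : forall x y, al <= y <= be -> exp (r * Rabs x) * ka <= Re (K (x, y))).
  { intros x y Hy. rewrite RK. apply Rmult_le_compat; try apply Rlt_le, exp_pos; auto. lra.
    - assert (0 < exp (r * x)) by apply exp_pos. assert (0 < exp (- (r * x))) by apply exp_pos.
      unfold Rabs; destruct Rcase_abs. replace (r * - x) with (- (r * x)) by ring. lra. lra.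
    - unfold ka. destruct (Rle_dec m y).
      + apply cos_decr_1; unfold m in *; nra.
      + rewrite <- (cos_neg (r * (y - m))). apply cos_decr_1; unfold m in *; nra. }
  apply le_of_exp_perturbation with (Re (K (x0, y0))); auto.
  intros dl Hdl.
  set (s := r - rho). assert (Hs : 0 < s) by (unfold s; lra).
  set (B := (A + Rabs (ln M)) / (dl * ka)).
  assert (HB : 0 <= B).
  { unfold B. apply Rdiv_le_0_compat. generalize (Rabs_pos (ln M)); lra. apply Rmult_lt_0_compat; auto. }
  set (X := Rmax (Rabs x0) (B / s)).
  assert (X1 : Rabs x0 <= X) by apply Rmax_l. assert (X2 : B / s <= X) by apply Rmax_r.
  assert (X0 : 0 <= X) by (generalize (Rabs_pos x0); lra).
  (* at |Re u| = X the weight has absorbed the growth *)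
  assert (End : A * exp (rho * X) - dl * (exp (r * X) * ka) <= ln M).
  { assert (E1 : exp (r * X) = exp (rho * X) * exp (s * X)) by (rewrite <- exp_plus; f_equal; unfold s; ring).
    assert (E2 : B <= exp (s * X)).
    { apply Rle_trans with (s * X). replace B with (s * (B / s)) by (field; lra). apply Rmult_le_compat_l; lra.
      generalize (exp_ineq1_le (s * X)); lra. }
    assert (E3 : 1 <= exp (rho * X)) by (rewrite <- exp_0; apply exp_le; nra).
    assert (E4 : A + Rabs (ln M) <= dl * ka * exp (s * X)).
    { replace (A + Rabs (ln M)) with (dl * ka * B) by (unfold B; field; split; lra).
      apply Rmult_le_compat_l; auto. apply Rmult_le_pos; lra. }
    rewrite E1.
    assert (E5 : - ln M <= Rabs (ln M)) by (rewrite <- Rabs_Ropp; apply Rle_abs).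
    assert (E6 := Rabs_pos (ln M)).
    replace (dl * (exp (rho * X) * exp (s * X) * ka)) with (exp (rho * X) * (dl * ka * exp (s * X))) by ring.
    nra. }
  assert (MM := max_modulus (fun u => g u * Cexp (- RtoC dl * K u))%C M (- X) X al be HM).
  assert (Mz : forall z, Cmod (g z * Cexp (- RtoC dl * K z)) = Cmod (g z) * exp (- (dl * Re (K z)))).
  { intros z. rewrite Cmod_mult, Cmod_Cexp. do 2 f_equal. destruct (K z); simpl; ring. }
  assert (Res : Cmod (g (x0, y0) * Cexp (- RtoC dl * K (x0, y0))) <= M).
  { apply MM.
    - intros z Hz. unfold K. auto 15 with hol.
    - intros [x y] [Hz1 Hz2] Hb. rewrite Mz. simpl in *.
      assert (Kp : 0 < Re (K (x, y))).
      { eapply Rlt_le_trans; [|apply BK; auto]. apply Rmult_lt_0_compat; auto. apply exp_pos. }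
      assert (K1 : exp (- (dl * Re (K (x, y)))) <= 1).
      { apply exp_le_1. nra. }
      assert (K0 := exp_pos (- (dl * Re (K (x, y))))).
      assert (G0 := Cmod_ge_0 (g (x, y))).
      assert (Side : Rabs x = X -> Cmod (g (x, y)) * exp (- (dl * Re (K (x, y)))) <= M).
      { intros HX. eapply Rle_trans.
        apply Rmult_le_compat_r; [lra|]. apply Hg. simpl. rewrite HX, <- exp_plus.
        rewrite <- (exp_ln M) by auto. apply exp_le.
        specialize (BK x y Hz2). rewrite HX in BK. nra. }
      destruct Hb as [Hb|[Hb|[Hb|Hb]]]; simpl in Hb; subst.
      + apply Side. rewrite Rabs_Ropp. apply Rabs_pos_eq; auto.
      + apply Side. apply Rabs_pos_eq; auto.
      + eapply Rle_trans; [apply Rmult_le_compat_l, K1; auto|]. rewrite Rmult_1_r. apply Bal.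
      + eapply Rle_trans; [apply Rmult_le_compat_l, K1; auto|]. rewrite Rmult_1_r. apply Bbe.
    - split; simpl; auto. apply Rabs_le_between; auto. }
  rewrite Mz in Res.
  apply Rmult_le_reg_r with (exp (- (dl * Re (K (x0, y0))))). apply exp_pos.
  rewrite Rmult_assoc, <- exp_plus. replace (dl * Re (K (x0, y0)) + - (dl * Re (K (x0, y0)))) with 0 by ring.
  rewrite exp_0, Rmult_1_r. auto.
Qed.

(** * Sectors *)

Definition polar (t th : R) : C := (RtoC t * Cexp (Ci * RtoC th))%C.

Lemma polar_coord t th : polar t th = (t * cos th, t * sin th).
Proof.
  unfold polar, Cexp; simpl. replace (0 * th - 1 * 0) with 0 by ring. replace (0 * 0 + 1 * th) with th by ring.
  rewrite exp_0. cring.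
Qed.

Lemma Cmod_polar t th : Cmod (polar t th) = Rabs t.
Proof. unfold polar. rewrite Cmod_mult, Cmod_Cexp, Cmod_R. simpl. replace (0 * th - 1 * 0) with 0 by ring. rewrite exp_0. ring. Qed.

Lemma Cexp_polar x y : Cexp (x, y) = polar (exp x) y.
Proof. rewrite polar_coord. reflexivity. Qed.

Definition order1 (f : C -> C) : Prop :=
  forall rho, 1 < rho -> double_exp_growth rho (fun u => f (Cexp u)).

Lemma order1_mult_exp f c : order1 f -> order1 (fun z => f z * Cexp (c * z))%C.
Proof.
  intros H rho Hr. apply (double_exp_growth_mult rho (fun u => f (Cexp u))); auto.
  destruct (double_exp_growth_exp rho 1 c) as [A [HA HB]]. rewrite Rabs_R1; lra.
  exists A. split; auto. intros u. specialize (HB u). rewrite Cmult_1_l in HB. auto.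
Qed.

Definition ray_bound (f : C -> C) (th a : R) : Prop :=
  exists K, 0 < K /\ forall t, 0 <= t -> Cmod (f (polar t th)) <= K * exp (a * t).

(** Dividing f by exp (c z), where c is chosen such that the real part of c e^(i th)
    is a at al and b at be, leaves a function bounded on both sides. *)
Theorem phragmen_lindelof_sector (f : C -> C) al be a b :
  (forall z, holo f z) -> order1 f -> al < be -> be < al + PI ->
  ray_bound f al a -> ray_bound f be b ->
  exists K, 0 < K /\ forall th, al <= th <= be -> forall t, 0 <= t ->
    Cmod (f (polar t th)) <= K * exp (((a * sin (be - th) + b * sin (th - al)) / sin (be - al)) * t).
Proof.
  intros Hol Ho H1 H2 [K1 [HK1 B1]] [K2 [HK2 B2]].
  set (S := sin (be - al)).
  assert (HS : 0 < S) by (unfold S; apply sin_gt_0; lra).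
  set (p := (a * sin be - b * sin al) / S). set (q := (a * cos be - b * cos al) / S).
  set (E := fun th => (a * sin (be - th) + b * sin (th - al)) / S).
  assert (HE : forall th, E th = p * cos th - q * sin th).
  { intros th. unfold E, p, q. rewrite !sin_minus. field. lra. }
  set (K := K1 + K2). exists K. split. unfold K; lra.
  set (c := (p, q) : C).
  set (g := fun u => (f (Cexp u) * Cexp (- c * Cexp u))%C).
  assert (Mg : forall x y, Cmod (g (x, y)) = Cmod (f (polar (exp x) y)) * exp (- (E y * exp x))).
  { intros x y. unfold g. rewrite Cmod_mult, Cmod_Cexp, !Cexp_polar. do 2 f_equal.
    rewrite HE, polar_coord. simpl. ring. }
  assert (Hrho : 1 < (1 + PI / (be - al)) / 2).
  { assert (1 < PI / (be - al)) by (apply Rlt_div_r; lra). lra. }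
  assert (PL : forall x y, al <= y <= be -> Cmod (g (x, y)) <= K).
  { apply phragmen_lindelof_strip with ((1 + PI / (be - al)) / 2); auto.
    - intros z. unfold g. apply holo_mult. apply (holo_comp f); auto using holo_Cexp. auto 10 with hol.
    - lra.
    - apply Rlt_div_r. lra. assert (1 < PI / (be - al)) by (apply Rlt_div_r; lra). lra.
    - unfold K; lra.
    - apply order1_mult_exp; auto.
    - intros x. rewrite Mg.
      replace (E al) with a by (unfold E; rewrite Rminus_diag, sin_0; fold S; field; lra).
      eapply Rle_trans; [apply Rmult_le_compat_r; [apply Rlt_le, exp_pos|apply B1, Rlt_le, exp_pos]|].
      rewrite Rmult_assoc, <- exp_plus, Rplus_opp_r, exp_0. unfold K; lra.
    - intros x. rewrite Mg.
      replace (E be) with b by (unfold E; rewrite Rminus_diag, sin_0; fold S; field; lra).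
      eapply Rle_trans; [apply Rmult_le_compat_r; [apply Rlt_le, exp_pos|apply B2, Rlt_le, exp_pos]|].
      rewrite Rmult_assoc, <- exp_plus, Rplus_opp_r, exp_0. unfold K; lra. }
  intros th Hth t Ht. fold (E th).
  destruct Ht as [Ht|<-].
  - specialize (PL (ln t) th Hth). rewrite Mg, exp_ln in PL by auto.
    apply Rmult_le_reg_r with (exp (- (E th * t))). apply exp_pos.
    rewrite (Rmult_assoc K), <- exp_plus, Rplus_opp_r, exp_0. lra.
  - rewrite Rmult_0_r, exp_0. specialize (B1 0 (Rle_refl 0)). rewrite Rmult_0_r, exp_0 in B1.
    unfold polar in *. rewrite Cmult_0_l in *. unfold K; lra.
Qed.

Lemma ray_bound_weaken f th a b : a <= b -> ray_bound f th a -> ray_bound f th b.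
Proof.
  intros Hab [K [HK H]]. exists K. split; auto. intros t Ht. eapply Rle_trans; [apply H; auto|].
  apply Rmult_le_compat_l. lra. apply exp_le. nra.
Qed.

(** Sines are concave enough for decay at a common rate on the two sides of a
    sector to persist inside. *)
Lemma sin_sum_ge x y : 0 <= x -> 0 <= y -> x + y <= PI -> sin (x + y) <= sin x + sin y.
Proof.
  intros. rewrite sin_plus.
  assert (0 <= sin x) by (apply sin_ge_0; lra). assert (0 <= sin y) by (apply sin_ge_0; lra).
  assert (cos x <= 1) by apply COS_bound. assert (cos y <= 1) by apply COS_bound. nra.
Qed.

Lemma sector_decay (f : C -> C) al be e :
  (forall z, holo f z) -> order1 f -> al < be -> be < al + PI -> 0 <= e ->
  ray_bound f al (- e) -> ray_bound f be (- e) ->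
  exists K, 0 < K /\ forall th, al <= th <= be -> forall t, 0 <= t ->
    Cmod (f (polar t th)) <= K * exp (- e * t).
Proof.
  intros Hol Ho H1 H2 He B1 B2.
  destruct (phragmen_lindelof_sector f al be _ _ Hol Ho H1 H2 B1 B2) as [K [HK HB]].
  exists K. split; auto. intros th Hth t Ht. eapply Rle_trans; [apply HB; auto|].
  apply Rmult_le_compat_l. lra. apply exp_le. apply Rmult_le_compat_r; auto.
  assert (HS : 0 < sin (be - al)) by (apply sin_gt_0; lra).
  apply Rle_div_l; auto.
  assert (X := sin_sum_ge (be - th) (th - al) ltac:(lra) ltac:(lra) ltac:(lra)).
  replace (be - th + (th - al)) with (be - al) in X by ring. nra.
Qed.

Lemma negative_right_of (E : R -> R) x w : 0 < w -> continuous E x -> E x < 0 ->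
  exists eta, 0 < eta < w /\ E (x + eta) < 0.
Proof.
  intros Hw Hc HE.
  assert (H := proj1 (filterlim_locally (F := locally x) E (E x)) Hc (mkposreal (- E x) ltac:(lra))).
  destruct H as [d Hd]. exists (Rmin d w / 2).
  assert (0 < Rmin d w) by (apply Rmin_pos; auto; apply cond_pos).
  assert (Rmin d w <= d) by apply Rmin_l. assert (Rmin d w <= w) by apply Rmin_r.
  split. lra.
  specialize (Hd (x + Rmin d w / 2)).
  assert (X : ball x d (x + Rmin d w / 2)).
  { change (Rabs (x + Rmin d w / 2 - x) < d). replace (x + Rmin d w / 2 - x) with (Rmin d w / 2) by ring.
    rewrite Rabs_pos_eq; lra. }
  specialize (Hd X). change (Rabs (E (x + Rmin d w / 2) - E x) < - E x) in Hd.
  apply Rabs_lt_between in Hd. lra.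
Qed.

(** In the spirit of Carlson: decay along two opposite rays and exponential type
    along one ray between them force decay along that ray.  The bound for the
    two quarter-like sectors is already negative near their outer sides, which
    leaves a sector of opening less than PI. *)
Lemma opposite_decay (f : C -> C) al ga e A :
  (forall z, holo f z) -> order1 f -> al < ga < al + PI -> 0 < e ->
  ray_bound f al (- e) -> ray_bound f (al + PI) (- e) -> ray_bound f ga A ->
  exists e', 0 < e' /\ ray_bound f ga (- e').
Proof.
  intros Hol Ho [H1 H2] He B1 B2 B3.
  destruct (phragmen_lindelof_sector f al ga _ _ Hol Ho H1 ltac:(lra) B1 B3) as [K1 [HK1 P1]].
  destruct (phragmen_lindelof_sector f ga (al + PI) _ _ Hol Ho H2 ltac:(lra) B3 B2) as [K2 [HK2 P2]].
  assert (S1 : 0 < sin (ga - al)) by (apply sin_gt_0; lra).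
  assert (S2 : 0 < sin (al + PI - ga)) by (apply sin_gt_0; lra).
  destruct (negative_right_of (fun th => (- e * sin (ga - th) + A * sin (th - al)) / sin (ga - al)) al (ga - al))
    as [eta [Heta N1]].
  { lra. }
  { apply (ex_derive_continuous (K := R_AbsRing) (V := R_NormedModule)). auto_derive. lra. }
  { rewrite Rminus_diag, sin_0. replace ((- e * sin (ga - al) + A * 0) / sin (ga - al)) with (- e) by (field; lra). lra. }
  destruct (negative_right_of (fun x => (A * sin (al + PI - (- x)) + - e * sin (- x - ga)) / sin (al + PI - ga)) (- (al + PI)) (al + PI - ga))
    as [eta2 [Heta2 N2]].
  { lra. }
  { apply (ex_derive_continuous (K := R_AbsRing) (V := R_NormedModule)). auto_derive. lra. }
  { rewrite Ropp_involutive, Rminus_diag, sin_0.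
    replace ((A * 0 + - e * sin (al + PI - ga)) / sin (al + PI - ga)) with (- e) by (field; lra). lra. }
  set (E1 := (- e * sin (ga - (al + eta)) + A * sin (al + eta - al)) / sin (ga - al)) in *.
  set (be := al + PI - eta2). replace (- (- (al + PI) + eta2)) with be in N2 by (unfold be; ring).
  set (E2 := (A * sin (al + PI - be) + - e * sin (be - ga)) / sin (al + PI - ga)) in *.
  set (e' := Rmin (- E1) (- E2)).
  assert (He' : 0 < e') by (apply Rmin_pos; lra).
  assert (Q1 : ray_bound f (al + eta) (- e')).
  { apply ray_bound_weaken with E1. assert (e' <= - E1) by apply Rmin_l. lra.
    exists K1. split; auto. intros t Ht. apply P1; auto. lra. }
  assert (Q2 : ray_bound f be (- e')).
  { apply ray_bound_weaken with E2. assert (e' <= - E2) by apply Rmin_r. lra.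
    exists K2. split; auto. intros t Ht. apply P2; auto. unfold be; lra. }
  destruct (sector_decay f (al + eta) be e') as [K [HK HB]]; auto; try (unfold be; lra).
  exists e'. split; auto. exists K. split; auto. intros. apply HB; auto. unfold be; lra.
Qed.

(** * Reading off bounds from the order and the indicator *)

(** The order is an infimum, so the growth condition holds for some exponent below
    any rho > 1; the maximum on a disc covers the small values of |z|. *)
Lemma order1_of_order (f : C -> C) : (forall z, holo f z) -> Rbar_le (order f) 1 -> order1 f.
Proof.
  intros Hol Hord rho Hrho.
  assert (Ex : exists r, 0 <= r < rho /\ exists r0 : R, 0 < r0 /\
      forall z : C, r0 < Cmod z -> Cmod (f z) <= exp (Rpower (Cmod z) r)).
  { apply NNPP. intros N.
    unfold order in Hord.
    match type of Hord with Rbar_le (Glb_Rbar ?E) _ =>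
      destruct (Glb_Rbar_correct E) as [_ G]; specialize (G rho) end.
    assert (X : Rbar_le rho 1).
    { eapply Rbar_le_trans; [apply G|exact Hord]. intros x [Hx1 Hx2]. simpl.
      apply Rnot_lt_le. intros Hlt. apply N. exists x. split; auto. }
    simpl in X. lra. }
  destruct Ex as [r [Hr [r0 [Hr0 B]]]].
  destruct (entire_bounded_square f r0 Hol) as [M [HM BM]].
  exists (1 + Rabs (ln M)). assert (P := Rabs_pos (ln M)). split. lra.
  intros u. set (x := Re u).
  assert (E1 : 1 <= exp (rho * Rabs x)).
  { rewrite <- exp_0. apply exp_le. generalize (Rabs_pos x); nra. }
  destruct (Rle_dec (Cmod (Cexp u)) r0) as [H|H].
  - eapply Rle_trans; [apply BM; auto|]. rewrite <- (exp_ln M) at 1 by auto. apply exp_le.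
    assert (Q := Rle_abs (ln M)). nra.
  - eapply Rle_trans; [apply B; lra|]. apply exp_le.
    unfold Rpower. rewrite Cmod_Cexp, ln_exp. fold x.
    apply Rle_trans with (1 * exp (rho * Rabs x)); [|apply Rmult_le_compat_r; lra].
    rewrite Rmult_1_l. apply exp_le.
    assert (Q := Rle_abs x). assert (Q2 := Rabs_pos x). nra.
Qed.

Lemma ray_bound_of_indicator (f : C -> C) th (B : R) : (forall z, holo f z) ->
  Rbar_lt (indicator f th) B -> ray_bound f th B.
Proof.
  intros Hol H. unfold indicator, LimSup_infty in H.
  match type of H with Rbar_lt (Rbar_glb ?E) _ => destruct (Rbar_ex_glb E) as [l Hl];
    rewrite (Rbar_is_glb_unique E l Hl) in H end.
  destruct Hl as [_ Hl].
  assert (Ex : exists r0 : R, Rbar_lt (Rbar_lub (fun v => exists r : R, r0 < r /\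
      v = Rbar_div (Rbar_log (Cmod (f (r * Cexp (Ci * th))%C))) r)) B).
  { apply NNPP. intros N. apply (Rbar_lt_not_le _ _ H). apply Hl. intros y [r0 Hy]. subst y.
    apply Rbar_not_lt_le. intros Hlt. apply N. exists r0. exact Hlt. }
  destruct Ex as [r0 Hr0].
  match type of Hr0 with Rbar_lt (Rbar_lub ?E) _ => destruct (Rbar_ex_lub E) as [m Hm];
    rewrite (Rbar_is_lub_unique E m Hm) in Hr0 end.
  destruct Hm as [Hm _].
  set (r1 := Rmax r0 1).
  assert (Q1 : r0 <= r1) by apply Rmax_l. assert (Q2 : 1 <= r1) by apply Rmax_r.
  destruct (entire_bounded_square f r1 Hol) as [M [HM BM]].
  exists (1 + M * exp (Rabs B * r1)). split.
  { assert (0 < exp (Rabs B * r1)) by apply exp_pos. nra. }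
  intros t Ht.
  assert (E0 : 0 < exp (B * t)) by apply exp_pos.
  assert (E1 : 0 < exp (Rabs B * r1)) by apply exp_pos.
  destruct (Rle_dec t r1) as [H1|H1].
  - apply Rle_trans with M. apply BM. rewrite Cmod_polar, Rabs_pos_eq; auto.
    assert (E2 : 1 <= exp (Rabs B * r1) * exp (B * t)).
    { rewrite <- exp_plus, <- exp_0. apply exp_le.
      assert (X := Rle_abs (- B)). rewrite Rabs_Ropp in X. assert (Y := Rabs_pos B). nra. }
    nra.
  - apply Rle_trans with (1 * exp (B * t)); [|apply Rmult_le_compat_r; nra].
    rewrite Rmult_1_l.
    assert (Ht1 : r0 < t) by lra.
    specialize (Hm _ (ex_intro _ t (conj Ht1 eq_refl))).
    assert (Hlt := Rbar_le_lt_trans _ _ _ Hm Hr0).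
    change (RtoC t * Cexp (Ci * RtoC th))%C with (polar t th) in Hlt.
    unfold Rbar_log in Hlt. destruct Req_EM_T as [E|E].
    + rewrite E. lra.
    + assert (P : 0 < Cmod (f (polar t th))) by (generalize (Cmod_ge_0 (f (polar t th))); lra).
      simpl in Hlt. rewrite <- (exp_ln (Cmod (f (polar t th)))) by auto.
      apply exp_le. left. apply Rmult_lt_compat_r with (r := t) in Hlt; try lra.
      rewrite Rmult_assoc, Rinv_l, Rmult_1_r in Hlt by lra. auto.
Qed.

Lemma Rbar_lt_between (x : Rbar) (B : R) : Rbar_lt x B -> exists B' : R, Rbar_lt x B' /\ B' < B.
Proof.
  destruct x as [x| |]; simpl; intros H; try easy.
  - exists ((x + B) / 2). split; lra.
  - exists (B - 1). split; auto. lra.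
Qed.

Lemma ray_bound_of_dom (f : C -> C) th : (forall z, holo f z) ->
  Rbar_lt (indicator f th) p_infty -> exists B, ray_bound f th B.
Proof.
  intros Hol H. assert (Ex : exists B : R, Rbar_lt (indicator f th) B).
  { destruct (indicator f th) as [x| |]; simpl in *; try easy. exists (x + 1). lra. }
  destruct Ex as [B HB]. exists B. apply ray_bound_of_indicator; auto.
Qed.

(** * Growth in vertical strips *)

Lemma polar_quadrant x y : 0 <= x -> 0 <= y -> exists t th, 0 <= t /\ 0 <= th <= PI / 2 /\
  x = t * cos th /\ y = t * sin th.
Proof.
  intros Hx Hy. assert (Hpi := PI_RGT_0). destruct Hx as [Hx|<-].
  - assert (S : Cexp (Clog (x, y)) = (x, y)) by (apply Cexp_Clog; auto).
    unfold Cexp in S. injection S as S1 S2.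
    exists (exp (Re (Clog (x, y)))), (atan (y / x)).
    assert (0 <= y / x) by (apply Rdiv_le_0_compat; auto).
    split; [apply Rlt_le, exp_pos|]. split; [|split; symmetry; auto].
    split. destruct H as [H|<-]. left. rewrite <- atan_0. apply atan_increasing; auto. rewrite atan_0; lra.
    left. apply atan_bound.
  - exists y, (PI / 2). rewrite cos_PI2, sin_PI2. repeat split; lra.
Qed.

(** In both quadrants the interpolating sinusoid is a cos th + b |sin th|, which is
    a x + b |y| in Cartesian coordinates. *)
Lemma right_half_plane_bound (f : C -> C) a b : (forall z, holo f z) -> order1 f -> 0 <= b ->
  ray_bound f 0 a -> ray_bound f (PI / 2) b -> ray_bound f (- (PI / 2)) b ->
  exists K, 0 < K /\ forall x y, 0 <= x -> Cmod (f (x, y)) <= K * exp (a * x + b * Rabs y).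
Proof.
  intros Hol Ho Hb B0 B1 B2. assert (Hpi := PI_RGT_0).
  destruct (phragmen_lindelof_sector f 0 (PI / 2) _ _ Hol Ho ltac:(lra) ltac:(lra) B0 B1) as [K1 [HK1 P1]].
  destruct (phragmen_lindelof_sector f (- (PI / 2)) 0 _ _ Hol Ho ltac:(lra) ltac:(lra) B2 B0) as [K2 [HK2 P2]].
  exists (K1 + K2). split. lra. intros x y Hx.
  assert (E : 0 < exp (a * x + b * Rabs y)) by apply exp_pos.
  destruct (polar_quadrant x (Rabs y)) as [t [th [Ht [Hth [Ex Ey]]]]]; auto. apply Rabs_pos.
  destruct (Rle_dec 0 y) as [Hy|Hy].
  - rewrite Rabs_pos_eq in Ey, E |- * by auto.
    specialize (P1 th Hth t Ht). rewrite polar_coord, <- Ex, <- Ey in P1.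
    eapply Rle_trans; [apply P1|].
    replace ((a * sin (PI / 2 - th) + b * sin (th - 0)) / sin (PI / 2 - 0) * t) with (a * x + b * y). nra.
    rewrite Rminus_0_r, Rminus_0_r, sin_PI2, sin_shift, Ex, Ey. field.
  - rewrite Rabs_left in Ey, E |- * by lra.
    specialize (P2 (- th) ltac:(lra) t Ht). rewrite polar_coord, cos_neg, sin_neg in P2.
    replace (t * cos th) with x in P2 by auto. replace (t * - sin th) with y in P2 by (rewrite <- Rmult_opp_opp in *; lra).
    eapply Rle_trans; [apply P2|].
    replace ((b * sin (0 - - th) + a * sin (- th - - (PI / 2))) / sin (0 - - (PI / 2)) * t) with (a * x + b * - y). nra.
    replace (0 - - (PI / 2)) with (PI / 2) by ring. replace (- th - - (PI / 2)) with (PI / 2 - th) by ring.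
    replace (0 - - th) with th by ring.
    rewrite sin_PI2, sin_shift, Ex, Ey. field.
Qed.

(** On the left of the imaginary axis only the order is known.  The weight
    exp (2 A s i w^(3/2)) with w = z / (s i) absorbs the growth on the negative real
    axis, has modulus 1 on the imaginary axis, and costs only a factor
    exp (O (sqrt |y|)) at bounded distance from it. *)
Lemma left_quadrant_bound (f : C -> C) s b : (forall z, holo f z) -> order1 f ->
  (s = 1 \/ s = - (1)) -> ray_bound f (s * (PI / 2)) b ->
  exists K A, 0 < K /\ 0 <= A /\ forall t th, 0 <= t -> 0 <= th <= PI / 2 ->
    Cmod (f (- (t * sin th), s * (t * cos th))) <= K * exp (b * (t * cos th) + A * sqrt t * (t * sin th)).
Proof.
  intros Hol Ho Hs [K0 [HK0 B0]]. assert (Hpi := PI_RGT_0).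
  assert (Hss : s * s = 1) by (destruct Hs; subst; ring).
  destruct (Ho (3 / 2)) as [A [HA BA]]. lra.
  destruct (entire_bounded_square f 1 Hol) as [M [HM BM]].
  set (K := K0 + 1 + M * exp (Rabs b)).
  assert (HMb : 0 < M * exp (Rabs b)) by (apply Rmult_lt_0_compat; auto; apply exp_pos).
  exists K, (2 * A * 2). split. unfold K; lra. split. lra.
  set (g := fun u => (f (Cexp (u + Ci * (s * (PI / 2))%R)) * Cexp (- RtoC b * Cexp (1 * u)) *
     Cexp ((2 * A * s)%R * Ci * Cexp (RtoC (3 / 2) * u)))%C).
  assert (Pt : forall x th, Cexp ((x, s * th)%R + Ci * (s * (PI / 2))%R) = (- (exp x * sin th), s * (exp x * cos th))).
  { intros x th. unfold Cexp; simpl.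
    replace (x + (0 * (s * (PI / 2)) - 1 * 0)) with x by ring.
    replace (s * th + (0 * 0 + 1 * (s * (PI / 2)))) with (s * (th + PI / 2)) by ring.
    replace (cos (s * (th + PI / 2))) with (- sin th). replace (sin (s * (th + PI / 2))) with (s * cos th).
    f_equal; ring.
    destruct Hs; subst s. rewrite !Rmult_1_l. rewrite sin_plus, cos_PI2, sin_PI2; ring.
    replace (- (1) * (th + PI / 2)) with (- (th + PI / 2)) by ring. rewrite sin_neg, sin_plus, cos_PI2, sin_PI2; ring.
    destruct Hs; subst s. rewrite !Rmult_1_l. rewrite cos_plus, cos_PI2, sin_PI2; ring.
    replace (- (1) * (th + PI / 2)) with (- (th + PI / 2)) by ring. rewrite cos_neg, cos_plus, cos_PI2, sin_PI2; ring. }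
  assert (cs : forall x, cos (s * x) = cos x).
  { intros. destruct Hs; subst. rewrite Rmult_1_l; auto. rewrite <- cos_neg. f_equal; ring. }
  assert (sn : forall x, sin (s * x) = s * sin x).
  { intros. destruct Hs; subst. rewrite !Rmult_1_l; auto. replace (- (1) * x) with (- x) by ring. rewrite sin_neg; ring. }
  assert (Mg : forall x th, Cmod (g (x, s * th)) = Cmod (f (- (exp x * sin th), s * (exp x * cos th))) *
     exp (- (b * (exp x * cos th) + 2 * A * exp (3 / 2 * x) * sin (3 / 2 * th)))).
  { intros x th. unfold g. rewrite !Cmod_mult, !Cmod_Cexp, Pt, Rmult_assoc, <- exp_plus. do 2 f_equal.
    unfold Cexp; simpl.
    replace (1 * (s * th) + 0 * x) with (s * th) by ring.
    replace (1 * x - 0 * (s * th)) with x by ring.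
    replace (3 / 2 * x - 0 * (s * th)) with (3 / 2 * x) by ring.
    replace (3 / 2 * (s * th) + 0 * x) with (s * (3 / 2 * th)) by ring.
    rewrite !cs, !sn.
    replace (2 * A * exp (3 / 2 * x) * sin (3 / 2 * th)) with (2 * A * exp (3 / 2 * x) * ((s * s) * sin (3 / 2 * th))) by (rewrite Hss; ring).
    ring. }
  assert (side0 : forall x, Cmod (g (x, s * 0)) <= K).
  { intros x. rewrite Mg. rewrite !Rmult_0_r, sin_0, cos_0, !Rmult_0_r, Rplus_0_r, !Rmult_1_r, Ropp_0.
    specialize (B0 (exp x) (Rlt_le _ _ (exp_pos x))).
    rewrite polar_coord, cs, sn, cos_PI2, sin_PI2 in B0.
    replace (exp x * 0) with 0 in B0 by ring. replace (exp x * (s * 1)) with (s * exp x) in B0 by ring.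
    apply Rle_trans with (K0 * exp (b * exp x) * exp (- (b * exp x))).
    apply Rmult_le_compat_r; auto. apply Rlt_le, exp_pos.
    rewrite Rmult_assoc, <- exp_plus, Rplus_opp_r, exp_0. unfold K; lra. }
  assert (sin34 : / 2 <= sin (3 / 2 * (PI / 2))).
  { replace (3 / 2 * (PI / 2)) with (PI - PI / 4) by field. rewrite <- sin_PI_x.
    replace (PI - (PI - PI / 4)) with (PI / 4) by ring.
    replace (/ 2) with (1 / 2) by field. rewrite <- sin_PI6. apply Rlt_le, sin_increasing_1; lra. }
  assert (side1 : forall x, Cmod (g (x, s * (PI / 2))) <= K).
  { intros x. rewrite Mg, sin_PI2, cos_PI2, !Rmult_0_r, Rplus_0_l, !Rmult_1_r.
    assert (E3 : 0 < exp (3 / 2 * x)) by apply exp_pos.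
    destruct (Rle_dec 0 x) as [Hx|Hx].
    - specialize (BA (x, s * (PI / 2) + s * (PI / 2))).
      replace (Cexp (x, s * (PI / 2) + s * (PI / 2))) with ((- exp x, 0) : C) in BA.
      2:{ specialize (Pt x (PI / 2)). rewrite sin_PI2, cos_PI2, !Rmult_0_r, Rmult_1_r in Pt.
          rewrite <- Pt. f_equal. apply Ceq; simpl; ring. }
      simpl in BA. rewrite Rabs_pos_eq in BA by auto.
      eapply Rle_trans; [apply Rmult_le_compat_r; [apply Rlt_le, exp_pos|apply BA]|].
      rewrite <- exp_plus. apply Rle_trans with 1; [|unfold K; lra]. apply exp_le_1.
      assert (0 <= A * exp (3 / 2 * x)) by (apply Rmult_le_pos; lra). nra.
    - apply Rle_trans with (M * 1); [|unfold K].
      + apply Rmult_le_compat; auto using Cmod_ge_0. apply Rlt_le, exp_pos.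
        apply BM. replace ((- exp x, 0) : C) with (RtoC (- exp x)) by reflexivity.
        rewrite Cmod_R, Rabs_Ropp, Rabs_pos_eq by apply Rlt_le, exp_pos. apply exp_le_1; lra.
        apply exp_le_1. assert (0 <= A * exp (3 / 2 * x)) by (apply Rmult_le_pos; lra). nra.
      + assert (1 <= exp (Rabs b)) by (rewrite <- exp_0; apply exp_le, Rabs_pos). nra. }
  assert (deg : double_exp_growth (3 / 2) g).
  { apply double_exp_growth_mult; [apply double_exp_growth_mult|].
    - exists A. split; auto. intros u. specialize (BA (u + Ci * (s * (PI / 2))%R)%C).
      replace (Re (u + Ci * (s * (PI / 2))%R)) with (Re u) in BA by (destruct u; simpl; ring). auto.
    - apply double_exp_growth_exp. rewrite Rabs_R1; lra.
    - apply double_exp_growth_exp. rewrite Rabs_pos_eq; lra. }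
  assert (Hg : forall z, holo g z).
  { intros z. unfold g. repeat apply holo_mult; auto 10 with hol. apply (holo_comp f); auto 10 with hol. }
  assert (PL : forall x th, 0 <= th <= PI / 2 -> Cmod (g (x, s * th)) <= K).
  { intros x th Hth. destruct Hs; subst s.
    - apply phragmen_lindelof_strip with (3 / 2) (1 * 0) (1 * (PI / 2)); auto; unfold K; lra.
    - apply phragmen_lindelof_strip with (3 / 2) (- (1) * (PI / 2)) (- (1) * 0); auto; unfold K; lra. }
  intros t th Ht Hth.
  destruct Ht as [Ht|<-].
  - specialize (PL (ln t) th Hth). rewrite Mg, exp_ln in PL by auto.
    assert (E32 : exp (3 / 2 * ln t) = t * sqrt t).
    { rewrite <- exp_half_ln by auto. rewrite <- (exp_ln t) at 2 by auto.
      rewrite <- exp_plus. f_equal. field. }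
    rewrite E32 in PL.
    assert (S2 : sin (3 / 2 * th) <= 2 * sin th).
    { replace (3 / 2 * th) with (th + th / 2) by field.
      assert (sin (th + th / 2) <= sin th + sin (th / 2)) by (apply sin_sum_ge; lra).
      assert (sin (th / 2) <= sin th) by (destruct (Req_dec th 0); [subst; right; f_equal; field|apply Rlt_le, sin_increasing_1; lra]).
      lra. }
    apply Rle_trans with (K * exp (b * (t * cos th) + 2 * A * (t * sqrt t) * sin (3 / 2 * th))).
    + apply Rmult_le_reg_r with (exp (- (b * (t * cos th) + 2 * A * (t * sqrt t) * sin (3 / 2 * th)))). apply exp_pos.
      rewrite (Rmult_assoc K), <- exp_plus, Rplus_opp_r, exp_0. lra.
    + apply Rmult_le_compat_l. unfold K; lra. apply exp_le. apply Rplus_le_compat_l.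
      assert (0 <= A * (t * sqrt t)) by (apply Rmult_le_pos; auto; apply Rmult_le_pos; [lra|apply sqrt_pos]).
      nra.
  - rewrite sqrt_0, !Rmult_0_l, !Rmult_0_r, Ropp_0, Rplus_0_r, exp_0.
    apply Rle_trans with M. apply BM. change (Cmod (RtoC 0) <= 1); rewrite Cmod_0; lra.
    assert (1 <= exp (Rabs b)) by (rewrite <- exp_0; apply exp_le, Rabs_pos). unfold K. nra.
Qed.

(** At bounded distance from the imaginary axis the factor exp (A m sqrt t) of the
    quadrant bound is at most a constant times exp (e t). *)
Lemma left_strip_bound (f : C -> C) b e m : (forall z, holo f z) -> order1 f -> 0 <= b -> 0 < e -> 0 <= m ->
  ray_bound f (PI / 2) b -> ray_bound f (- (PI / 2)) b ->
  exists K, 0 < K /\ forall x y, - m <= x <= 0 -> Cmod (f (x, y)) <= K * exp ((b + e) * Rabs y).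
Proof.
  intros Hol Ho Hb He Hm B1 B2.
  destruct (left_quadrant_bound f 1 b) as [K1 [A1 [HK1 [HA1 P1]]]]; auto. rewrite Rmult_1_l; auto.
  destruct (left_quadrant_bound f (- (1)) b) as [K2 [A2 [HK2 [HA2 P2]]]]; auto.
  { replace (- (1) * (PI / 2)) with (- (PI / 2)) by ring; auto. }
  set (A := A1 + A2). set (E := exp (e * m + (A * m) * (A * m) / e)).
  assert (HE : 0 < E) by apply exp_pos.
  exists ((K1 + K2) * E). split. apply Rmult_lt_0_compat; lra.
  intros x y Hx.
  destruct (polar_quadrant (Rabs y) (- x)) as [t [th [Ht [Hth [Ey Ex]]]]]. apply Rabs_pos. lra.
  assert (Tm : t <= m + Rabs y).
  { assert (Q := sin2_cos2 th). unfold Rsqr in Q.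
    assert (0 <= sin th) by (apply sin_ge_0; lra). assert (0 <= cos th) by (apply cos_ge_0; lra).
    assert (1 <= sin th + cos th) by nra. nra. }
  assert (Key : forall A', 0 <= A' <= A -> exp (b * (t * cos th) + A' * sqrt t * (t * sin th)) <= E * exp ((b + e) * Rabs y)).
  { intros A' HA'. unfold E. rewrite <- exp_plus. apply exp_le.
    rewrite <- Ey, <- Ex.
    assert (S := sqrt_pos t). assert (SS := sqrt_sqrt t Ht). set (r := sqrt t) in *.
    assert (Z1 : A' * r * - x <= A * m * r).
    { assert (A' * - x <= A * m) by (apply Rmult_le_compat; lra). nra. }
    assert (Z2 : A * m * r <= e * (r * r) + A * m * (A * m) / e).
    { set (q := A * m). assert (0 <= (2 * e * r - q) * (2 * e * r - q)) by apply Rle_0_sqr.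
      assert (Y : q * r <= (e * e * (r * r) + q * q) / e).
      { apply (proj1 (Rle_div_r (q * r) (e * e * (r * r) + q * q) e He)). nra. }
      replace (e * (r * r) + q * q / e) with ((e * e * (r * r) + q * q) / e) by (field; lra). auto. }
    nra. }
  destruct (Rle_dec 0 y) as [Hy|Hy].
  - specialize (P1 t th Ht Hth). rewrite <- Ey, <- Ex in P1. rewrite Rabs_pos_eq in P1 at 1 by auto.
    rewrite Ropp_involutive, Rmult_1_l in P1.
    specialize (Key A1 ltac:(unfold A; lra)). rewrite <- Ey, <- Ex in Key.
    eapply Rle_trans; [apply P1|]. rewrite (Rmult_assoc (K1 + K2)).
    apply Rmult_le_compat; auto; try lra. apply Rlt_le, exp_pos.
  - assert (Hy1 : y < 0) by (apply Rnot_le_lt; auto).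
    specialize (P2 t th Ht Hth). rewrite <- Ey, <- Ex in P2. replace (Rabs y) with (- y) in P2 at 1 by (rewrite Rabs_left; auto).
    rewrite Ropp_involutive in P2. replace (- (1) * - y) with y in P2 by ring.
    specialize (Key A2 ltac:(unfold A; lra)). rewrite <- Ey, <- Ex in Key.
    eapply Rle_trans; [apply P2|]. rewrite (Rmult_assoc (K1 + K2)).
    apply Rmult_le_compat; auto; try lra. apply Rlt_le, exp_pos.
Qed.

(** * Integrals over half-lines of exponentially decaying functions *)

Definition is_HInt (g : R -> C) (l : C) : Prop :=
  forall eps, 0 < eps -> exists T0, 0 <= T0 /\ forall T, T0 <= T -> Cmod (CInt g 0 T - l) <= eps.

(** The limit as T tends to oo of the integral over [0, T], when there is one; it is
    used for exponentially decaying integrands, where HInt_correct provides it. *)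
Definition HInt (g : R -> C) : C := epsilon (inhabits (RtoC 0)) (is_HInt g).

Definition exp_decay (g : R -> C) : Prop :=
  (forall t, 0 <= t -> rcont g t) /\
  exists K e, 0 <= K /\ 0 < e /\ forall t, 0 <= t -> Cmod (g t) <= K * exp (- e * t).

Lemma Ceq_of_close (x y : C) K : (forall eps, 0 < eps -> Cmod (x - y) <= K * eps) -> x = y.
Proof.
  intros H. apply Cminus_eq_0, Cmod_eq_0, Rle_antisym; [|apply Cmod_ge_0].
  apply le_epsilon. intros e He. rewrite Rplus_0_l.
  assert (P := Rabs_pos K). assert (Q := Rle_abs K).
  eapply Rle_trans; [apply (H (e / (Rabs K + 1))); apply Rdiv_lt_0_compat; lra|].
  apply Rle_trans with ((Rabs K + 1) * (e / (Rabs K + 1))).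
  apply Rmult_le_compat_r. apply Rlt_le, Rdiv_lt_0_compat; lra. lra.
  right; field; lra.
Qed.

Lemma is_HInt_unique g l m : is_HInt g l -> is_HInt g m -> l = m.
Proof.
  intros H1 H2. apply Ceq_of_close with 2. intros e He.
  destruct (H1 e He) as [T1 [P1 Q1]]. destruct (H2 e He) as [T2 [P2 Q2]].
  specialize (Q1 (Rmax T1 T2) (Rmax_l _ _)). specialize (Q2 (Rmax T1 T2) (Rmax_r _ _)).
  replace (l - m)%C with ((CInt g 0 (Rmax T1 T2) - m) - (CInt g 0 (Rmax T1 T2) - l))%C by ring.
  eapply Rle_trans; [apply Cmod_triangle_minus|]. lra.
Qed.

Lemma HInt_eq g l : is_HInt g l -> HInt g = l.
Proof.
  intros H. apply is_HInt_unique with g; auto.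
  apply (epsilon_spec (inhabits (RtoC 0)) (is_HInt g)). eauto.
Qed.

Lemma is_RInt_exp_neg K e a b : 0 < e -> is_RInt (fun t => K * exp (- e * t)) a b (K / e * (exp (- e * a) - exp (- e * b))).
Proof.
  intros He. replace (K / e * (exp (- e * a) - exp (- e * b))) with
   (minus (G := R_AbelianGroup) (- K / e * exp (- e * b)) (- K / e * exp (- e * a)))
   by (unfold minus, plus, opp; simpl; field; lra).
  apply (is_RInt_derive (V := R_CompleteNormedModule) (fun t => - K / e * exp (- e * t))).
  - intros x _. auto_derive; auto. field. lra.
  - intros x _. apply (ex_derive_continuous (K := R_AbsRing) (V := R_NormedModule)). auto_derive. auto.
Qed.

Lemma CInt_decay_bound g K e a b : 0 <= K -> 0 < e -> 0 <= a <= b -> (forall t, 0 <= t -> rcont g t) ->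
  (forall t, 0 <= t -> Cmod (g t) <= K * exp (- e * t)) ->
  Cmod (CInt g a b) <= K / e * exp (- e * a).
Proof.
  intros HK He Hab Hc HB.
  eapply Rle_trans. apply CInt_bound with (k := fun t => K * exp (- e * t)); try lra.
  - intros t Ht. apply Hc; lra.
  - intros t Ht. apply HB; lra.
  - apply is_RInt_exp_neg; auto.
  - apply Rmult_le_compat_l. apply Rdiv_le_0_compat; auto. generalize (exp_pos (- e * b)); lra.
Qed.

Lemma exp_neg_small K e eps : 0 <= K -> 0 < e -> 0 < eps -> exists T0, 0 <= T0 /\ forall T, T0 <= T -> K * exp (- e * T) <= eps.
Proof.
  intros HK He Hp.
  exists (K / (e * eps)). split. apply Rdiv_le_0_compat; auto; nra.
  intros T HT.
  assert (X := exp_ineq1_le (e * T)).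
  assert (Y : exp (e * T) * exp (- e * T) = 1) by (rewrite <- exp_plus, <- exp_0; f_equal; ring).
  assert (Z : K <= eps * exp (e * T)).
  { apply (Rle_div_l K T (e * eps)) in HT. nra. nra. }
  assert (0 < exp (- e * T)) by apply exp_pos.
  apply Rle_trans with (eps * exp (e * T) * exp (- e * T)). apply Rmult_le_compat_r; lra.
  rewrite Rmult_assoc, Y. lra.
Qed.

Lemma HInt_tail g K e : 0 <= K -> 0 < e -> (forall t, 0 <= t -> rcont g t) ->
  (forall t, 0 <= t -> Cmod (g t) <= K * exp (- e * t)) ->
  forall T, 0 <= T -> Cmod (CInt g 0 T - HInt g) <= K / e * exp (- e * T).
Proof.
  intros HK He Hc HB.
  assert (HD : forall T T', 0 <= T <= T' -> Cmod (CInt g 0 T' - CInt g 0 T) <= K / e * exp (- e * T)).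
  { intros T T' HT. rewrite <- (CInt_Chasles g 0 T T'); try lra. 2: intros t Ht; apply Hc; lra.
    replace (CInt g 0 T + CInt g T T' - CInt g 0 T)%C with (CInt g T T') by ring.
    apply CInt_decay_bound; auto. }
  assert (HKe : 0 <= K / e) by (apply Rdiv_le_0_compat; auto).
  destruct (proj1 (filterlim_locally_cauchy (U := C_R_CompleteNormedModule) (F := Rbar_locally p_infty) (fun T => CInt g 0 T))) as [l Hl].
  { intros [eps Heps]. destruct (exp_neg_small (K / e) e (eps / 4)) as [T0 [HT0 HT]]; auto. lra.
    exists (fun T => T0 <= T). split. exists T0. intros; lra.
    intros u v Hu Hv.
    assert (D : Cmod (CInt g 0 u - CInt g 0 T0) <= eps / 4 /\ Cmod (CInt g 0 v - CInt g 0 T0) <= eps / 4).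
    { split; eapply Rle_trans; [apply HD; lra|apply HT; lra|apply HD; lra|apply HT; lra]. }
    apply (norm_compat1 (V := C_R_NormedModule)). rewrite <- Cmod_norm.
    change (Cmod (CInt g 0 v - CInt g 0 u) < eps).
    replace (CInt g 0 v - CInt g 0 u)%C with ((CInt g 0 v - CInt g 0 T0) - (CInt g 0 u - CInt g 0 T0))%C by ring.
    eapply Rle_lt_trans; [apply Cmod_triangle_minus|]. lra. }
  assert (Hl' : is_HInt g l).
  { intros eps Heps.
    assert (H1 := proj1 (filterlim_locally_ball_norm (U := C_R_NormedModule) (F := Rbar_locally p_infty) _ _) Hl (mkposreal eps Heps)).
    destruct H1 as [T0 H1]. exists (Rmax 0 (T0 + 1)). split. apply Rmax_l.
    intros T HT. assert (T0 < T) by (generalize (Rmax_r 0 (T0 + 1)); lra).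
    specialize (H1 T H). unfold ball_norm in H1. rewrite <- Cmod_norm in H1. left. exact H1. }
  rewrite (HInt_eq g l Hl'). intros T HT.
  apply le_epsilon. intros eps Heps. destruct (Hl' eps Heps) as [T0 [HT0 H0]].
  specialize (H0 (Rmax T0 T) (Rmax_l _ _)). specialize (HD T (Rmax T0 T) (conj HT (Rmax_r _ _))).
  replace (CInt g 0 T - l)%C with ((CInt g 0 (Rmax T0 T) - l) - (CInt g 0 (Rmax T0 T) - CInt g 0 T))%C by ring.
  eapply Rle_trans; [apply Cmod_triangle_minus|]. lra.
Qed.

Lemma HInt_bound g K e : 0 <= K -> 0 < e -> (forall t, 0 <= t -> rcont g t) ->
  (forall t, 0 <= t -> Cmod (g t) <= K * exp (- e * t)) -> Cmod (HInt g) <= K / e.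
Proof.
  intros HK He Hc HB. assert (X := HInt_tail g K e HK He Hc HB 0 (Rle_refl 0)).
  rewrite CInt_point, Rmult_0_r, exp_0, Rmult_1_r in X.
  replace (0 - HInt g)%C with (- HInt g)%C in X by ring. rewrite Cmod_opp in X. auto.
Qed.

Lemma HInt_correct g : exp_decay g -> is_HInt g (HInt g).
Proof.
  intros [Hc [K [e [HK [He HB]]]]] eps Heps.
  assert (HKe : 0 <= K / e) by (apply Rdiv_le_0_compat; auto).
  destruct (exp_neg_small (K / e) e eps) as [T0 [HT0 HT]]; auto.
  exists T0. split; auto. intros T H. eapply Rle_trans; [apply (HInt_tail g K e); auto; lra|]. auto.
Qed.

Lemma is_HInt_ext f g l : (forall t, 0 <= t -> f t = g t) -> is_HInt f l -> is_HInt g l.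
Proof.
  intros E H eps Heps. destruct (H eps Heps) as [T0 [H0 H1]]. exists T0. split; auto.
  intros T HT. rewrite <- (CInt_ext f g) by (try lra; intros; apply E; lra). auto.
Qed.

Lemma HInt_ext f g : exp_decay f -> (forall t, 0 <= t -> f t = g t) -> HInt f = HInt g.
Proof. intros. symmetry. apply HInt_eq. apply is_HInt_ext with f; auto. apply HInt_correct; auto. Qed.

Lemma exp_decay_ext f g : (forall t, f t = g t) -> exp_decay f -> exp_decay g.
Proof.
  intros E [Hc [K [e [HK [He HB]]]]]. split.
  - intros t Ht. apply rcont_ext with f; auto.
  - exists K, e. repeat split; auto. intros. rewrite <- E. auto.
Qed.

Lemma exp_decay_cmul c g : exp_decay g -> exp_decay (fun t => c * g t)%C.
Proof.
  intros [Hc [K [e [HK [He HB]]]]]. split.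
  - intros t Ht. apply rcont_mult; auto using rcont_const.
  - exists (Cmod c * K), e. repeat split; auto. apply Rmult_le_pos; auto using Cmod_ge_0.
    intros. rewrite Cmod_mult, Rmult_assoc. apply Rmult_le_compat_l; auto using Cmod_ge_0.
Qed.

Lemma HInt_cmul c g : exp_decay g -> HInt (fun t => c * g t)%C = (c * HInt g)%C.
Proof.
  intros H. apply HInt_eq. intros eps Heps.
  assert (P := Cmod_ge_0 c).
  destruct (HInt_correct g H (eps / (Cmod c + 1))) as [T0 [H0 H1]]. apply Rdiv_lt_0_compat; lra.
  exists T0. split; auto. intros T HT. rewrite CInt_cmul; try lra. 2: intros t Ht; apply H; lra.
  replace (c * CInt g 0 T - c * HInt g)%C with (c * (CInt g 0 T - HInt g))%C by ring.
  rewrite Cmod_mult. specialize (H1 T HT).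
  apply Rle_trans with ((Cmod c + 1) * (eps / (Cmod c + 1))).
  apply Rmult_le_compat; auto using Cmod_ge_0; lra. right; field; lra.
Qed.

Lemma exp_decay_plus f g : exp_decay f -> exp_decay g -> exp_decay (fun t => f t + g t)%C.
Proof.
  intros [Hc [K [e [HK [He HB]]]]] [Hc' [K' [e' [HK' [He' HB']]]]]. split.
  - intros t Ht. apply rcont_plus; auto.
  - exists (K + K'), (Rmin e e'). repeat split. lra. apply Rmin_pos; auto.
    intros t Ht. eapply Rle_trans; [apply Cmod_triangle|]. rewrite Rmult_plus_distr_r.
    apply Rplus_le_compat.
    + eapply Rle_trans; [apply HB; auto|]. apply Rmult_le_compat_l; auto. apply exp_le.
      assert (Rmin e e' <= e) by apply Rmin_l. nra.
    + eapply Rle_trans; [apply HB'; auto|]. apply Rmult_le_compat_l; auto. apply exp_le.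
      assert (Rmin e e' <= e') by apply Rmin_r. nra.
Qed.

Lemma HInt_plus f g : exp_decay f -> exp_decay g -> HInt (fun t => f t + g t)%C = (HInt f + HInt g)%C.
Proof.
  intros Hf Hg. apply HInt_eq. intros eps Heps.
  destruct (HInt_correct f Hf (eps / 2)) as [T1 [H1 H1']]. lra.
  destruct (HInt_correct g Hg (eps / 2)) as [T2 [H2 H2']]. lra.
  exists (Rmax T1 T2). split. eapply Rle_trans; [apply H1|apply Rmax_l].
  intros T HT. assert (A := Rmax_l T1 T2). assert (B := Rmax_r T1 T2).
  rewrite CInt_plus; try lra. 2: intros t Ht; apply Hf; lra. 2: intros t Ht; apply Hg; lra.
  specialize (H1' T ltac:(lra)). specialize (H2' T ltac:(lra)).
  replace (CInt f 0 T + CInt g 0 T - (HInt f + HInt g))%C with ((CInt f 0 T - HInt f) + (CInt g 0 T - HInt g))%C by ring.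
  eapply Rle_trans; [apply Cmod_triangle|]. lra.
Qed.

Lemma exp_decay_minus f g : exp_decay f -> exp_decay g -> exp_decay (fun t => f t - g t)%C.
Proof.
  intros Hf Hg. apply exp_decay_ext with (fun t => f t + (- (1)) * g t)%C. intros; ring.
  apply exp_decay_plus; auto using exp_decay_cmul.
Qed.

Lemma HInt_minus f g : exp_decay f -> exp_decay g -> HInt (fun t => f t - g t)%C = (HInt f - HInt g)%C.
Proof.
  intros Hf Hg. transitivity (HInt (fun t => f t + (- (1)) * g t)%C).
  - symmetry. apply HInt_ext. apply exp_decay_plus; auto using exp_decay_cmul. intros; ring.
  - rewrite HInt_plus, HInt_cmul; auto using exp_decay_cmul. ring.
Qed.

(** * Holomorphy of parameter integrals *)

Lemma rcont_Cexp_lin (l w : C) t : rcont (fun t => Cexp (l * RtoC t * w)) t.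
Proof.
  apply rcont_ext with (fun s => Cexp (0 + RtoC s * (l * w))).
  intros x. f_equal. ring. apply rcont_Cexp_line.
Qed.

(** As long as |l h| <= e / 2, the second-order remainder of exp (l t h) is |h|^2
    times a function that the decay e of the integrand makes integrable. *)
Theorem cderiv_HInt_param (g : R -> C) (l w0 : C) :
  (forall t, 0 <= t -> rcont g t) -> exp_decay (fun t => g t * Cexp (l * RtoC t * w0))%C ->
  cderiv (fun w => HInt (fun t => g t * Cexp (l * RtoC t * w)))%C w0
         (HInt (fun t => l * RtoC t * (g t * Cexp (l * RtoC t * w0))))%C.
Proof.
  intros Hg [Hc [K [e [HK [He HB]]]]].
  set (G := fun t => (g t * Cexp (l * RtoC t * w0))%C) in *.
  assert (P := Cmod_ge_0 l).
  set (d := e / (2 * (Cmod l + 1))).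
  assert (Hd : 0 < d) by (apply Rdiv_lt_0_compat; lra).
  assert (Hld : Cmod l * d <= e / 2).
  { apply Rle_trans with ((Cmod l + 1) * d). nra. unfold d. right; field; lra. }
  assert (EG : forall w t, (g t * Cexp (l * RtoC t * w) = G t * Cexp (l * RtoC t * (w - w0)))%C).
  { intros w t. unfold G. rewrite <- (Cmult_assoc (g t)), <- Cexp_add. do 2 f_equal. ring. }
  assert (Gb : forall t, 0 <= t -> Cmod (G t) <= K * exp (- e * t)) by exact HB.
  assert (D1 : forall h, Cmod h < d -> exp_decay (fun t => G t * Cexp (l * RtoC t * h))%C).
  { intros h Hh. split.
    - intros t Ht. apply rcont_mult; auto using rcont_Cexp_lin.
    - exists K, (e / 2). repeat split; auto. lra. intros t Ht. rewrite Cmod_mult, Cmod_Cexp.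
      replace (- (e / 2) * t) with (- e * t + e / 2 * t) by field. rewrite exp_plus, <- Rmult_assoc.
      apply Rmult_le_compat; auto using Cmod_ge_0. apply Rlt_le, exp_pos. apply exp_le.
      eapply Rle_trans; [apply Rle_abs|]. eapply Rle_trans; [apply re_le_Cmod|].
      rewrite !Cmod_mult, Cmod_R, Rabs_pos_eq by auto. assert (Q := Cmod_ge_0 h).
      assert (Cmod l * Cmod h <= e / 2) by nra. nra. }
  assert (D2 : exp_decay (fun t => l * RtoC t * G t)%C).
  { split.
    - intros t Ht. apply rcont_mult; auto. apply rcont_mult; auto using rcont_const.
      apply rcont_ext with (fun s => 0 + RtoC s * 1)%C. intros; ring. apply rcont_line.
    - exists (Cmod l * (2 / e) * K), (e / 2). split; [|split].
      repeat apply Rmult_le_pos; auto; try lra. apply Rlt_le, Rinv_0_lt_compat; auto. lra.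
      intros t Ht. rewrite !Cmod_mult, Cmod_R, Rabs_pos_eq by auto.
      assert (Y := linear_le_exp 2 e t ltac:(lra) He).
      replace (- (e / 2) * t) with (- e * t + e / 2 * t) by field. rewrite exp_plus.
      replace (Cmod l * (2 / e) * K * (exp (- e * t) * exp (e / 2 * t))) with
        (Cmod l * (2 / e * exp (e / 2 * t)) * (K * exp (- e * t))) by ring.
      apply Rmult_le_compat; auto using Cmod_ge_0. apply Rmult_le_pos; auto. apply Rmult_le_compat_l; auto. }
  set (K' := K * (Cmod l * Cmod l) * (8 / e * (8 / e))).
  assert (HK' : 0 <= K').
  { unfold K'. repeat apply Rmult_le_pos; auto; try lra; apply Rlt_le, Rinv_0_lt_compat; auto. }
  apply cderiv_quadratic with d (K' / (e / 4)); auto. apply Rdiv_le_0_compat; lra.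
  intros h Hh.
  assert (D0 : exp_decay G) by (split; [|exists K, e]; auto).
  replace (HInt (fun t => g t * Cexp (l * t * (w0 + h)))%C) with (HInt (fun t => G t * Cexp (l * t * h))%C).
  2:{ apply HInt_ext; auto. intros t Ht. rewrite (EG (w0 + h)%C). do 2 f_equal. ring. }
  change (HInt (fun t => l * RtoC t * (g t * Cexp (l * RtoC t * w0)))%C) with (HInt (fun t => l * RtoC t * G t)%C).
  fold G.
  rewrite <- (HInt_minus _ G), <- HInt_cmul, <- HInt_minus; auto using exp_decay_cmul.
  2:{ apply exp_decay_minus; auto. }
  replace (K' / (e / 4) * (Cmod h * Cmod h)) with ((K' * (Cmod h * Cmod h)) / (e / 4)) by (field; lra).
  assert (Hhh : 0 <= Cmod h * Cmod h) by (assert (Q := Cmod_ge_0 h); nra).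
  apply HInt_bound.
  - apply Rmult_le_pos; auto.
  - lra.
  - intros t Ht. apply rcont_ext with (fun t => (G t * Cexp (l * RtoC t * h) + (- (1)) * G t) + (- h) * (l * RtoC t * G t))%C.
    intros; ring. apply rcont_plus. apply rcont_plus. apply D1; auto. apply rcont_mult; auto using rcont_const.
    apply rcont_mult; auto using rcont_const. apply D2; auto.
  - intros t Ht.
    replace (G t * Cexp (l * t * h) - G t - h * (l * t * G t))%C with (G t * (Cexp (l * t * h) - 1 - l * t * h))%C by ring.
    rewrite Cmod_mult.
    assert (T := Cexp_taylor1 (l * t * h)). rewrite !Cmod_mult, Cmod_R, Rabs_pos_eq in T by auto.
    assert (Q := Cmod_ge_0 h).
    assert (Y := linear_le_exp 8 e t ltac:(lra) He).
    assert (Y2 : t * t <= 8 / e * (8 / e) * exp (e / 4 * t)).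
    { replace (e / 4 * t) with (e / 8 * t + e / 8 * t) by field. rewrite exp_plus.
      replace (8 / e * (8 / e) * (exp (e / 8 * t) * exp (e / 8 * t))) with
       ((8 / e * exp (e / 8 * t)) * (8 / e * exp (e / 8 * t))) by ring.
      apply Rmult_le_compat; auto. }
    assert (Z : exp (Cmod l * t * Cmod h) <= exp (e / 2 * t)).
    { apply exp_le. assert (Cmod l * Cmod h <= e / 2) by nra. nra. }
    replace (K' * (Cmod h * Cmod h) * exp (- (e / 4) * t)) with
      ((K * exp (- e * t)) * ((Cmod l * Cmod l) * (Cmod h * Cmod h) * (8 / e * (8 / e) * exp (e / 4 * t)) * exp (e / 2 * t))).
    2:{ unfold K'. replace (- (e / 4) * t) with (- e * t + e / 4 * t + e / 2 * t) by field. rewrite !exp_plus. ring. }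
    apply Rmult_le_compat; auto using Cmod_ge_0.
    eapply Rle_trans; [apply T|].
    replace (Cmod l * t * Cmod h * (Cmod l * t * Cmod h)) with (Cmod l * Cmod l * (Cmod h * Cmod h) * (t * t)) by ring.
    apply Rmult_le_compat; auto.
    repeat apply Rmult_le_pos; auto. apply Rlt_le, exp_pos.
    apply Rmult_le_compat_l; auto. repeat apply Rmult_le_pos; auto.
Qed.

Lemma holo_HInt_param (g : R -> C) (l w0 : C) :
  (forall t, 0 <= t -> rcont g t) -> exp_decay (fun t => g t * Cexp (l * RtoC t * w0))%C ->
  holo (fun w => HInt (fun t => g t * Cexp (l * RtoC t * w)))%C w0.
Proof. intros. eexists. apply cderiv_HInt_param; auto. Qed.

(** * Integrals over vertical lines and the residue theorem in a strip *)

Definition line_point (c s t : R) : C := (c, s * t).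

(** The integral along Re v = c with respect to Im v; the two half-lines, upward for
    s = 1 and downward for s = -1, are kept apart because each of them is an
    integral over [0, oo). *)
Definition vline_int (F : C -> C) (c : R) : C :=
  (HInt (fun t => F (line_point c 1 t)) + HInt (fun t => F (line_point c (- (1)) t)))%C.

Lemma line_point_eq c s t : line_point c s t = (RtoC c + RtoC t * (RtoC s * Ci))%C.
Proof. unfold line_point. cring. Qed.

Lemma rcont_line_point f c s t : ccont f (line_point c s t) -> rcont (fun t => f (line_point c s t)) t.
Proof.
  intros H. apply rcont_ext with (fun x => f (RtoC c + RtoC x * (RtoC s * Ci))%C). intros; rewrite line_point_eq; auto.
  apply (rcont_comp f). rewrite <- line_point_eq; auto. apply rcont_line.
Qed.

Lemma sign_abs s t : (s = 1 \/ s = - (1)) -> 0 <= t -> Rabs (s * t) = t.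
Proof. intros [->| ->] Ht. rewrite Rmult_1_l; apply Rabs_pos_eq; auto.
  replace (- (1) * t) with (- t) by ring. rewrite Rabs_Ropp. apply Rabs_pos_eq; auto. Qed.

Lemma CInt_reflect g T : 0 <= T -> cont_seg g (- T) T -> CInt g (- T) 0 = CInt (fun t => g (- (1) * t)) 0 T.
Proof.
  intros HT Hc. symmetry. apply (is_RInt_unique (V := C_R_CompleteNormedModule)).
  assert (H : is_RInt (V := C_R_NormedModule) g (- 0) (- T) (- CInt g (- T) 0)%C).
  { apply (is_RInt_swap (V := C_R_NormedModule)). rewrite Ropp_0. apply CInt_correct. lra. eapply cont_seg_sub; eauto; lra. }
  apply (is_RInt_comp_opp (V := C_R_NormedModule)) in H.
  apply (is_CInt_cmul (- (1))) in H.
  replace (- (1) * - CInt g (- T) 0)%C with (CInt g (- T) 0) in H by ring.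
  eapply is_RInt_ext; [|exact H]. intros x _.
  change (- (1) * - g (- x)%R = g (- (1) * x)%R)%C. replace (- (1) * x)%R with (- x)%R by ring. ring.
Qed.

Lemma exp_decay_of_tail g Y K e : 0 <= K -> 0 < e -> (forall t, 0 <= t -> rcont g t) ->
  (forall t, Y <= t -> Cmod (g t) <= K * exp (- e * t)) -> exp_decay g.
Proof.
  intros HK He Hc HB. split; auto.
  destruct (cont_seg_bounded g 0 (Rmax 0 Y)) as [M [HM BM]]. intros t Ht; apply Hc; lra.
  exists (K + M * exp (e * Rmax 0 Y)), e.
  assert (E0 : 0 < exp (e * Rmax 0 Y)) by apply exp_pos.
  split. nra. split; auto. intros t Ht.
  assert (E1 : 0 < exp (- e * t)) by apply exp_pos.
  destruct (Rle_dec (Rmax 0 Y) t) as [H|H].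
  - eapply Rle_trans; [apply HB|]. generalize (Rmax_r 0 Y); lra. apply Rmult_le_compat_r. lra. nra.
  - eapply Rle_trans; [apply BM; lra|]. rewrite Rmult_plus_distr_r, (Rmult_assoc M), <- exp_plus.
    assert (1 <= exp (e * Rmax 0 Y + - e * t)) by (rewrite <- exp_0; apply exp_le; nra). nra.
Qed.

(** The residue theorem on the rectangles |Im z| <= T: the horizontal sides vanish
    as T tends to oo. *)
Theorem residue_strip (F : C -> C) (A : C) c1 c2 z0 Y K e :
  c1 < Re z0 < c2 -> 0 <= K -> 0 < e ->
  (forall z, c1 <= Re z <= c2 -> z <> z0 -> holo F z) ->
  (forall eps, 0 < eps -> exists dl, 0 < dl /\ forall z, z <> z0 -> Cmod (z - z0) < dl ->
     Cmod ((z - z0) * F z - A)%C <= eps) ->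
  (forall x y, c1 <= x <= c2 -> Y <= Rabs y -> Cmod (F (x, y)) <= K * exp (- e * Rabs y)) ->
  (vline_int F c2 - vline_int F c1 = 2 * PI * A)%C.
Proof.
  intros Hz HK He Hol Hres Hdec.
  assert (Dec : forall c s, c = c1 \/ c = c2 -> s = 1 \/ s = - (1) -> exp_decay (fun t => F (line_point c s t))).
  { intros c s Hcc Hs. apply exp_decay_of_tail with (Rmax 0 Y) K e; auto.
    - intros t Ht. apply rcont_line_point, holo_ccont, Hol. destruct Hcc; simpl; lra. intros <-. simpl in Hz. destruct Hcc; lra.
    - intros t Ht. assert (A1 := Rmax_l 0 Y). assert (A2 := Rmax_r 0 Y).
      rewrite <- (sign_abs s t) at 2 by (auto; lra). apply Hdec. destruct Hcc; lra. rewrite sign_abs by (auto; lra). lra. }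
  assert (Key : (Ci * (vline_int F c2 - vline_int F c1) = 2 * PI * Ci * A)%C).
  { apply Ceq_of_close with 6. intros eps Heps.
    destruct (HInt_correct _ (Dec c1 1 ltac:(auto) ltac:(auto)) eps Heps) as [T1 [P1 Q1]].
    destruct (HInt_correct _ (Dec c1 (- (1)) ltac:(auto) ltac:(auto)) eps Heps) as [T2 [P2 Q2]].
    destruct (HInt_correct _ (Dec c2 1 ltac:(auto) ltac:(auto)) eps Heps) as [T3 [P3 Q3]].
    destruct (HInt_correct _ (Dec c2 (- (1)) ltac:(auto) ltac:(auto)) eps Heps) as [T4 [P4 Q4]].
    destruct (exp_neg_small (K * (c2 - c1)) e eps) as [T5 [P5 Q5]]; auto. apply Rmult_le_pos; lra.
    set (T := T1 + T2 + T3 + T4 + T5 + Rabs (Im z0) + Rabs Y + 1).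
    assert (A1 := Rabs_pos (Im z0)). assert (A2 := Rabs_pos Y).
    assert (A3 := Rle_abs (Im z0)). assert (A4 := Rle_abs Y). assert (A5 := Rle_abs (- Im z0)). rewrite Rabs_Ropp in A5.
    specialize (Q1 T ltac:(unfold T; lra)). specialize (Q2 T ltac:(unfold T; lra)).
    specialize (Q3 T ltac:(unfold T; lra)). specialize (Q4 T ltac:(unfold T; lra)). specialize (Q5 T ltac:(unfold T; lra)).
    assert (R := residue_rect F A c1 c2 (- T) T z0 Hz ltac:(unfold T; split; lra)).
    rewrite <- R; auto. 2:{ intros z Hz'; apply Hol. apply Hz'. }
    assert (HT : 0 <= T) by (unfold T; lra).
    assert (Vl : forall c, c = c1 \/ c = c2 -> CInt (fun y => F (c, y)) (- T) T = (CInt (fun t => F (line_point c 1 t)) 0 T + CInt (fun t => F (line_point c (- (1)) t)) 0 T)%C).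
    { intros c Hcc.
      assert (Cc : cont_seg (fun t => F (c, t)) (- T) T).
      { intros t Ht. apply rcont_ver, holo_ccont, Hol. destruct Hcc; simpl; lra. intros <-. simpl in Hz. destruct Hcc; lra. }
      rewrite <- (CInt_Chasles _ (- T) 0 T) by (auto; lra). rewrite (CInt_reflect (fun t => F (c, t))); auto.
      rewrite (CInt_ext (fun t => F (line_point c 1 t)) (fun t => F (c, t)) 0 T HT) by (intros; unfold line_point; rewrite Rmult_1_l; auto).
      unfold line_point. ring. }
    unfold rect_int. rewrite !Vl by auto.
    assert (H1 : forall y, Rabs y = T -> Cmod (CInt (fun x => F (x, y)) c1 c2) <= eps).
    { intros y Hy. eapply Rle_trans; [|apply Q5].
      replace (K * (c2 - c1) * exp (- e * T)) with ((K * exp (- e * T)) * (c2 - c1)) by ring.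
      apply CInt_bound_const. lra.
      - intros t Ht. apply rcont_hor, holo_ccont, Hol. simpl; lra. intros E. apply (f_equal Im) in E; simpl in E. subst y. unfold T in Hy; lra.
      - intros t Ht. rewrite <- Hy. apply Hdec; auto. rewrite Hy. unfold T; lra. }
    assert (H2 := H1 (- T) ltac:(rewrite Rabs_Ropp; apply Rabs_pos_eq; auto)).
    assert (H3 := H1 T ltac:(apply Rabs_pos_eq; auto)).
    unfold vline_int.
    match goal with |- Cmod ?X <= _ => replace X with (
      Ci * (CInt (fun t => F (line_point c1 1 t)) 0 T - HInt (fun t => F (line_point c1 1 t))) + Ci * (CInt (fun t => F (line_point c1 (- (1)) t)) 0 T - HInt (fun t => F (line_point c1 (- (1)) t)))
      - Ci * (CInt (fun t => F (line_point c2 1 t)) 0 T - HInt (fun t => F (line_point c2 1 t))) - Ci * (CInt (fun t => F (line_point c2 (- (1)) t)) 0 T - HInt (fun t => F (line_point c2 (- (1)) t)))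
      - CInt (fun x => F (x, (- T)%R)) c1 c2 + CInt (fun x => F (x, T)) c1 c2)%C by ring end.
    eapply Rle_trans; [apply Cmod_triangle|].
    eapply Rle_trans; [apply Rplus_le_compat_r, Cmod_triangle_minus|].
    eapply Rle_trans; [apply Rplus_le_compat_r, Rplus_le_compat_r, Cmod_triangle_minus|].
    eapply Rle_trans; [apply Rplus_le_compat_r, Rplus_le_compat_r, Rplus_le_compat_r, Cmod_triangle_minus|].
    eapply Rle_trans; [apply Rplus_le_compat_r, Rplus_le_compat_r, Rplus_le_compat_r, Rplus_le_compat_r, Cmod_triangle|].
    rewrite !(Cmod_mult Ci), Cmod_Ci. lra. }
  apply Cmult_reg_l with Ci. intros E. apply (f_equal Im) in E. simpl in E. lra.
  rewrite Key. ring.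
Qed.

(** * The sine and its poles *)

Lemma Ci_neq_0 : Ci <> 0.
Proof. intros E. apply (f_equal Im) in E. simpl in E. lra. Qed.

Lemma two_Ci_neq_0 : (2 * Ci)%C <> 0.
Proof. intros E. apply (f_equal Im) in E. simpl in E. lra. Qed.

Lemma Csin_lower z : (exp (Rabs (Im z)) - exp (- Rabs (Im z))) / 2 <= Cmod (Csin z).
Proof.
  unfold Csin. assert (N : (2 * Ci)%C <> 0) by (exact two_Ci_neq_0).
  rewrite Cmod_div, Cmod_mult, Cmod_Ci, Cmod_R, (Rabs_pos_eq 2) by (auto; lra).
  assert (E1 : Cmod (Cexp (Ci * z)) = exp (- Im z)) by (rewrite Cmod_Cexp; f_equal; destruct z; simpl; ring).
  assert (E2 : Cmod (Cexp (- (Ci * z))) = exp (Im z)) by (rewrite Cmod_Cexp; f_equal; destruct z; simpl; ring).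
  apply Rle_div_r. lra. replace ((exp (Rabs (Im z)) - exp (- Rabs (Im z))) / 2 * (2 * 1)) with (exp (Rabs (Im z)) - exp (- Rabs (Im z))) by field.
  assert (T1 := Cmod_triangle (Cexp (Ci * z) - Cexp (- (Ci * z))) (Cexp (- (Ci * z)))).
  replace (Cexp (Ci * z) - Cexp (- (Ci * z)) + Cexp (- (Ci * z)))%C with (Cexp (Ci * z)) in T1 by ring.
  assert (T2 := Cmod_triangle_minus (Cexp (Ci * z)) (Cexp (Ci * z) - Cexp (- (Ci * z)))).
  replace (Cexp (Ci * z) - (Cexp (Ci * z) - Cexp (- (Ci * z))))%C with (Cexp (- (Ci * z))) in T2 by ring.
  rewrite E1, E2 in *. unfold Rabs; destruct Rcase_abs; rewrite ?Ropp_involutive; lra.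
Qed.

Lemma Csin_coord x y : Csin (x, y) = (sin x * ((exp y + exp (- y)) / 2), cos x * ((exp y - exp (- y)) / 2)).
Proof.
  unfold Csin, Cexp; simpl.
  replace (0 * x - 1 * y) with (- y) by ring. replace (0 * y + 1 * x) with x by ring.
  rewrite Ropp_involutive, cos_neg, sin_neg.
  unfold Cdiv. replace (/ (2 * Ci))%C with ((0, - / 2) : C).
  apply Ceq; simpl; field.
  apply Cmult_reg_l with (2 * Ci)%C. exact two_Ci_neq_0.
  rewrite Cinv_r. apply Ceq; simpl; field. exact two_Ci_neq_0.
Qed.

Lemma Csin_0_inv x y : Csin (x, y) = 0 -> sin x = 0 /\ y = 0.
Proof.
  rewrite Csin_coord. intros E. assert (E1 := f_equal Re E). assert (E2 := f_equal Im E). simpl in E1, E2.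
  assert (0 < exp y) by apply exp_pos. assert (0 < exp (- y)) by apply exp_pos.
  assert (S : sin x = 0).
  { apply Rmult_integral in E1. destruct E1; auto. lra. }
  split; auto.
  apply Rmult_integral in E2. destruct E2 as [E2|E2].
  - generalize (sin2_cos2 x). unfold Rsqr. rewrite S, E2. lra.
  - assert (exp y = exp (- y)) by lra. apply exp_inv in H1. lra.
Qed.

Lemma Csin_PI_neq_0 v : (forall k : Z, v <> RtoC (IZR k)) -> Csin (RtoC PI * v) <> 0.
Proof.
  destruct v as [x y]. intros H E. replace (PI * (x, y))%C with ((PI * x, PI * y) : C) in E by cring.
  apply Csin_0_inv in E. destruct E as [E1 E2].
  apply sin_eq_0_0 in E1. destruct E1 as [k Hk]. apply (H k).
  assert (Hpi := PI_RGT_0). apply Ceq; simpl; nra.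
Qed.

Lemma not_int_of_between x (n : Z) : IZR n - 1 < x < IZR n -> forall k : Z, x <> IZR k.
Proof.
  intros [H1 H2] k ->. apply lt_IZR in H2. rewrite <- minus_IZR in H1. apply lt_IZR in H1. lia.
Qed.

Lemma Csin_PI_neq_0_between v (n : Z) : IZR n - 1 < Re v < IZR n -> Csin (RtoC PI * v) <> 0.
Proof.
  intros H. apply Csin_PI_neq_0. intros k ->. apply (not_int_of_between _ _ H k). reflexivity.
Qed.

Lemma Csin_PI_lower x y : 1 <= Rabs y -> exp (PI * Rabs y) / 4 <= Cmod (Csin (RtoC PI * (x, y))).
Proof.
  intros Hy. eapply Rle_trans; [|apply Csin_lower].
  assert (Hpi := PI2_3_2).
  replace (Im (PI * (x, y))) with (PI * y) by (simpl; ring). rewrite Rabs_mult, (Rabs_pos_eq PI) by lra.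
  assert (E1 : 1 <= PI * Rabs y) by (clear - Hpi Hy; nra).
  assert (X := exp_ineq1_le (PI * Rabs y)).
  assert (E2 : exp (PI * Rabs y) * exp (- (PI * Rabs y)) = 1) by (rewrite <- exp_plus, <- exp_0; f_equal; ring).
  assert (0 < exp (- (PI * Rabs y))) by apply exp_pos.
  assert (2 <= exp (PI * Rabs y)) by lra. assert (2 * exp (- (PI * Rabs y)) <= 1) by nra. lra.
Qed.

(** Midway between two poles the bound holds down to the real axis and does not
    depend on the line. *)
Lemma Csin_PI_half_lower c y : Rabs (sin (PI * c)) = 1 -> exp (PI * Rabs y) / 2 <= Cmod (Csin (RtoC PI * (c, y))).
Proof.
  intros Hc. replace (PI * (c, y))%C with ((PI * c, PI * y) : C) by cring. rewrite Csin_coord.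
  eapply Rle_trans; [|apply re_le_Cmod]. simpl. rewrite Rabs_mult, Hc, Rmult_1_l.
  assert (Hpi := PI_RGT_0).
  assert (0 < exp (PI * y)) by apply exp_pos. assert (0 < exp (- (PI * y))) by apply exp_pos.
  rewrite (Rabs_pos_eq ((exp (PI * y) + exp (- (PI * y))) / 2)) by lra.
  unfold Rabs; destruct Rcase_abs. replace (PI * - y) with (- (PI * y)) by ring. lra. lra.
Qed.

Lemma sin_PI_IZR k : sin (PI * IZR k) = 0.
Proof. apply sin_eq_0_1. exists k. ring. Qed.

Lemma cos_PI_IZR_sq k : cos (PI * IZR k) * cos (PI * IZR k) = 1.
Proof. generalize (sin2_cos2 (PI * IZR k)). unfold Rsqr. rewrite sin_PI_IZR. lra. Qed.

Lemma sin_PI_half k : Rabs (sin (PI * (IZR k - / 2))) = 1.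
Proof.
  replace (PI * (IZR k - / 2)) with (PI * IZR k - PI / 2) by field.
  rewrite sin_minus, sin_PI_IZR, cos_PI2, sin_PI2. assert (X := cos_PI_IZR_sq k).
  replace (0 * 0 - cos (PI * IZR k) * 1) with (- cos (PI * IZR k)) by ring.
  rewrite Rabs_Ropp. destruct (Rle_dec 0 (cos (PI * IZR k))).
  rewrite Rabs_pos_eq; auto; nra. rewrite Rabs_left; nra.
Qed.

Lemma Cexp_i_PI_IZR k : Cexp (Ci * (RtoC PI * RtoC (IZR k))) = RtoC (cos (PI * IZR k)).
Proof.
  unfold Cexp; simpl.
  replace (0 * (PI * IZR k - 0 * 0) - 1 * (PI * 0 + 0 * IZR k)) with 0 by ring.
  replace (0 * (PI * 0 + 0 * IZR k) + 1 * (PI * IZR k - 0 * 0)) with (PI * IZR k) by ring.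
  rewrite exp_0, sin_PI_IZR. apply Ceq; simpl; ring.
Qed.

Lemma holo_Csin_PI v : holo (fun v => Csin (RtoC PI * v)) v.
Proof. unfold Csin. unfold Cdiv. auto 10 with hol. Qed.
#[export] Hint Resolve holo_Csin_PI : hol.

Lemma cderiv_Csin_PI_IZR k : cderiv (fun v => Csin (RtoC PI * v)) (RtoC (IZR k)) (RtoC (PI * cos (PI * IZR k))).
Proof.
  set (n := RtoC (IZR k)).
  assert (D3 := cderiv_plus _ _ n _ _ (cderiv_Cexp_scal (Ci * PI) n) (cderiv_scal (- (1)) _ n _ (cderiv_Cexp_scal (- (Ci * PI)) n))).
  assert (D4 := cderiv_scal (/ (2 * Ci)) _ n _ D3). cbv beta in D4.
  assert (N : (2 * Ci)%C <> 0) by (exact two_Ci_neq_0).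
  replace (RtoC (PI * cos (PI * IZR k))) with
   (/ (2 * Ci) * (Ci * PI * Cexp (Ci * PI * n) + - (1) * (- (Ci * PI) * Cexp (- (Ci * PI) * n))))%C.
  - eapply cderiv_ext; [|exact D4]. intros x. unfold Csin, Cdiv.
    replace (Ci * (PI * x))%C with (Ci * PI * x)%C by ring.
    replace (- (Ci * PI * x))%C with (- (Ci * PI) * x)%C by ring. ring.
  - replace (- (Ci * PI) * n)%C with (- (Ci * (PI * n)))%C by ring. replace (Ci * PI * n)%C with (Ci * (PI * n))%C by ring.
    rewrite Cexp_opp. unfold n. rewrite Cexp_i_PI_IZR.
    assert (Q := cos_PI_IZR_sq k). set (c := cos (PI * IZR k)) in *.
    assert (c <> 0) by (intros E; rewrite E in Q; lra).
    replace (/ RtoC c)%C with (RtoC c). rewrite RtoC_mult. field. apply Ci_neq_0.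
    rewrite <- RtoC_inv by auto. f_equal. apply Rmult_eq_reg_l with c; auto. rewrite Rinv_r; auto.
Qed.

Lemma residue_quotient (G S : C -> C) (D n : C) : ccont G n -> S n = 0 -> cderiv S n D -> D <> 0 ->
  forall eps, 0 < eps -> exists dl, 0 < dl /\ forall z, z <> n -> Cmod (z - n) < dl ->
     Cmod ((z - n) * (G z / S z) - G n / D)%C <= eps.
Proof.
  intros HG HS HD ND eps Heps.
  destruct (Cmult_near (G n) (/ D) eps Heps) as [d [Hd H1]].
  destruct (HG d Hd) as [d1 [Hd1 H2]].
  destruct (holo_ccont Cinv D (holo_inv _ D ND (holo_id D)) d Hd) as [d2 [Hd2 H3]].
  assert (PD := proj1 (Cmod_gt_0 D) ND).
  set (d3 := Rmin d2 (Cmod D) / 2).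
  assert (Q : 0 < Rmin d2 (Cmod D)) by (apply Rmin_pos; auto).
  assert (Q1 := Rmin_l d2 (Cmod D)). assert (Q2 := Rmin_r d2 (Cmod D)).
  destruct (HD d3) as [d4 [Hd4 H4]]. unfold d3; lra.
  exists (Rmin d1 d4). split. apply Rmin_pos; auto.
  intros z Hz Hzn. apply lt_Rmin in Hzn. destruct Hzn as [h1 h4].
  specialize (H2 _ h1). specialize (H4 _ h4). replace (n + (z - n))%C with z in * by ring.
  assert (N : (z - n)%C <> 0) by (apply Cminus_eq_contra; auto).
  assert (PN := proj1 (Cmod_gt_0 _) N).
  set (k := (S z / (z - n) - D)%C).
  assert (Hk : Cmod k <= d3).
  { unfold k. replace (S z / (z - n) - D)%C with ((S z - S n - (z - n) * D) / (z - n))%C by (rewrite HS; field; auto).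
    rewrite Cmod_div by auto. apply Rle_div_l; auto. }
  assert (NS : S z <> 0).
  { intros E. unfold k in Hk. rewrite E in Hk. replace (0 / (z - n) - D)%C with (- D)%C in Hk by (field; auto).
    rewrite Cmod_opp in Hk. unfold d3 in Hk. lra. }
  specialize (H3 k ltac:(unfold d3 in Hk; lra)).
  replace (D + k)%C with (S z / (z - n))%C in H3 by (unfold k; ring).
  left. specialize (H1 _ _ H2 H3).
  replace (G n + (G z - G n))%C with (G z) in H1 by ring.
  replace (/ D + (/ (S z / (z - n)) - / D))%C with (/ (S z / (z - n)))%C in H1 by ring.
  replace ((z - n) * (G z / S z) - G n / D)%C with (G z * / (S z / (z - n)) - G n * / D)%C by (field; auto). auto.
Qed.

(** * Mellin-Barnes integrals *)

(** Exponential type b in every vertical strip, to the left as well as to the right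
    of the imaginary axis. *)
Definition strip_growth (phi : C -> C) (b : R) : Prop :=
  forall m, 0 <= m -> exists K, 0 < K /\ forall x y, Rabs x <= m -> Cmod (phi (x, y)) <= K * exp (b * Rabs y).

Definition kern (phi : C -> C) (zeta v : C) : C := (phi v * Cexp (v * zeta) / Csin (RtoC PI * v))%C.

(** The Mellin-Barnes integral along Re v = c of the kernel phi v e^(v zeta) / sin
    (PI v), with respect to Im v. *)
Definition Mell (phi : C -> C) (c : R) (zeta : C) : C := vline_int (kern phi zeta) c.

Lemma Cmod_Cexp_mult x y zeta : Cmod (Cexp ((x, y) * zeta)) <= exp (x * Re zeta + Rabs (Im zeta) * Rabs y).
Proof.
  rewrite Cmod_Cexp. apply exp_le. destruct zeta as [p q]; simpl.
  assert (- (y * q) <= Rabs q * Rabs y) by (rewrite <- Rabs_mult, Rmult_comm, <- Rabs_Ropp; apply Rle_abs). lra.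
Qed.

(** 1 / sin (PI v) decays like e^(- PI |y|), which leaves room for the type b of phi
    and for |Im zeta|. *)
Lemma kern_decay phi b zeta m : strip_growth phi b -> Rabs (Im zeta) < PI - b -> 0 <= m ->
  exists K e, 0 <= K /\ 0 < e /\ forall x y, Rabs x <= m -> 1 <= Rabs y -> Cmod (kern phi zeta (x, y)) <= K * exp (- e * Rabs y).
Proof.
  intros HG Hz Hm. destruct (HG m Hm) as [K [HK HB]].
  set (E := exp (m * Rabs (Re zeta))). assert (HE : 0 < E) by apply exp_pos.
  exists (K * E * 4), (PI - b - Rabs (Im zeta)). split. nra. split. lra.
  intros x y Hx Hy. specialize (HB x y Hx).
  assert (S := Csin_PI_lower x y Hy).
  assert (P : 0 < exp (PI * Rabs y)) by apply exp_pos.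
  assert (N : Csin (PI * (x, y)) <> 0) by (apply Cmod_gt_0; lra).
  unfold kern. rewrite Cmod_div, Cmod_mult by auto.
  assert (X : Cmod (Cexp ((x, y) * zeta)) <= E * exp (Rabs (Im zeta) * Rabs y)).
  { eapply Rle_trans; [apply Cmod_Cexp_mult|]. unfold E. rewrite <- exp_plus. apply exp_le. apply Rplus_le_compat_r.
    eapply Rle_trans; [apply Rle_abs|]. rewrite Rabs_mult. apply Rmult_le_compat_r; auto. apply Rabs_pos. }
  apply Rle_trans with ((K * exp (b * Rabs y)) * (E * exp (Rabs (Im zeta) * Rabs y)) * / (exp (PI * Rabs y) / 4)).
  - apply Rmult_le_compat. apply Rmult_le_pos; apply Cmod_ge_0. apply Rlt_le, Rinv_0_lt_compat; lra.
    apply Rmult_le_compat; auto using Cmod_ge_0. apply Rinv_le_contravar; lra.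
  - right. replace (- (PI - b - Rabs (Im zeta)) * Rabs y) with (b * Rabs y + Rabs (Im zeta) * Rabs y + - (PI * Rabs y)) by ring.
    rewrite !exp_plus, exp_Ropp. field. lra.
Qed.

Lemma kern_holo phi zeta v : (forall z, holo phi z) -> Csin (RtoC PI * v) <> 0 -> holo (kern phi zeta) v.
Proof. intros Hol N. unfold kern. apply holo_div; auto 10 with hol. Qed.

Lemma kern_exp_decay phi b zeta c (n : Z) s : (forall z, holo phi z) -> strip_growth phi b -> Rabs (Im zeta) < PI - b ->
  IZR n - 1 < c < IZR n -> (s = 1 \/ s = - (1)) -> exp_decay (fun t => kern phi zeta (line_point c s t)).
Proof.
  intros Hol HG Hz Hc Hs.
  destruct (kern_decay phi b zeta (Rabs c) HG Hz (Rabs_pos c)) as [K [e [HK [He HB]]]].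
  apply exp_decay_of_tail with 1 K e; auto.
  - intros t _. apply rcont_line_point, holo_ccont, kern_holo; auto. apply Csin_PI_neq_0_between with n. auto.
  - intros t Ht. rewrite <- (sign_abs s t) at 2 by (auto; lra). apply HB. lra. rewrite sign_abs by (auto; lra). lra.
Qed.

Lemma residue_zero (F : C -> C) z0 : ccont F z0 ->
  forall eps, 0 < eps -> exists dl, 0 < dl /\ forall z, z <> z0 -> Cmod (z - z0) < dl ->
     Cmod ((z - z0) * F z - 0)%C <= eps.
Proof.
  intros HF eps Heps. destruct (Cmult_near 0 (F z0) eps Heps) as [d [Hd H1]].
  destruct (HF d Hd) as [d1 [Hd1 H2]]. exists (Rmin d d1). split. apply Rmin_pos; auto.
  intros z _ Hz. left. apply lt_Rmin in Hz. destruct Hz as [h1 h2].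
  specialize (H1 _ _ h1 (H2 _ h2)). replace (z0 + (z - z0))%C with z in H1 by ring.
  replace ((z - z0) * F z - 0)%C with ((0 + (z - z0)) * (F z0 + (F z - F z0)) - 0 * F z0)%C by ring. auto.
Qed.

Lemma Mell_shift_free phi b zeta c1 c2 (n : Z) : (forall z, holo phi z) -> strip_growth phi b -> Rabs (Im zeta) < PI - b ->
  IZR n - 1 < c1 -> c1 < c2 -> c2 < IZR n -> Mell phi c2 zeta = Mell phi c1 zeta.
Proof.
  intros Hol HG Hz H1 H2 H3.
  destruct (kern_decay phi b zeta (Rabs c1 + Rabs c2) HG Hz) as [K [e [HK [He HB]]]].
  { generalize (Rabs_pos c1) (Rabs_pos c2); lra. }
  assert (Hh : forall z, c1 <= Re z <= c2 -> holo (kern phi zeta) z).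
  { intros z Hzz. apply kern_holo; auto. apply Csin_PI_neq_0_between with n; lra. }
  apply Cminus_eq_0. unfold Mell.
  rewrite (residue_strip (kern phi zeta) 0 c1 c2 (((c1 + c2) / 2)%R, 0%R) 1 K e); auto.
  - ring.
  - simpl; lra.
  - apply residue_zero, holo_ccont, Hh. simpl; lra.
  - intros x y Hx Hy. apply HB; auto using Rabs_le_sum.
Qed.

(** The residue of the kernel at n is phi n (- e^zeta)^n / PI. *)
Lemma Mell_shift_pole phi b zeta (n : Z) : (forall z, holo phi z) -> strip_growth phi b -> Rabs (Im zeta) < PI - b ->
  (Mell phi (IZR n + / 2) zeta - Mell phi (IZR n - / 2) zeta =
    2 * phi (RtoC (IZR n)) * (RtoC (cos (PI * IZR n)) * Cexp (RtoC (IZR n) * zeta)))%C.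
Proof.
  intros Hol HG Hz.
  destruct (kern_decay phi b zeta (Rabs (IZR n) + 1) HG Hz) as [K [e [HK [He HB]]]].
  { generalize (Rabs_pos (IZR n)); lra. }
  assert (Q := cos_PI_IZR_sq n). set (c := cos (PI * IZR n)) in *.
  assert (Hc : c <> 0) by (intros E; rewrite E in Q; lra).
  assert (Hpi := PI_RGT_0).
  assert (ND : RtoC (PI * c) <> 0).
  { apply RtoC_neq_0. intros E. apply Rmult_integral in E. lra. }
  unfold Mell.
  rewrite (residue_strip (kern phi zeta) (phi (RtoC (IZR n)) * Cexp (RtoC (IZR n) * zeta) / RtoC (PI * c))%C _ _ (RtoC (IZR n)) 1 K e); auto.
  - assert (NP : RtoC PI <> 0) by (apply RtoC_neq_0; lra).
    assert (Ic : (/ RtoC (PI * c) = / PI * c)%C).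
    { apply Cmult_reg_l with (RtoC (PI * c)); auto. rewrite Cinv_r by auto. rewrite RtoC_mult.
      replace (PI * c * (/ PI * c))%C with (PI * / PI * (c * c))%C by ring.
      rewrite <- (RtoC_mult c c), Q, Cinv_r by auto. ring. }
    unfold Cdiv. rewrite Ic. field. auto.
  - simpl; lra.
  - intros z Hzz N. apply kern_holo; auto. apply Csin_PI_neq_0. intros k ->. apply N. do 2 f_equal. simpl in Hzz.
    destruct Hzz as [A1 A2].
    assert (k - 1 < n)%Z by (apply lt_IZR; rewrite minus_IZR; lra).
    assert (n < k + 1)%Z by (apply lt_IZR; rewrite plus_IZR; lra). lia.
  - apply (residue_quotient (fun v => phi v * Cexp (v * zeta))%C (fun v => Csin (RtoC PI * v))); auto.
    + apply holo_ccont. auto with hol.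
    + replace (PI * IZR n)%C with ((PI * IZR n, 0) : C) by cring. rewrite Csin_coord, sin_PI_IZR.
      rewrite Ropp_0, exp_0. apply Ceq; simpl; field.
    + apply cderiv_Csin_PI_IZR.
  - intros x y Hx Hy. apply HB; auto.
    assert (A1 := Rle_abs (IZR n)). assert (A3 := Rle_abs (- IZR n)).
    rewrite Rabs_Ropp in *. apply Rabs_le; lra.
Qed.

Lemma kern_line_point phi c s t z :
  kern phi z (line_point c s t) =
  (Cexp (RtoC c * z) * (phi (line_point c s t) / Csin (RtoC PI * line_point c s t) * Cexp (RtoC s * Ci * RtoC t * z)))%C.
Proof.
  unfold kern, Cdiv. replace (line_point c s t * z)%C with (RtoC c * z + RtoC s * Ci * RtoC t * z)%C by (rewrite line_point_eq; ring).
  rewrite Cexp_add. ring.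
Qed.

Lemma Cexp_cancel (a x : C) : (Cexp (- a) * (Cexp a * x) = x)%C.
Proof. rewrite Cmult_assoc, Cexp_opp_mult. ring. Qed.

Lemma half_integrand_decay phi b z c (n : Z) s : (forall z, holo phi z) -> strip_growth phi b -> Rabs (Im z) < PI - b ->
  IZR n - 1 < c < IZR n -> (s = 1 \/ s = - (1)) ->
  exp_decay (fun t => phi (line_point c s t) / Csin (RtoC PI * line_point c s t) * Cexp (RtoC s * Ci * RtoC t * z))%C.
Proof.
  intros Hol HG Hz Hc Hs. apply exp_decay_ext with (fun t => Cexp (- (RtoC c * z)) * kern phi z (line_point c s t))%C.
  intros t. rewrite kern_line_point. apply Cexp_cancel. apply exp_decay_cmul, kern_exp_decay with b n; assumption.
Qed.

Lemma holo_half_Mell phi b zeta c (n : Z) s : (forall z, holo phi z) -> strip_growth phi b -> Rabs (Im zeta) < PI - b ->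
  IZR n - 1 < c < IZR n -> (s = 1 \/ s = - (1)) ->
  holo (fun zeta => HInt (fun t => kern phi zeta (line_point c s t))) zeta.
Proof.
  intros Hol HG Hz Hc Hs.
  set (g := fun t : R => (phi (line_point c s t) / Csin (RtoC PI * line_point c s t))%C).
  assert (D : forall z, Rabs (Im z) < PI - b -> exp_decay (fun t => g t * Cexp (RtoC s * Ci * RtoC t * z))%C).
  { intros z Hzz. exact (half_integrand_decay phi b z c n s Hol HG Hzz Hc Hs). }
  apply holo_ext_loc with (fun z => Cexp (RtoC c * z) * HInt (fun t => g t * Cexp (RtoC s * Ci * RtoC t * z)))%C.
  - exists (PI - b - Rabs (Im zeta)). split. lra. intros z Hzz. apply Im_near in Hzz.
    rewrite <- HInt_cmul by (apply D; exact Hzz). apply HInt_ext. apply exp_decay_cmul, D; exact Hzz.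
    intros t _. symmetry. apply kern_line_point.
  - apply holo_mult. auto with hol. apply (holo_HInt_param g (RtoC s * Ci)); [|apply D; exact Hz].
    intros t _. apply (rcont_line_point (fun v => phi v / Csin (RtoC PI * v))%C).
    apply holo_ccont, holo_div; auto with hol. apply Csin_PI_neq_0_between with n. exact Hc.
Qed.

Lemma holo_Mell phi b zeta c (n : Z) : (forall z, holo phi z) -> strip_growth phi b -> Rabs (Im zeta) < PI - b ->
  IZR n - 1 < c < IZR n -> holo (Mell phi c) zeta.
Proof. intros. apply holo_plus; apply holo_half_Mell with b n; auto. Qed.

(** The constant does not depend on n, because sin (PI v) is bounded below uniformly
    on the lines midway between integers. *)
Lemma Mell_bound phi K a b zeta : (forall z, holo phi z) -> strip_growth phi b -> Rabs (Im zeta) < PI - b -> 0 < K ->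
  (forall x y, 0 <= x -> Cmod (phi (x, y)) <= K * exp (a * x + b * Rabs y)) ->
  exists C, 0 <= C /\ forall n : nat, Cmod (Mell phi (INR n + / 2) zeta) <= C * exp ((INR n + / 2) * (a + Re zeta)).
Proof.
  intros Hol HG Hz HK HB. set (e := PI - b - Rabs (Im zeta)). assert (He : 0 < e) by (unfold e; lra).
  exists (4 * K / e). split. apply Rdiv_le_0_compat; lra. intros n. set (c := INR n + / 2).
  assert (Hc0 : 0 <= c) by (unfold c; generalize (pos_INR n); lra).
  assert (Hc : IZR (Z.of_nat n + 1) - 1 < c < IZR (Z.of_nat n + 1)).
  { rewrite plus_IZR, <- INR_IZR_INZ. unfold c; lra. }
  assert (D := fun s Hs => proj1 (kern_exp_decay phi b zeta c _ s Hol HG Hz Hc Hs)).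
  assert (B : forall y, Cmod (kern phi zeta (c, y)) <= (2 * K * exp (c * (a + Re zeta))) * exp (- e * Rabs y)).
  { intros y. assert (S := Csin_PI_half_lower c y).
    assert (S1 : Rabs (sin (PI * c)) = 1).
    { replace c with (IZR (Z.of_nat n + 1) - / 2). apply sin_PI_half. rewrite plus_IZR, <- INR_IZR_INZ. unfold c; lra. }
    specialize (S S1). assert (P : 0 < exp (PI * Rabs y)) by apply exp_pos.
    assert (N : Csin (PI * (c, y)) <> 0) by (apply Cmod_gt_0; lra).
    unfold kern. rewrite Cmod_div, Cmod_mult by auto.
    apply Rle_trans with ((K * exp (a * c + b * Rabs y)) * exp (c * Re zeta + Rabs (Im zeta) * Rabs y) * / (exp (PI * Rabs y) / 2)).
    - apply Rmult_le_compat. apply Rmult_le_pos; apply Cmod_ge_0. apply Rlt_le, Rinv_0_lt_compat; lra.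
      apply Rmult_le_compat; auto using Cmod_ge_0, Cmod_Cexp_mult. apply Rinv_le_contravar; lra.
    - right. unfold e.
      replace (- (PI - b - Rabs (Im zeta)) * Rabs y) with (b * Rabs y + Rabs (Im zeta) * Rabs y + - (PI * Rabs y)) by ring.
      replace (c * (a + Re zeta)) with (a * c + c * Re zeta) by ring.
      rewrite !exp_plus, exp_Ropp. field. lra. }
  assert (P0 : 0 <= 2 * K * exp (c * (a + Re zeta))) by (assert (0 < exp (c * (a + Re zeta))) by apply exp_pos; nra).
  unfold Mell, vline_int. eapply Rle_trans; [apply Cmod_triangle|].
  replace (4 * K / e * exp (c * (a + Re zeta))) with (2 * K * exp (c * (a + Re zeta)) / e + 2 * K * exp (c * (a + Re zeta)) / e) by (field; lra).
  apply Rplus_le_compat; apply HInt_bound; auto; intros t Ht.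
  - rewrite <- (sign_abs 1 t) at 2 by auto. apply B.
  - rewrite <- (sign_abs (- (1)) t) at 2 by auto. apply B.
Qed.

Lemma neg_exp_pow (n : nat) zeta : ((- Cexp zeta) ^ n = RtoC (cos (PI * INR n)) * Cexp (RtoC (INR n) * zeta))%C.
Proof.
  rewrite Cexp_nat_mult. induction n.
  - simpl. rewrite Rmult_0_r, cos_0. ring.
  - rewrite !Cpow_S, IHn, S_INR. replace (PI * (INR n + 1)) with (PI * INR n + PI) by ring. rewrite neg_cos, RtoC_opp. ring.
Qed.

Lemma Mell_partial phi b zeta (n : nat) : (forall z, holo phi z) -> strip_growth phi b -> Rabs (Im zeta) < PI - b ->
  sum_n (G := C_AbelianGroup) (fun k => phi (RtoC (INR k)) * (- Cexp zeta) ^ k)%C n =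
   (/ 2 * Mell phi (INR n + / 2) zeta - / 2 * Mell phi (- / 2) zeta)%C.
Proof.
  intros Hol HG Hz. induction n.
  - rewrite sum_O. assert (E := Mell_shift_pole phi b zeta 0 Hol HG Hz).
    replace (IZR 0 - / 2) with (- / 2) in E by ring. simpl INR.
    rewrite Rmult_0_r, cos_0 in E. replace (RtoC (IZR 0) * zeta)%C with (RtoC 0) in E by ring. rewrite Cexp_0 in E.
    transitivity (/ 2 * (Mell phi (0 + / 2) zeta - Mell phi (- / 2) zeta))%C. rewrite E. simpl. field.
    match goal with |- ?x = ?y => change (@eq C x y) end. ring.
  - rewrite sum_Sn, IHn. rewrite neg_exp_pow.
    assert (E := Mell_shift_pole phi b zeta (Z.of_nat (S n)) Hol HG Hz). rewrite <- INR_IZR_INZ in E.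
    replace (INR n + / 2) with (INR (S n) - / 2) by (rewrite S_INR; field).
    change (/ 2 * Mell phi (INR (S n) - / 2) zeta - / 2 * Mell phi (- / 2) zeta + phi (RtoC (INR (S n))) * (RtoC (cos (PI * INR (S n))) * Cexp (RtoC (INR (S n)) * zeta)) =
      / 2 * Mell phi (INR (S n) + / 2) zeta - / 2 * Mell phi (- / 2) zeta)%C.
    replace (phi (RtoC (INR (S n))) * (RtoC (cos (PI * INR (S n))) * Cexp (RtoC (INR (S n)) * zeta)))%C with
     (/ 2 * (Mell phi (INR (S n) + / 2) zeta - Mell phi (INR (S n) - / 2) zeta))%C. ring.
    rewrite E. field.
Qed.

Lemma pseries_term_sum (a : nat -> C) (z : C) n :
  sum_n (G := C_AbelianGroup) (fun k => a k * z ^ k)%C n =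
  sum_n (G := NormedModule.AbelianGroup _ C_NormedModule) (fun k => scal (V := C_NormedModule) (pow_n (K := C_AbsRing) z k) (a k)) n.
Proof.
  apply sum_n_ext. intros k. change (a k * z ^ k = pow_n (K := C_AbsRing) z k * a k)%C.
  replace (pow_n (K := C_AbsRing) z k) with (z ^ k)%C. ring. induction k; simpl; auto.
Qed.

Lemma is_pseries_C (a : nat -> C) (z l : C) :
  is_pseries (K := C_AbsRing) (V := C_NormedModule) a z l <->
  (forall eps, 0 < eps -> exists N, forall n, (N <= n)%nat ->
     Cmod (sum_n (G := C_AbelianGroup) (fun k => a k * z ^ k)%C n - l) < eps).
Proof.
  assert (X := fun f => filterlim_locally_ball_norm (K := C_AbsRing) (U := C_NormedModule) (F := eventually) f l).
  split; intros H.
  - intros eps Heps. destruct (proj1 (X _) H (mkposreal eps Heps)) as [N HN]. exists N. intros n Hn.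
    rewrite pseries_term_sum. apply (HN n Hn).
  - apply X. intros [eps Heps]. destruct (H eps Heps) as [N HN]. exists N. intros n Hn. specialize (HN n Hn).
    rewrite pseries_term_sum in HN. exact HN.
Qed.

(** Moving the line from -1/2 to n + 1/2 picks up the first terms of the power
    series at - e^zeta, and for Re zeta < - a the integral over the moved line tends
    to 0. *)
Theorem Mell_pseries phi K a b zeta : (forall z, holo phi z) -> strip_growth phi b -> Rabs (Im zeta) < PI - b -> 0 < K ->
  (forall x y, 0 <= x -> Cmod (phi (x, y)) <= K * exp (a * x + b * Rabs y)) ->
  Re zeta < - a ->
  is_pseries (K := C_AbsRing) (V := C_NormedModule) (fun n => phi (RtoC (INR n))) (- Cexp zeta)%C (- (/ 2 * Mell phi (- / 2) zeta))%C.
Proof.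
  intros Hol HG Hz HK HB Ha. apply is_pseries_C. intros eps Heps.
  destruct (Mell_bound phi K a b zeta) as [C [HC BC]]; auto.
  destruct (exp_neg_small C (- (a + Re zeta)) (eps / 2)) as [T0 [HT0 HT]]; auto; try lra.
  destruct (INR_archimed 1 T0) as [N HN]. lra.
  exists N. intros n Hn. rewrite (Mell_partial phi b) by auto.
  replace (/ 2 * Mell phi (INR n + / 2) zeta - / 2 * Mell phi (- / 2) zeta - - (/ 2 * Mell phi (- / 2) zeta))%C with
   (/ 2 * Mell phi (INR n + / 2) zeta)%C by ring.
  apply le_INR in Hn. specialize (HT (INR n + / 2) ltac:(lra)). specialize (BC n).
  rewrite Cmod_mult, Cmod_inv, Cmod_R, Rabs_pos_eq by (auto using C2_neq_0; lra).
  replace (- - (a + Re zeta) * (INR n + / 2)) with ((INR n + / 2) * (a + Re zeta)) in HT by ring.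
  assert (0 <= Cmod (Mell phi (INR n + / 2) zeta)) by apply Cmod_ge_0. lra.
Qed.

(** * Laplace transforms along rays *)

Definition twist (phi : C -> C) (w z : C) : C := (phi z * Cexp (- w * z))%C.

Definition ray_transform (phi : C -> C) (th : R) (w : C) : C :=
  HInt (fun t => twist phi w (polar t th) * Cexp (Ci * RtoC th))%C.

(** The rays on which the Laplace integral of phi at w converges exponentially. *)
Definition good_ray (phi : C -> C) (w : C) (th : R) : Prop :=
  exists e, 0 < e /\ ray_bound (twist phi w) th (- e).

Lemma twist_holo phi w z : (forall z, holo phi z) -> holo (twist phi w) z.
Proof. intros. unfold twist. auto 10 with hol. Qed.

Lemma twist_order1 phi w : order1 phi -> order1 (twist phi w).
Proof. intros. apply order1_mult_exp; auto. Qed.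

Lemma polar_line t th : polar t th = (0 + RtoC t * Cexp (Ci * RtoC th))%C.
Proof. unfold polar. ring. Qed.

Lemma ray_decay f th e : (forall z, holo f z) -> 0 < e -> ray_bound f th (- e) ->
  exp_decay (fun t => f (polar t th) * Cexp (Ci * RtoC th))%C.
Proof.
  intros Hol He [K [HK HB]]. split.
  - intros t Ht. apply rcont_mult; auto using rcont_const.
    apply rcont_ext with (fun t => f (0 + RtoC t * Cexp (Ci * RtoC th))%C). intros; rewrite polar_line; auto.
    apply (rcont_comp f). apply holo_ccont; auto. apply rcont_line.
  - exists K, e. repeat split; auto. lra. intros t Ht.
    rewrite Cmod_mult, Cmod_Cexp. replace (Re (Ci * th)) with 0 by (simpl; ring). rewrite exp_0, Rmult_1_r. auto.
Qed.

Lemma ray_primitive f F th T : (forall z, holo f z) -> (forall z, cderiv F z (f z)) -> 0 <= T ->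
  CInt (fun t => f (polar t th) * Cexp (Ci * RtoC th))%C 0 T = (F (polar T th) - F 0)%C.
Proof.
  intros Hol HF HT. replace (RtoC 0) with (polar 0 th) by (unfold polar; ring).
  apply (CInt_FTC (fun t => F (polar t th))); auto.
  - intros t Ht. rewrite Cmult_comm. apply (rderiv_comp F (fun t => polar t th)); auto.
    apply rderiv_ext with (fun t => 0 + RtoC t * Cexp (Ci * RtoC th))%C. intros; rewrite polar_line; auto.
    apply rderiv_line.
  - intros t Ht. apply rcont_mult; auto using rcont_const.
    apply rcont_ext with (fun t => f (0 + RtoC t * Cexp (Ci * RtoC th))%C). intros; rewrite polar_line; auto.
    apply (rcont_comp f). apply holo_ccont; auto. apply rcont_line.
Qed.

(** Two rays at an angle less than PI: the arc joining them contributes nothing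
    in the limit, because the decay persists in the sector between them. *)
Lemma rotate_ray phi w al be : (forall z, holo phi z) -> order1 phi -> al < be -> be < al + PI ->
  good_ray phi w al -> good_ray phi w be -> ray_transform phi al w = ray_transform phi be w.
Proof.
  intros Hol Ho H1 H2 [e1 [He1 B1]] [e2 [He2 B2]].
  set (f := twist phi w) in *.
  assert (Hf : forall z, holo f z) by (intros; apply twist_holo; auto).
  set (e := Rmin e1 e2). assert (He : 0 < e) by (apply Rmin_pos; auto).
  assert (E1 : e <= e1) by apply Rmin_l. assert (E2 : e <= e2) by apply Rmin_r.
  destruct (sector_decay f al be e Hf (twist_order1 phi w Ho) H1 H2 (Rlt_le _ _ He)) as [K [HK HB]].
  { apply ray_bound_weaken with (- e1); [lra|exact B1]. } { apply ray_bound_weaken with (- e2); [lra|exact B2]. }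
  destruct (entire_primitive f Hf) as [F HF].
  apply Ceq_of_close with 3. intros eps Heps.
  destruct (HInt_correct _ (ray_decay f al e1 Hf He1 B1) eps Heps) as [T1 [P1 Q1]].
  destruct (HInt_correct _ (ray_decay f be e2 Hf He2 B2) eps Heps) as [T2 [P2 Q2]].
  destruct (exp_neg_small (K * (2 / e) * (be - al)) (e / 2) eps) as [T3 [P3 Q3]]; auto; try lra.
  { apply Rmult_le_pos; [|lra]. apply Rmult_le_pos; [lra|]. apply Rlt_le, Rdiv_lt_0_compat; lra. }
  set (T := T1 + T2 + T3). assert (HT : 0 <= T) by (unfold T; lra).
  specialize (Q1 T ltac:(unfold T; lra)). specialize (Q2 T ltac:(unfold T; lra)). specialize (Q3 T ltac:(unfold T; lra)).
  rewrite (ray_primitive f F) in Q1, Q2 by auto.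
  change (HInt (fun t => f (polar t al) * Cexp (Ci * RtoC al))%C) with (ray_transform phi al w) in Q1.
  change (HInt (fun t => f (polar t be) * Cexp (Ci * RtoC be))%C) with (ray_transform phi be w) in Q2.
  assert (Arc : Cmod (F (polar T be) - F (polar T al)) <= eps).
  { eapply Rle_trans; [|apply Q3].
    replace (K * (2 / e) * (be - al) * exp (- (e / 2) * T)) with ((K * (2 / e) * exp (- (e / 2) * T)) * (be - al)) by ring.
    apply (Cmod_increment (fun th => F (polar T th)) (fun th => (RtoC T * (Ci * Cexp (0 + RtoC th * Ci))) * f (polar T th))%C); try lra.
    - intros th Hth. apply (rderiv_comp F (fun th => polar T th)); auto.
      apply rderiv_ext with (fun th => (fun z => RtoC T * z)%C (Cexp (0 + RtoC th * Ci)))%C.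
      intros x. unfold polar. do 2 f_equal. ring.
      rewrite Cmult_comm. apply (rderiv_comp (fun z => RtoC T * z)%C).
      + assert (X := cderiv_scal T _ _ _ (cderiv_id (Cexp (0 + th * Ci)))). rewrite Cmult_1_r in X. exact X.
      + apply rderiv_Cexp_line.
    - intros th Hth. apply rcont_mult. apply rcont_mult; auto using rcont_const. apply rcont_mult; auto using rcont_const, rcont_Cexp_line.
      apply rcont_ext with (fun th => (fun z => f (RtoC T * z)%C) (Cexp (0 + RtoC th * Ci))). intros x. unfold polar. do 3 f_equal. ring.
      apply (rcont_comp (fun z => f (RtoC T * z)%C)). apply holo_ccont. apply (holo_comp f); auto with hol. apply rcont_Cexp_line.
    - intros th Hth. rewrite !Cmod_mult, Cmod_R, Cmod_Ci, Cmod_Cexp, Rabs_pos_eq by auto.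
      replace (Re (0 + th * Ci)) with 0 by (simpl; ring). rewrite exp_0, !Rmult_1_r.
      specialize (HB th Hth T HT).
      assert (Y := linear_le_exp 2 e T ltac:(lra) He).
      replace (- (e / 2) * T) with (e / 2 * T + - e * T) by field. rewrite exp_plus.
      replace (K * (2 / e) * (exp (e / 2 * T) * exp (- e * T))) with ((2 / e * exp (e / 2 * T)) * (K * exp (- e * T))) by ring.
      apply Rmult_le_compat; auto using Cmod_ge_0. }
  replace (ray_transform phi al w - ray_transform phi be w)%C with
    ((F (polar T be) - F 0 - ray_transform phi be w) - (F (polar T al) - F 0 - ray_transform phi al w) - (F (polar T be) - F (polar T al)))%C by ring.
  eapply Rle_trans; [apply Cmod_triangle_minus|].
  eapply Rle_trans; [apply Rplus_le_compat_r, Cmod_triangle_minus|]. lra.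
Qed.

Lemma twist_ray_bound phi w th a : ray_bound phi th a -> ray_bound (twist phi w) th (a + Cmod w).
Proof.
  intros [K [HK HB]]. exists K. split; auto. intros t Ht. unfold twist.
  rewrite Cmod_mult, Cmod_Cexp, Rmult_plus_distr_r, exp_plus, <- Rmult_assoc.
  apply Rmult_le_compat; auto using Cmod_ge_0. apply Rlt_le, exp_pos. apply exp_le.
  eapply Rle_trans; [apply Rle_abs|]. eapply Rle_trans; [apply re_le_Cmod|].
  rewrite Cmod_mult, Cmod_opp, Cmod_polar, Rabs_pos_eq by auto. lra.
Qed.

(** The function also decays on the ray ga between them (opposite_decay), which
    reduces the rotation by PI to two smaller ones. *)
Lemma rotate_ray_opposite phi w al ga A : (forall z, holo phi z) -> order1 phi -> al < ga < al + PI ->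
  ray_bound phi ga A ->
  good_ray phi w al -> good_ray phi w (al + PI) -> ray_transform phi al w = ray_transform phi (al + PI) w.
Proof.
  intros Hol Ho Hga HA G1 G2.
  assert (Gg : good_ray phi w ga).
  { destruct G1 as [e1 [He1 B1]], G2 as [e2 [He2 B2]].
    set (e := Rmin e1 e2). assert (He : 0 < e) by (apply Rmin_pos; auto).
    assert (E1 : e <= e1) by apply Rmin_l. assert (E2 : e <= e2) by apply Rmin_r.
    apply (opposite_decay (twist phi w) al ga e (A + Cmod w)); [|exact (twist_order1 phi w Ho)|exact Hga|exact He| | |].
    - intros; apply twist_holo; auto.
    - apply ray_bound_weaken with (- e1); [lra|exact B1].
    - apply ray_bound_weaken with (- e2); [lra|exact B2].
    - apply twist_ray_bound; exact HA. }
  transitivity (ray_transform phi ga w); apply rotate_ray; solve [assumption|lra].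
Qed.

Lemma Cexp_2PI (k : Z) : Cexp (Ci * RtoC (2 * PI * IZR k)) = 1.
Proof.
  unfold Cexp; simpl. replace (0 * (2 * PI * IZR k) - 1 * 0) with 0 by ring.
  replace (0 * 0 + 1 * (2 * PI * IZR k)) with (2 * (PI * IZR k)) by ring.
  rewrite exp_0, cos_2a_sin, sin_2a, sin_PI_IZR. apply Ceq; simpl; ring.
Qed.

Lemma Cexp_angle_period th (k : Z) : Cexp (Ci * RtoC (th + 2 * PI * IZR k)) = Cexp (Ci * RtoC th).
Proof. rewrite RtoC_plus. replace (Ci * (th + RtoC (2 * PI * IZR k)))%C with (Ci * th + Ci * RtoC (2 * PI * IZR k))%C by ring.
  rewrite Cexp_add, Cexp_2PI. ring. Qed.

Lemma polar_period t th (k : Z) : polar t (th + 2 * PI * IZR k) = polar t th.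
Proof. unfold polar. rewrite Cexp_angle_period. auto. Qed.

Lemma ray_bound_period f th (k : Z) a : ray_bound f th a -> ray_bound f (th + 2 * PI * IZR k) a.
Proof. intros [K [HK H]]. exists K. split; auto. intros. rewrite polar_period. auto. Qed.

Lemma good_ray_period phi w th (k : Z) : good_ray phi w th -> good_ray phi w (th + 2 * PI * IZR k).
Proof. intros [e [He H]]. exists e. split; auto. apply ray_bound_period; auto. Qed.

Lemma ray_transform_period phi w th (k : Z) : (forall z, holo phi z) -> good_ray phi w th ->
  ray_transform phi (th + 2 * PI * IZR k) w = ray_transform phi th w.
Proof.
  intros Hol [e [He H]]. unfold ray_transform. symmetry. apply HInt_ext.
  - apply ray_decay with e; auto. intros; apply twist_holo; auto.
  - intros. rewrite polar_period, Cexp_angle_period. auto.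
Qed.

Lemma angle_reduce x y : exists k : Z, x <= y + 2 * PI * IZR k < x + 2 * PI.
Proof.
  assert (Hpi := PI_RGT_0).
  destruct (base_Int_part ((y - x) / (2 * PI))) as [H1 H2].
  exists (- Int_part ((y - x) / (2 * PI)))%Z. rewrite opp_IZR.
  set (n := IZR (Int_part ((y - x) / (2 * PI)))) in *.
  assert (E : (y - x) / (2 * PI) * (2 * PI) = y - x) by (field; lra).
  set (q := (y - x) / (2 * PI)) in *. nra.
Qed.

(** Two angles are either less than PI apart or opposite. If they are opposite, one
    of the rays 0 and PI / 2, on which phi is of exponential type, lies strictly
    between them on one of the two sides. *)
Theorem ray_transform_indep phi w th1 th2 A B : (forall z, holo phi z) -> order1 phi ->
  ray_bound phi 0 A -> ray_bound phi (PI / 2) B ->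
  good_ray phi w th1 -> good_ray phi w th2 -> ray_transform phi th1 w = ray_transform phi th2 w.
Proof.
  intros Hol Ho HA HB G1 G2. assert (Hpi := PI_RGT_0).
  destruct (angle_reduce th1 th2) as [k Hk].
  rewrite <- (ray_transform_period phi w th2 k) by auto.
  apply (good_ray_period phi w th2 k) in G2.
  set (th := th2 + 2 * PI * IZR k) in *. clearbody th. clear th2 k.
  assert (P1 : ray_transform phi (th1 + 2 * PI) w = ray_transform phi th1 w).
  { rewrite <- (ray_transform_period phi w th1 1) by auto. f_equal; ring. }
  assert (G1' : good_ray phi w (th1 + 2 * PI)).
  { replace (th1 + 2 * PI) with (th1 + 2 * PI * IZR 1) by ring. apply good_ray_period; auto. }
  destruct (Req_dec th th1) as [->|N1]; [reflexivity|].
  destruct (Rlt_dec th (th1 + PI)) as [H1|H1].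
  { apply rotate_ray; auto; lra. }
  destruct (Rlt_dec (th1 + PI) th) as [H2|H2].
  { rewrite <- P1. symmetry. apply rotate_ray; auto; lra. }
  assert (th = th1 + PI) by lra. subst th.
  assert (Ga : exists ga D, th1 < ga < th1 + 2 * PI /\ ga <> th1 + PI /\ ray_bound phi ga D).
  { destruct (angle_reduce th1 0) as [j Hj].
    destruct (Req_dec (0 + 2 * PI * IZR j) th1) as [E|E]; [|destruct (Req_dec (0 + 2 * PI * IZR j) (th1 + PI)) as [E'|E']].
    - exists (PI / 2 + 2 * PI * IZR j), B. split. lra. split. lra. apply ray_bound_period; auto.
    - exists (PI / 2 + 2 * PI * IZR j), B. split. lra. split. lra. apply ray_bound_period; auto.
    - exists (0 + 2 * PI * IZR j), A. split. lra. split. lra. apply ray_bound_period; auto. }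
  destruct Ga as [ga [D [Hga [Nga Hb]]]].
  destruct (Rlt_dec ga (th1 + PI)) as [H3|H3].
  - apply rotate_ray_opposite with ga D; auto. lra.
  - rewrite <- P1. symmetry. replace (th1 + 2 * PI) with (th1 + PI + PI) by ring.
    apply rotate_ray_opposite with ga D; auto. lra.
    replace (th1 + PI + PI) with (th1 + 2 * PI) by ring. auto.
Qed.

Lemma Re_mul_conj_angle w th : Re (Cconj w * Cexp (- (Ci * RtoC th)))%C = Re (w * Cexp (Ci * RtoC th))%C.
Proof.
  destruct w as [x y]. unfold Cexp; simpl.
  replace (- (0 * th - 1 * 0)) with 0 by ring. replace (- (0 * 0 + 1 * th)) with (- th) by ring.
  replace (0 * th - 1 * 0) with 0 by ring. replace (0 * 0 + 1 * th) with th by ring.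
  rewrite cos_neg, sin_neg. ring.
Qed.

(** That w is not in the conjugate diagram means Re (w e^(i th)) > h th for some th,
    and the difference is a rate of decay. *)
Lemma good_ray_of_diagram phi w : (forall z, holo phi z) -> ~ conj_diagram phi w -> exists th, good_ray phi w th.
Proof.
  intros Hol H.
  assert (Ex : exists th, Rbar_lt (indicator phi th) (Re (w * Cexp (Ci * RtoC th))%C)).
  { apply NNPP. intros N. apply H. exists (Cconj w). split.
    - intros th. rewrite Re_mul_conj_angle. apply Rbar_not_lt_le. intros Hlt. apply N. exists th; auto.
    - destruct w; unfold Cconj; simpl. rewrite Ropp_involutive. auto. }
  destruct Ex as [th Hth]. exists th.
  destruct (Rbar_lt_between _ _ Hth) as [B [HB1 HB2]].
  destruct (ray_bound_of_indicator phi th B Hol HB1) as [K [HK Hb]].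
  set (r := Re (w * Cexp (Ci * RtoC th))%C) in *.
  exists (r - B). split. lra. exists K. split; auto. intros t Ht. unfold twist. rewrite Cmod_mult, Cmod_Cexp.
  replace (Re (- w * polar t th)) with (- (r * t)).
  - replace (- (r - B) * t) with (B * t + - (r * t)) by ring. rewrite exp_plus, <- Rmult_assoc.
    apply Rmult_le_compat_r. apply Rlt_le, exp_pos. auto.
  - unfold r, polar. destruct w as [x y]. destruct (Cexp (Ci * th)) as [p q]. simpl. ring.
Qed.

Lemma good_ray_near phi w th e : 0 < e -> ray_bound (twist phi w) th (- e) ->
  forall w', Cmod (w' - w) < e -> good_ray phi w' th.
Proof.
  intros He [K [HK HB]] w' Hw. exists (e - Cmod (w' - w)). split. lra.
  exists K. split; auto. intros t Ht.
  replace (twist phi w' (polar t th)) with (twist phi w (polar t th) * Cexp (- (w' - w) * polar t th))%C.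
  2:{ unfold twist. rewrite <- Cmult_assoc, <- Cexp_add. do 2 f_equal. ring. }
  rewrite Cmod_mult, Cmod_Cexp.
  replace (- (e - Cmod (w' - w)) * t) with (- e * t + Cmod (w' - w) * t) by ring. rewrite exp_plus, <- Rmult_assoc.
  apply Rmult_le_compat; auto using Cmod_ge_0. apply Rlt_le, exp_pos. apply exp_le.
  eapply Rle_trans; [apply Rle_abs|]. eapply Rle_trans; [apply re_le_Cmod|].
  rewrite Cmod_mult, Cmod_opp, Cmod_polar, Rabs_pos_eq by auto. lra.
Qed.

(** Any good ray will do, by laplace_ray; the half-planes of convergence of the rays
    together cover the complement of the conjugate diagram. *)
Definition laplace (phi : C -> C) (w : C) : C :=
  ray_transform phi (epsilon (inhabits 0) (good_ray phi w)) w.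

Lemma laplace_ray phi w th A B : (forall z, holo phi z) -> order1 phi ->
  ray_bound phi 0 A -> ray_bound phi (PI / 2) B -> good_ray phi w th -> laplace phi w = ray_transform phi th w.
Proof.
  intros Hol Ho HA HB G.
  exact (ray_transform_indep phi w _ th A B Hol Ho HA HB
    (epsilon_spec (inhabits 0) (good_ray phi w) (ex_intro _ th G)) G).
Qed.

Lemma holo_laplace phi w th A B : (forall z, holo phi z) -> order1 phi ->
  ray_bound phi 0 A -> ray_bound phi (PI / 2) B -> good_ray phi w th -> holo (laplace phi) w.
Proof.
  intros Hol Ho HA HB [e [He G]].
  set (u := Cexp (Ci * RtoC th)).
  set (g := fun t => (phi (polar t th) * u)%C).
  assert (E : forall w t, (twist phi w (polar t th) * u = g t * Cexp (- u * RtoC t * w))%C).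
  { intros w' t. unfold twist, g. replace (- w' * polar t th)%C with (- u * RtoC t * w')%C by (unfold polar; fold u; ring). ring. }
  assert (D : forall w', Cmod (w' - w) < e -> exp_decay (fun t => g t * Cexp (- u * RtoC t * w'))%C).
  { intros w' Hw'. destruct (good_ray_near phi w th e He G w' Hw') as [e' [He' G']].
    eapply exp_decay_ext; [intros t; apply E|]. apply ray_decay with e'; auto. intros; apply twist_holo; auto. }
  apply holo_ext_loc with (fun w => HInt (fun t => g t * Cexp (- u * RtoC t * w))%C).
  - exists e. split; [exact He|]. intros w' Hw'.
    rewrite (laplace_ray phi w' th A B Hol Ho HA HB (good_ray_near phi w th e He G w' Hw')).
    apply HInt_ext; [apply D; exact Hw'|intros; symmetry; apply E].
  - apply holo_HInt_param.
    + intros t Ht. unfold g. apply rcont_mult; auto using rcont_const.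
      apply rcont_ext with (fun t => phi (0 + RtoC t * u)%C). intros; rewrite polar_line; auto.
      apply (rcont_comp phi). apply holo_ccont; auto. apply rcont_line.
    + apply D. replace (w - w)%C with (RtoC 0) by ring. rewrite Cmod_0; auto.
Qed.

(** * An Abel-Plana representation *)

Definition plana_weight (t : R) : R := / (1 + exp (2 * PI * t)).

Definition plana_half (phi : C -> C) (s : R) (w : C) : C :=
  HInt (fun t => twist phi w ((- / 2)%R, (s * t)%R) * RtoC (plana_weight t))%C.

Definition segment_integral (phi : C -> C) (w : C) : C :=
  CInt (fun x => twist phi w (x, 0)) (- / 2) 0.

(** For F v = phi v e^(- v w), the sum of F n over n >= 0 equals, when everything
    converges, the integral of F from -1/2 to oo minus i times the integral over
    y > 0 of (F (-1/2 + i y) - F (-1/2 - i y)) / (1 + e^(2 PI y)). Here the part of the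
    first integral over (0, oo) is turned to a ray where it converges. *)
Definition plana (phi : C -> C) (w : C) : C :=
  (- Ci * (plana_half phi 1 w - plana_half phi (- (1)) w) + segment_integral phi w + laplace phi w)%C.

Lemma plana_weight_bounds t : 0 < plana_weight t <= exp (- (2 * PI) * t).
Proof.
  unfold plana_weight. assert (P : 0 < exp (2 * PI * t)) by apply exp_pos. split.
  apply Rinv_0_lt_compat; lra.
  replace (- (2 * PI) * t) with (- (2 * PI * t)) by ring. rewrite exp_Ropp. apply Rinv_le_contravar; lra.
Qed.

Lemma rcont_plana_weight t : rcont (fun t => RtoC (plana_weight t)) t.
Proof.
  apply rcont_RtoC. apply (ex_derive_continuous (K := R_AbsRing) (V := R_NormedModule)).
  unfold plana_weight. auto_derive. assert (0 < exp (2 * PI * t)) by apply exp_pos. lra.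
Qed.

Lemma twist_line_bound phi b m : strip_growth phi b -> 0 <= m ->
  exists K, 0 < K /\ forall w x s t, (s = 1 \/ s = - (1)) -> 0 <= t -> Rabs x <= m ->
   Cmod (twist phi w (x, s * t)) <= (K * exp (m * Rabs (Re w))) * exp ((b + s * Im w) * t).
Proof.
  intros HG Hm. destruct (HG m Hm) as [K [HK HB]]. exists K. split; auto.
  intros w x s t Hs Ht Hx. unfold twist. rewrite Cmod_mult, Cmod_Cexp.
  specialize (HB x (s * t) Hx). rewrite sign_abs in HB by auto.
  replace (K * exp (m * Rabs (Re w)) * exp ((b + s * Im w) * t)) with ((K * exp (b * t)) * exp (m * Rabs (Re w) + s * Im w * t)).
  - apply Rmult_le_compat; auto using Cmod_ge_0. apply Rlt_le, exp_pos. apply exp_le.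
    destruct w as [p q]; simpl.
    assert (- p * x <= Rabs p * Rabs x) by (rewrite <- Rabs_mult, <- Rabs_Ropp; eapply Rle_trans; [|apply Rle_abs]; right; ring).
    assert (Rabs p * Rabs x <= Rabs p * m) by (apply Rmult_le_compat_l; auto; apply Rabs_pos). lra.
  - rewrite (Rmult_plus_distr_r b), !exp_plus. ring.
Qed.

Lemma rcont_twist_line phi w x s t : (forall z, holo phi z) -> rcont (fun t => twist phi w (x, s * t)) t.
Proof.
  intros Hol. apply rcont_ext with (fun t => twist phi w (RtoC x + RtoC t * (RtoC s * Ci))%C).
  intros y. f_equal. cring. apply (rcont_comp (twist phi w)). apply holo_ccont, twist_holo; auto. apply rcont_line.
Qed.

Lemma Rabs_half : Rabs (- / 2) <= / 2.
Proof. rewrite Rabs_Ropp, Rabs_pos_eq; lra. Qed.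

Lemma plana_half_decay phi b w s : (forall z, holo phi z) -> strip_growth phi b -> Rabs (Im w) < 2 * PI - b ->
  (s = 1 \/ s = - (1)) -> exp_decay (fun t => twist phi w ((- / 2)%R, (s * t)%R) * RtoC (plana_weight t))%C.
Proof.
  intros Hol HG Hw Hs. destruct (twist_line_bound phi b (/ 2) HG) as [K [HK HB]]. lra.
  split.
  - intros t Ht. apply rcont_mult. apply rcont_twist_line; auto. apply rcont_plana_weight.
  - assert (0 < exp (/ 2 * Rabs (Re w))) by apply exp_pos.
    exists (K * exp (/ 2 * Rabs (Re w))), (2 * PI - b - Rabs (Im w)). split. nra. split. lra.
    intros t Ht. specialize (HB w (- / 2) s t Hs Ht Rabs_half).
    destruct (plana_weight_bounds t) as [W1 W2].
    rewrite Cmod_mult, Cmod_R, Rabs_pos_eq by lra.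
    apply Rle_trans with ((K * exp (/ 2 * Rabs (Re w))) * exp ((b + s * Im w) * t) * exp (- (2 * PI) * t)).
    apply Rmult_le_compat; auto using Cmod_ge_0. lra.
    rewrite Rmult_assoc, <- exp_plus. apply Rmult_le_compat_l. nra. apply exp_le.
    assert (s * Im w <= Rabs (Im w)).
    { destruct Hs; subst. rewrite Rmult_1_l. apply Rle_abs. replace (- (1) * Im w) with (- Im w) by ring. rewrite <- Rabs_Ropp. apply Rle_abs. }
    nra.
Qed.

Lemma twist_line_decay phi b w s : (forall z, holo phi z) -> strip_growth phi b -> s * Im w < - b ->
  (s = 1 \/ s = - (1)) -> exp_decay (fun t => twist phi w (- / 2, s * t)).
Proof.
  intros Hol HG Hw Hs. destruct (twist_line_bound phi b (/ 2) HG) as [K [HK HB]]. lra.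
  split.
  - intros t Ht. apply rcont_twist_line; auto.
  - assert (0 < exp (/ 2 * Rabs (Re w))) by apply exp_pos.
    exists (K * exp (/ 2 * Rabs (Re w))), (- (b + s * Im w)). split. nra. split. lra.
    intros t Ht. rewrite Ropp_involutive. apply HB; auto. apply Rabs_half.
Qed.

Lemma polar_imaginary s t : (s = 1 \/ s = - (1)) -> polar t (s * (PI / 2)) = (0, s * t).
Proof.
  intros Hs. rewrite polar_coord. destruct Hs; subst. rewrite !Rmult_1_l, cos_PI2, sin_PI2. f_equal; ring.
  replace (- (1) * (PI / 2)) with (- (PI / 2)) by ring. rewrite cos_neg, sin_neg, cos_PI2, sin_PI2. f_equal; ring.
Qed.

Lemma good_imaginary_ray phi b w s : strip_growth phi b -> s * Im w < - b -> (s = 1 \/ s = - (1)) ->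
  good_ray phi w (s * (PI / 2)).
Proof.
  intros HG Hw Hs. destruct (twist_line_bound phi b 0 HG) as [K [HK HB]]. lra.
  exists (- (b + s * Im w)). split. lra. exists K. split; auto. intros t Ht. rewrite polar_imaginary by auto.
  rewrite Ropp_involutive. specialize (HB w 0 s t Hs Ht). rewrite Rmult_0_l, exp_0, Rmult_1_r, Rabs_R0 in HB. apply HB. lra.
Qed.

(** Moving the half-line from Re v = -1/2 to the imaginary axis. *)
Lemma shifted_ray phi b w s : (forall z, holo phi z) -> strip_growth phi b -> s * Im w < - b ->
  (s = 1 \/ s = - (1)) ->
  (RtoC s * Ci * HInt (fun t => twist phi w (- / 2, s * t)%R) = segment_integral phi w + ray_transform phi (s * (PI / 2)) w)%C.
Proof.
  intros Hol HG Hw Hs. set (f := twist phi w).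
  assert (Hf : forall z, holo f z) by (intros; apply twist_holo; auto).
  destruct (entire_primitive f Hf) as [F HF].
  assert (Sg : segment_integral phi w = (F 0 - F ((- / 2)%R, 0%R))%C).
  { unfold segment_integral. apply (CInt_hor_primitive F f). lra. intros; auto.
    intros t Ht. apply rcont_hor, holo_ccont; auto. }
  destruct (good_imaginary_ray phi b w s HG Hw Hs) as [e1 [He1 G]].
  apply Ceq_of_close with 3. intros eps Heps.
  destruct (HInt_correct _ (twist_line_decay phi b w s Hol HG Hw Hs) eps Heps) as [T1 [P1 Q1]].
  destruct (HInt_correct _ (ray_decay f (s * (PI / 2)) e1 Hf He1 G) eps Heps) as [T2 [P2 Q2]].
  destruct (twist_line_bound phi b (/ 2) HG) as [K [HK HB]]. lra. specialize (HB w).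
  set (K' := K * exp (/ 2 * Rabs (Re w))) in *.
  assert (HK' : 0 < K') by (apply Rmult_lt_0_compat; auto; apply exp_pos).
  destruct (exp_neg_small K' (- (b + s * Im w)) eps) as [T3 [P3 Q3]]; auto; try lra.
  set (T := T1 + T2 + T3). assert (HT : 0 <= T) by (unfold T; lra).
  specialize (Q1 T ltac:(unfold T; lra)). specialize (Q2 T ltac:(unfold T; lra)). specialize (Q3 T ltac:(unfold T; lra)).
  rewrite (ray_primitive f F) in Q2 by auto. rewrite polar_imaginary in Q2 by auto.
  change (HInt (fun t => f (polar t (s * (PI / 2))) * Cexp (Ci * RtoC (s * (PI / 2))))%C) with (ray_transform phi (s * (PI / 2)) w) in Q2.
  assert (E1 : (RtoC s * Ci * CInt (fun t => f (- / 2, s * t)%R) 0 T = F ((- / 2)%R, (s * T)%R) - F ((- / 2)%R, 0%R))%C).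
  { rewrite <- CInt_cmul; auto. 2: intros t Ht; apply rcont_twist_line; auto.
    assert (Ext : forall x, (RtoC (- / 2) + RtoC x * (RtoC s * Ci) = ((- / 2)%R, (s * x)%R))%C) by (intros; cring).
    replace (F ((- / 2)%R, (s * T)%R) - F ((- / 2)%R, 0%R))%C with (F (RtoC (- / 2) + RtoC T * (RtoC s * Ci)) - F (RtoC (- / 2) + RtoC 0 * (RtoC s * Ci)))%C.
    2: rewrite !Ext, Rmult_0_r; auto.
    apply (CInt_FTC (fun t => F (RtoC (- / 2) + RtoC t * (RtoC s * Ci))%C)); auto.
    - intros t Ht. rewrite <- Ext. apply (rderiv_comp F (fun t => RtoC (- / 2) + RtoC t * (RtoC s * Ci))%C); auto. apply rderiv_line.
    - apply cont_seg_cmul. intros t Ht; apply rcont_twist_line; auto. }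
  assert (H : Cmod (CInt (fun x => f (x, s * T)) (- / 2) 0) <= eps).
  { eapply Rle_trans; [apply CInt_bound_const with (M := eps)|]; try lra.
    - intros t Ht. apply rcont_hor, holo_ccont; auto.
    - intros t Ht. eapply Rle_trans; [apply HB; auto; apply Rabs_le; lra|].
      rewrite Ropp_involutive in Q3. auto. }
  rewrite (CInt_hor_primitive F f) in H; try lra; auto.
  2: intros t Ht; apply rcont_hor, holo_ccont; auto.
  rewrite Sg.
  set (L := HInt (fun t => f (- / 2, s * t)%R)) in *.
  change (HInt (fun t => twist phi w (- / 2, s * t)%R)) with L in *.
  change (CInt (fun t => twist phi w (- / 2, s * t)%R) 0 T) with (CInt (fun t => f (- / 2, s * t)%R) 0 T) in Q1.
  set (I0 := CInt (fun t => f (- / 2, s * t)%R) 0 T) in *. set (R0 := ray_transform phi (s * (PI / 2)) w) in *.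
  replace (RtoC s * Ci * L - (F 0 - F ((- / 2)%R, 0%R) + R0))%C with
    ((F (0%R, (s * T)%R) - F 0 - R0) - (F (0%R, (s * T)%R) - F ((- / 2)%R, (s * T)%R)) - RtoC s * Ci * (I0 - L))%C.
  2:{ replace (RtoC s * Ci * (I0 - L))%C with (RtoC s * Ci * I0 - RtoC s * Ci * L)%C by ring. rewrite E1. ring. }
  eapply Rle_trans; [apply Cmod_triangle_minus|].
  eapply Rle_trans; [apply Rplus_le_compat_r, Cmod_triangle_minus|].
  rewrite (Cmod_mult _ (I0 - L)), Cmod_mult, Cmod_Ci, Cmod_R.
  replace (Rabs s) with 1. lra. destruct Hs; subst. rewrite Rabs_R1; auto. rewrite Rabs_Ropp, Rabs_R1; auto.
Qed.

(** At zeta = - s PI i - w the quotient e^(v zeta) / sin (PI v) on Re v = -1/2 is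
    a constant times e^(- v w) times a logistic function of s y. *)
Lemma kern_twist phi w s y : (s = 1 \/ s = - (1)) ->
  kern phi (- (RtoC (s * PI) * Ci) - w) (- / 2, y) =
   (- (2) * (RtoC s * Ci) * (twist phi w ((- / 2)%R, y) * RtoC (exp (s * (PI * y)) / (exp (PI * y) + exp (- (PI * y))))))%C.
Proof.
  intros Hs. unfold kern, twist.
  replace (((- / 2)%R, y) * (- (RtoC (s * PI) * Ci) - w))%C with (- w * ((- / 2)%R, y) + ((s * (PI * y))%R, (s * (PI / 2))%R))%C.
  2:{ destruct w. apply Ceq; simpl; field. }
  rewrite Cexp_add.
  replace (PI * ((- / 2)%R, y))%C with ((- (PI / 2), PI * y) : C) by (apply Ceq; simpl; field).
  rewrite Csin_coord, sin_neg, cos_neg, sin_PI2, cos_PI2.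
  assert (E1 : Cexp (s * (PI * y), s * (PI / 2)) = (RtoC (exp (s * (PI * y))) * (RtoC s * Ci))%C).
  { unfold Cexp; simpl. destruct Hs; subst. rewrite !Rmult_1_l, cos_PI2, sin_PI2. cring.
    replace (- (1) * (PI / 2)) with (- (PI / 2)) by ring. rewrite cos_neg, sin_neg, cos_PI2, sin_PI2. cring. }
  rewrite E1.
  set (D := exp (PI * y) + exp (- (PI * y))).
  assert (HD : 0 < D) by (assert (0 < exp (PI * y)) by apply exp_pos; assert (0 < exp (- (PI * y))) by apply exp_pos; unfold D; lra).
  assert (ND : RtoC D <> 0) by (apply RtoC_neq_0; lra).
  replace ((- (1) * (D / 2), 0 * ((exp (PI * y) - exp (- (PI * y))) / 2)) : C) with (- (RtoC D / 2))%C.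
  2:{ rewrite Rmult_0_l. replace (RtoC D / 2)%C with (RtoC (D / 2)) by (rewrite RtoC_div; auto). cring. }
  rewrite RtoC_div. field; auto. lra.
Qed.

Lemma plana_weight_lower t : exp (- (PI * t)) / (exp (PI * t) + exp (- (PI * t))) = plana_weight t.
Proof.
  unfold plana_weight. replace (2 * PI * t) with (PI * t + PI * t) by ring. rewrite exp_plus, exp_Ropp.
  assert (0 < exp (PI * t)) by apply exp_pos. field. split; nra.
Qed.

Lemma plana_weight_upper t : exp (PI * t) / (exp (PI * t) + exp (- (PI * t))) = 1 - plana_weight t.
Proof.
  rewrite <- plana_weight_lower. assert (0 < exp (PI * t)) by apply exp_pos. assert (0 < exp (- (PI * t))) by apply exp_pos.
  field. lra.
Qed.

(** On the two strips b < |Im w| < 2 PI - b the weight e^(- s i PI v) / sin (PI v)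
    of the Mellin-Barnes integral splits as the Plana weight plus a pure half-line. *)
Theorem Mell_plana phi b w s A : (forall z, holo phi z) -> order1 phi -> strip_growth phi b ->
  ray_bound phi 0 A -> ray_bound phi (PI / 2) b ->
  (s = 1 \/ s = - (1)) -> - (2 * PI - b) < s * Im w < - b ->
  (- (/ 2 * Mell phi (- / 2) (- (RtoC (s * PI) * Ci) - w)) = plana phi w)%C.
Proof.
  intros Hol Ho HG HA HB Hs Hw.
  set (zeta := (- (RtoC (s * PI) * Ci) - w)%C).
  assert (Hw' : Rabs (Im w) < 2 * PI - b /\ Rabs (Im zeta) < PI - b).
  { replace (Im zeta) with (- (s * PI) - Im w) by (unfold zeta; destruct w; simpl; ring).
    assert (Hpi := PI_RGT_0).
    destruct Hs; subst s; split; apply Rabs_lt_between; lra. }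
  destruct Hw' as [W1 W2].
  assert (X1 := plana_half_decay phi b w s Hol HG W1 Hs).
  assert (Hs' : - s = 1 \/ - s = - (1)) by (destruct Hs; subst; [right|left]; ring).
  assert (X2 := plana_half_decay phi b w (- s) Hol HG W1 Hs').
  assert (X3 := twist_line_decay phi b w s Hol HG (proj2 Hw) Hs).
  assert (V : Mell phi (- / 2) zeta = (HInt (fun t => kern phi zeta (- / 2, s * t)%R) + HInt (fun t => kern phi zeta (- / 2, (- s) * t)%R))%C).
  { destruct Hs; subst s. reflexivity. rewrite Ropp_involutive, Cplus_comm. reflexivity. }
  assert (Y1 : HInt (fun t => kern phi zeta (- / 2, s * t)%R) =
    (- (2) * (RtoC s * Ci) * (HInt (fun t => twist phi w (- / 2, s * t)%R) - plana_half phi s w))%C).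
  { assert (X4 := exp_decay_minus _ _ X3 X1).
    unfold plana_half. rewrite <- (HInt_minus _ _ X3 X1), <- (HInt_cmul _ _ X4).
    symmetry. apply HInt_ext.
      - apply exp_decay_cmul, X4.
      - intros t Ht. unfold zeta. rewrite kern_twist by auto. f_equal.
        replace (exp (s * (PI * (s * t))) / (exp (PI * (s * t)) + exp (- (PI * (s * t))))) with (1 - plana_weight t).
        rewrite RtoC_minus. ring.
        rewrite <- plana_weight_upper. destruct Hs; subst s. rewrite !Rmult_1_l; auto.
        replace (- (1) * (PI * (- (1) * t))) with (PI * t) by ring. replace (PI * (- (1) * t)) with (- (PI * t)) by ring.
        rewrite Ropp_involutive. rewrite (Rplus_comm (exp (- (PI * t)))). reflexivity. }
  assert (Y2 : HInt (fun t => kern phi zeta (- / 2, (- s) * t)%R) = (- (2) * (RtoC s * Ci) * plana_half phi (- s) w)%C).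
  { unfold plana_half. rewrite <- (HInt_cmul _ _ X2). symmetry. apply HInt_ext. apply exp_decay_cmul, X2.
    intros t Ht. unfold zeta. rewrite kern_twist by auto. do 3 f_equal.
    rewrite <- plana_weight_lower. destruct Hs; subst s.
    replace (1 * (PI * (- (1) * t))) with (- (PI * t)) by ring. replace (PI * (- (1) * t)) with (- (PI * t)) by ring.
    rewrite Ropp_involutive, (Rplus_comm (exp (- (PI * t)))). reflexivity.
    replace (- (1) * (PI * (- - (1) * t))) with (- (PI * t)) by ring. replace (PI * (- - (1) * t)) with (PI * t) by ring. auto. }
  rewrite V, Y1, Y2. unfold plana.
  rewrite (laplace_ray phi w (s * (PI / 2)) A b Hol Ho HA HB (good_imaginary_ray phi b w s HG (proj2 Hw) Hs)).
  assert (Sh := shifted_ray phi b w s Hol HG (proj2 Hw) Hs).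
  transitivity (RtoC s * Ci * HInt (fun t => twist phi w (- / 2, s * t)%R) - RtoC s * Ci * (plana_half phi s w - plana_half phi (- s) w))%C.
  { field. }
  rewrite Sh. destruct Hs; subst s. ring. rewrite Ropp_involutive, RtoC_opp. ring.
Qed.

Lemma holo_plana_half phi b w s : (forall z, holo phi z) -> strip_growth phi b -> Rabs (Im w) < 2 * PI - b ->
  (s = 1 \/ s = - (1)) -> holo (plana_half phi s) w.
Proof.
  intros Hol HG Hw Hs.
  set (g := fun t => (phi ((- / 2)%R, (s * t)%R) * RtoC (plana_weight t))%C).
  assert (E : forall w t, (twist phi w ((- / 2)%R, (s * t)%R) * RtoC (plana_weight t) = Cexp (/ 2 * w) * (g t * Cexp (- (RtoC s * Ci) * RtoC t * w)))%C).
  { intros w' t. unfold twist, g. replace (- w' * ((- / 2)%R, (s * t)%R))%C with (/ 2 * w' + - (RtoC s * Ci) * RtoC t * w')%C.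
    rewrite Cexp_add. ring. replace (/ 2)%C with (RtoC (/ 2)) by (rewrite RtoC_inv; auto). destruct w'. cring. }
  assert (D : forall w', Rabs (Im w') < 2 * PI - b -> exp_decay (fun t => g t * Cexp (- (RtoC s * Ci) * RtoC t * w'))%C).
  { intros w' Hw'. apply exp_decay_ext with (fun t => Cexp (- (/ 2 * w')) * (twist phi w' ((- / 2)%R, (s * t)%R) * RtoC (plana_weight t)))%C.
    intros t. rewrite E. apply Cexp_cancel. apply exp_decay_cmul. apply plana_half_decay with b; auto. }
  apply holo_ext_loc with (fun w => Cexp (/ 2 * w) * HInt (fun t => g t * Cexp (- (RtoC s * Ci) * RtoC t * w)))%C.
  - exists (2 * PI - b - Rabs (Im w)). split. lra. intros z Hzz. apply Im_near in Hzz.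
    rewrite <- HInt_cmul by auto. apply HInt_ext. apply exp_decay_cmul; auto. intros t _. symmetry; apply E.
  - apply holo_mult. auto with hol. apply (holo_HInt_param g (- (RtoC s * Ci))).
    + intros t Ht. unfold g. apply rcont_mult; [|apply rcont_plana_weight].
      apply rcont_ext with (fun t => phi (RtoC (- / 2) + RtoC t * (RtoC s * Ci))%C). intros x. f_equal. cring.
      apply (rcont_comp phi). apply holo_ccont; auto. apply rcont_line.
    + apply D; auto.
Qed.

Lemma holo_segment_integral phi w : (forall z, holo phi z) -> holo (segment_integral phi) w.
Proof.
  intros Hol.
  assert (Cc : forall w, cont_seg (fun x => twist phi w (x, 0)) (- / 2) 0).
  { intros w' t Ht. apply rcont_hor, holo_ccont, twist_holo; auto. }
  destruct (cont_seg_bounded _ _ _ (Cc w)) as [M [HM BM]].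
  set (D := fun x => (- RtoC x * twist phi w (x, 0%R))%C).
  assert (CD : cont_seg D (- / 2) 0).
  { intros t Ht. unfold D. apply rcont_mult. apply rcont_ext with (fun x => 0 + RtoC x * (- (1)))%C. intros; ring. apply rcont_line. apply Cc; auto. }
  exists (CInt D (- / 2) 0). apply cderiv_quadratic with 1 (M * exp 1). lra.
  apply Rmult_le_pos. lra. apply Rlt_le, exp_pos.
  intros h Hh. unfold segment_integral.
  rewrite <- CInt_minus, <- CInt_cmul, <- CInt_minus; auto; try lra.
  2:{ intros t Ht. apply rcont_ext with (fun x => twist phi (w + h)%C (x, 0%R) + (- (1)) * twist phi w (x, 0%R))%C. intros; ring.
      apply rcont_plus. apply Cc; auto. apply rcont_mult; auto using rcont_const. apply Cc; auto. }
  2: apply cont_seg_cmul; auto.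
  eapply Rle_trans; [apply CInt_bound_const with (M := M * exp 1 * (Cmod h * Cmod h)); try lra|].
  - intros t Ht. apply rcont_ext with (fun x => twist phi (w + h)%C (x, 0%R) + (- (1)) * twist phi w (x, 0%R) + (- h) * D x)%C. intros; ring.
    apply rcont_plus. apply rcont_plus. apply Cc; auto. apply rcont_mult; auto using rcont_const. apply Cc; auto.
    apply rcont_mult; auto using rcont_const.
  - intros t Ht.
    replace (twist phi (w + h)%C (t, 0%R) - twist phi w (t, 0%R) - h * D t)%C with
      (twist phi w (t, 0%R) * (Cexp (- h * (t, 0%R)) - 1 - (- h * (t, 0%R))))%C.
    2:{ unfold D, twist. replace (- (w + h) * (t, 0%R))%C with (- w * (t, 0%R) + - h * (t, 0%R))%C by ring. rewrite Cexp_add.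
        change ((t, 0) : C) with (RtoC t). ring. }
    rewrite Cmod_mult, Rmult_assoc. apply Rmult_le_compat; auto using Cmod_ge_0.
    eapply Rle_trans; [apply Cexp_taylor1|].
    assert (B : Cmod (- h * (t, 0%R)) <= Cmod h).
    { change ((t, 0) : C) with (RtoC t). rewrite Cmod_mult, Cmod_opp, Cmod_R.
      assert (Rabs t <= 1) by (apply Rabs_le; lra). assert (0 <= Cmod h) by apply Cmod_ge_0. nra. }
    assert (P := Cmod_ge_0 (- h * (t, 0%R))). rewrite (Rmult_comm (exp 1)).
    apply Rmult_le_compat. apply Rmult_le_pos; auto. apply Rlt_le, exp_pos. apply Rmult_le_compat; auto. apply exp_le; lra.
  - assert (0 <= M * exp 1 * (Cmod h * Cmod h)).
    { repeat apply Rmult_le_pos; try apply Cmod_ge_0. lra. apply Rlt_le, exp_pos. }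
    lra.
Qed.

Lemma holo_plana phi b w th A : (forall z, holo phi z) -> order1 phi -> strip_growth phi b ->
  ray_bound phi 0 A -> ray_bound phi (PI / 2) b -> Rabs (Im w) < 2 * PI - b -> good_ray phi w th -> holo (plana phi) w.
Proof.
  intros. unfold plana. apply holo_plus. apply holo_plus. apply holo_mult. apply holo_const.
  apply holo_minus; apply holo_plana_half with b; auto. apply holo_segment_integral; auto.
  apply holo_laplace with th A b; auto.
Qed.

(** * Power series near the origin *)

Definition csum (c : nat -> C) (n : nat) : C := sum_n (G := C_AbelianGroup) c n.

Lemma csum_S c n : csum c (S n) = (csum c n + c (S n))%C.
Proof. unfold csum. rewrite sum_Sn. reflexivity. Qed.

Lemma csum_0 c : csum c 0 = c O.
Proof. unfold csum. rewrite sum_O. reflexivity. Qed.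

Lemma csum_diff c M n m : (forall k, Cmod (c k) <= M * (/ 2) ^ k) ->
  Cmod (csum c (n + m) - csum c n) <= M * (/ 2) ^ n - M * (/ 2) ^ (n + m).
Proof.
  intros H. induction m.
  - rewrite Nat.add_0_r. replace (csum c n - csum c n)%C with (RtoC 0) by ring. rewrite Cmod_0. lra.
  - rewrite Nat.add_succ_r, csum_S.
    replace (csum c (n + m) + c (S (n + m)) - csum c n)%C with ((csum c (n + m) - csum c n) + c (S (n + m)))%C by ring.
    eapply Rle_trans; [apply Cmod_triangle|]. specialize (H (S (n + m))). simpl pow in *. lra.
Qed.

Lemma half_pow_small M eps : 0 <= M -> 0 < eps -> exists N, forall n, (N <= n)%nat -> M * (/ 2) ^ n < eps.
Proof.
  intros HM He. destruct (small_mult M eps HM He) as [d [Hd H]].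
  destruct (pow_lt_1_zero (/ 2)) with d as [N HN]; auto. rewrite Rabs_pos_eq; lra.
  exists N. intros n Hn. specialize (HN n Hn). assert (0 <= (/ 2) ^ n) by (apply pow_le; lra).
  rewrite Rabs_pos_eq in HN by auto. auto.
Qed.

Lemma csum_lim c M : 0 <= M -> (forall k, Cmod (c k) <= M * (/ 2) ^ k) ->
  exists l, forall n, Cmod (csum c n - l) <= M * (/ 2) ^ n.
Proof.
  intros HM H.
  assert (HD : forall n m, (n <= m)%nat -> Cmod (csum c m - csum c n) <= M * (/ 2) ^ n).
  { intros n m Hnm. replace m with (n + (m - n))%nat by lia.
    eapply Rle_trans; [apply (csum_diff c M); auto|].
    assert (0 <= M * (/ 2) ^ (n + (m - n))) by (apply Rmult_le_pos; auto; apply pow_le; lra). lra. }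
  destruct (proj1 (filterlim_locally_cauchy (U := C_R_CompleteNormedModule) (F := eventually) (csum c))) as [l Hl].
  { intros [eps Heps]. destruct (half_pow_small M (eps / 2)) as [N HN]; auto. lra.
    exists (fun n => (N <= n)%nat). split. exists N. auto.
    intros u v Hu Hv. specialize (HN N (le_n N)).
    assert (D1 := HD N u Hu). assert (D2 := HD N v Hv).
    apply (norm_compat1 (V := C_R_NormedModule)). rewrite <- Cmod_norm.
    change (Cmod (csum c v - csum c u) < eps).
    replace (csum c v - csum c u)%C with ((csum c v - csum c N) - (csum c u - csum c N))%C by ring.
    eapply Rle_lt_trans; [apply Cmod_triangle_minus|]. lra. }
  exists l. intros n. apply le_epsilon. intros eps Heps.
  assert (H1 := proj1 (filterlim_locally_ball_norm (U := C_R_NormedModule) (F := eventually) _ _) Hl (mkposreal eps Heps)).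
  destruct H1 as [N HN]. specialize (HN (N + n)%nat ltac:(lia)). unfold ball_norm in HN. rewrite <- Cmod_norm in HN.
  change (Cmod (csum c (N + n) - l) < eps) in HN.
  assert (D := HD n (N + n)%nat ltac:(lia)).
  replace (csum c n - l)%C with ((csum c (N + n) - l) - (csum c (N + n) - csum c n))%C by ring.
  eapply Rle_trans; [apply Cmod_triangle_minus|]. lra.
Qed.

Lemma csum_bound c M n : 0 <= M -> (forall k, Cmod (c k) <= M * (/ 2) ^ k) -> Cmod (csum c n) <= 2 * M.
Proof.
  intros HM H. assert (D := csum_diff c M 0 n H). simpl in D.
  replace (csum c n) with ((csum c n - csum c 0) + csum c 0)%C by ring.
  eapply Rle_trans; [apply Cmod_triangle|]. rewrite csum_0 in *. specialize (H O). simpl in H.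
  assert (0 <= M * (/ 2) ^ n) by (apply Rmult_le_pos; auto; apply pow_le; lra). lra.
Qed.

(** The sum of the power series where it converges. *)
Definition pser (a : nat -> C) (z : C) : C :=
  epsilon (inhabits (RtoC 0)) (fun l => forall eps, 0 < eps -> exists N, forall n, (N <= n)%nat -> Cmod (csum (fun k => a k * z ^ k)%C n - l) < eps).

Lemma pow_remainder z h rho k : 0 <= rho -> Cmod z <= rho -> Cmod (z + h) <= rho ->
  rho * rho * Cmod ((z + h) ^ k - z ^ k - h * (RtoC (INR k) * z ^ pred k)) <= INR k * INR k * rho ^ k * (Cmod h * Cmod h).
Proof.
  intros Hr Hz Hzh.
  assert (P : 0 <= Cmod h * Cmod h) by (assert (0 <= Cmod h) by apply Cmod_ge_0; nra).
  induction k.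
  - simpl. replace (1 - 1 - h * (0 * 1))%C with (RtoC 0) by ring. rewrite Cmod_0. lra.
  - assert (HI := pos_INR k).
    assert (Hpk : rho * Cmod (RtoC (INR k) * z ^ pred k) <= INR k * rho ^ k).
    { rewrite Cmod_mult, Cmod_R, Rabs_pos_eq, Cmod_pow by auto. destruct k. simpl; lra.
      simpl pred. assert (Cmod z ^ k <= rho ^ k) by (apply pow_incr; split; auto using Cmod_ge_0).
      change (rho ^ S k) with (rho * rho ^ k).
      replace (INR (S k) * (rho * rho ^ k)) with (rho * (INR (S k) * rho ^ k)) by ring.
      apply Rmult_le_compat_l; auto. apply Rmult_le_compat_l; auto. }
    assert (E : ((z + h) ^ S k - z ^ S k - h * (RtoC (INR (S k)) * z ^ pred (S k)) =
      (z + h) * ((z + h) ^ k - z ^ k - h * (RtoC (INR k) * z ^ pred k)) + h * h * (RtoC (INR k) * z ^ pred k))%C).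
    { rewrite S_INR, RtoC_plus. destruct k; [simpl; ring|]. simpl pred. rewrite !Cpow_S. ring. }
    rewrite E. set (X := ((z + h) ^ k - z ^ k - h * (RtoC (INR k) * z ^ pred k))%C) in *.
    set (Y := (RtoC (INR k) * z ^ pred k)%C) in *.
    apply Rle_trans with (rho * rho * (rho * Cmod X + Cmod h * Cmod h * Cmod Y)).
    + apply Rmult_le_compat_l. nra. eapply Rle_trans; [apply Cmod_triangle|]. rewrite !Cmod_mult.
      apply Rplus_le_compat_r. apply Rmult_le_compat_r; auto using Cmod_ge_0.
    + rewrite S_INR. change (rho ^ S k) with (rho * rho ^ k).
      assert (Z1 : rho * (rho * rho * Cmod X) <= rho * (INR k * INR k * rho ^ k * (Cmod h * Cmod h))) by (apply Rmult_le_compat_l; auto).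
      assert (Z2 : rho * (Cmod h * Cmod h) * (rho * Cmod Y) <= rho * (Cmod h * Cmod h) * (INR k * rho ^ k)).
      { apply Rmult_le_compat_l; auto. apply Rmult_le_pos; auto. }
      assert (Z3 : 0 <= rho * rho ^ k * (Cmod h * Cmod h)) by (apply Rmult_le_pos; auto; apply Rmult_le_pos; auto; apply pow_le; auto).
      nra.
Qed.

Lemma INR_le_2pow k : INR k <= 2 ^ k.
Proof. induction k. simpl; lra. rewrite S_INR. simpl. assert (1 <= 2 ^ k) by (apply pow_R1_Rle; lra). lra. Qed.

(** k <= 2^k, so a ratio 1/16 keeps the series geometric of ratio 1/2 after two
    differentiations. *)
Lemma pow_gain k A rho : 0 <= A * rho <= / 16 -> INR k * INR k * (A * rho) ^ k <= (/ 2) ^ k /\ INR k * (A * rho) ^ k <= (/ 2) ^ k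
  /\ (A * rho) ^ k <= (/ 2) ^ k.
Proof.
  intros H. assert (H1 : 0 <= (A * rho) ^ k <= (/ 16) ^ k) by (split; [apply pow_le|apply pow_incr]; lra).
  assert (H2 := INR_le_2pow k). assert (H3 := pos_INR k).
  assert (H4 : 1 <= 2 ^ k) by (apply pow_R1_Rle; lra).
  assert (E : (/ 2) ^ k = 2 ^ k * 2 ^ k * 2 ^ k * (/ 16) ^ k).
  { rewrite <- !Rpow_mult_distr. f_equal. field. }
  assert (P : 0 < (/ 16) ^ k) by (apply pow_lt; lra).
  rewrite E. set (p := 2 ^ k) in *.
  assert (INR k * INR k <= p * p) by nra. assert (0 <= INR k * INR k) by nra. assert (p * p <= p * p * p) by nra.
  assert (INR k <= p * p * p) by nra. assert (1 <= p * p * p) by nra.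
  repeat split; [apply Rmult_le_compat; lra|apply Rmult_le_compat; lra|].
  apply Rle_trans with (1 * (/ 16) ^ k). lra. apply Rmult_le_compat_r; lra.
Qed.

Lemma pser_lim a K A rho z : 0 <= K -> 0 < A -> 0 < rho -> A * rho <= / 16 -> (forall k, Cmod (a k) <= K * A ^ k) -> Cmod z <= rho ->
  forall n, Cmod (csum (fun k => a k * z ^ k)%C n - pser a z) <= K * (/ 2) ^ n.
Proof.
  intros HK HA Hr HAr Ha Hz.
  destruct (csum_lim (fun k => a k * z ^ k)%C K) as [l Hl]; auto.
  { intros k. rewrite Cmod_mult, Cmod_pow. apply Rle_trans with (K * A ^ k * rho ^ k).
    apply Rmult_le_compat; auto using Cmod_ge_0. apply pow_le, Cmod_ge_0. apply pow_incr; split; auto using Cmod_ge_0.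
    rewrite Rmult_assoc, <- Rpow_mult_distr. apply Rmult_le_compat_l; auto. apply pow_gain. split; auto. apply Rlt_le, Rmult_lt_0_compat; auto. }
  replace (pser a z) with l; auto.
  assert (S : forall eps, 0 < eps -> exists N, forall n, (N <= n)%nat -> Cmod (csum (fun k => a k * z ^ k)%C n - pser a z) < eps).
  { apply (epsilon_spec (inhabits (RtoC 0)) (fun l => forall eps, 0 < eps -> exists N, forall n, (N <= n)%nat -> Cmod (csum (fun k => a k * z ^ k)%C n - l) < eps)).
    exists l. intros eps Heps. destruct (half_pow_small K eps HK Heps) as [N HN]. exists N. intros n Hn.
    exact (Rle_lt_trans _ _ _ (Hl n) (HN n Hn)). }
  apply Ceq_of_close with 2. intros eps Heps.
  destruct (S eps Heps) as [N1 H1]. destruct (half_pow_small K eps HK Heps) as [N2 H2].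
  specialize (H1 (N1 + N2)%nat ltac:(lia)). specialize (H2 (N1 + N2)%nat ltac:(lia)). specialize (Hl (N1 + N2)%nat).
  set (c := csum (fun k => a k * z ^ k)%C (N1 + N2)) in *.
  replace (l - pser a z)%C with ((c - pser a z) - (c - l))%C by ring.
  eapply Rle_trans; [apply Cmod_triangle_minus|]. lra.
Qed.

Lemma csum_taylor a z h n : (csum (fun k => a k * (z + h) ^ k) n - csum (fun k => a k * z ^ k) n - h * csum (fun k => a k * (RtoC (INR k) * z ^ pred k)) n =
   csum (fun k => a k * ((z + h) ^ k - z ^ k - h * (RtoC (INR k) * z ^ pred k))) n)%C.
Proof.
  induction n. rewrite !csum_0. ring. rewrite !csum_S, <- IHn. ring.
Qed.

(** The partial sums satisfy a second-order Taylor estimate with a constant that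
    does not depend on their length. *)
Lemma holo_pser a K A rho z : 0 <= K -> 0 < A -> 0 < rho -> A * rho <= / 16 -> (forall k, Cmod (a k) <= K * A ^ k) -> Cmod z < rho ->
  holo (pser a) z.
Proof.
  intros HK HA Hr HAr Ha Hz.
  assert (HAr' : 0 <= A * rho <= / 16) by (split; auto; apply Rlt_le, Rmult_lt_0_compat; auto).
  destruct (csum_lim (fun k => a k * (RtoC (INR k) * z ^ pred k))%C (K / rho)) as [L HL].
  { apply Rdiv_le_0_compat; auto. }
  { intros k. rewrite !Cmod_mult, Cmod_pow, Cmod_R, Rabs_pos_eq by apply pos_INR.
    assert (Hp : INR k * Cmod z ^ pred k * rho <= INR k * rho ^ k).
    { destruct k. simpl; lra. simpl pred. assert (Cmod z ^ k <= rho ^ k) by (apply pow_incr; split; auto using Cmod_ge_0; lra).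
      change (rho ^ S k) with (rho * rho ^ k). assert (Q := pos_INR (S k)). rewrite Rmult_assoc. apply Rmult_le_compat_l; auto. nra. }
    assert (G := proj1 (proj2 (pow_gain k A rho HAr'))). rewrite Rpow_mult_distr in G.
    apply Rmult_le_reg_r with rho; auto.
    replace (K / rho * (/ 2) ^ k * rho) with (K * (/ 2) ^ k) by (field; lra).
    apply Rle_trans with (K * A ^ k * (INR k * rho ^ k)).
    - rewrite Rmult_assoc. apply Rmult_le_compat; auto using Cmod_ge_0. repeat apply Rmult_le_pos; try apply pos_INR; try lra. apply pow_le, Cmod_ge_0.
    - rewrite Rmult_assoc. apply Rmult_le_compat_l; auto. lra. }
  exists L. apply cderiv_quadratic with (rho - Cmod z) (2 * (K / (rho * rho))). lra.
  { apply Rmult_le_pos. lra. apply Rdiv_le_0_compat; auto. nra. }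
  intros h Hh.
  assert (Hzh : Cmod (z + h) <= rho) by (eapply Rle_trans; [apply Cmod_triangle|]; lra).
  assert (P : 0 <= Cmod h * Cmod h) by (assert (0 <= Cmod h) by apply Cmod_ge_0; nra).
  apply le_epsilon. intros eps Heps.
  destruct (half_pow_small K (eps / 3)) as [N1 H1]; auto. lra.
  assert (HKr : 0 <= K / rho) by (apply Rdiv_le_0_compat; auto).
  assert (HKh : 0 <= K / rho * Cmod h) by (apply Rmult_le_pos; auto using Cmod_ge_0).
  destruct (half_pow_small (K / rho * Cmod h) (eps / 3)) as [N2 H2]; auto. lra.
  set (n := (N1 + N2)%nat). specialize (H1 n ltac:(unfold n; lia)). specialize (H2 n ltac:(unfold n; lia)).
  assert (Q1 := pser_lim a K A rho z HK HA Hr HAr Ha ltac:(lra) n).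
  assert (Q2 := pser_lim a K A rho (z + h)%C HK HA Hr HAr Ha Hzh n).
  specialize (HL n).
  assert (B : Cmod (csum (fun k => a k * ((z + h) ^ k - z ^ k - h * (RtoC (INR k) * z ^ pred k)))%C n) <= 2 * (K / (rho * rho) * (Cmod h * Cmod h))).
  { apply csum_bound.
    - apply Rmult_le_pos; auto. apply Rdiv_le_0_compat; auto. nra.
    - intros k. rewrite Cmod_mult.
      assert (R := pow_remainder z h rho k ltac:(lra) ltac:(lra) Hzh).
      set (D := Cmod ((z + h) ^ k - z ^ k - h * (RtoC (INR k) * z ^ pred k))%C) in *.
      assert (G := proj1 (pow_gain k A rho HAr')). rewrite Rpow_mult_distr in G.
      assert (HD : 0 <= D) by apply Cmod_ge_0.
      assert (HAk : 0 <= A ^ k) by (apply pow_le; lra).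
      apply Rmult_le_reg_r with (rho * rho). nra.
      replace (K / (rho * rho) * (Cmod h * Cmod h) * (/ 2) ^ k * (rho * rho)) with (K * ((/ 2) ^ k * (Cmod h * Cmod h))) by (field; lra).
      apply Rle_trans with (K * A ^ k * (rho * rho * D)).
      + rewrite Rmult_assoc, (Rmult_comm D). apply Rmult_le_compat_r; auto. apply Rmult_le_pos; nra.
      + apply Rle_trans with (K * A ^ k * (INR k * INR k * rho ^ k * (Cmod h * Cmod h))).
        apply Rmult_le_compat_l; auto. apply Rmult_le_pos; auto.
        replace (K * A ^ k * (INR k * INR k * rho ^ k * (Cmod h * Cmod h))) with (K * ((INR k * INR k * (A ^ k * rho ^ k)) * (Cmod h * Cmod h))) by ring.
        apply Rmult_le_compat_l; auto. apply Rmult_le_compat_r; auto. }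
  rewrite <- csum_taylor in B.
  set (c1 := csum (fun k => a k * (z + h) ^ k)%C n) in *. set (c0 := csum (fun k => a k * z ^ k)%C n) in *.
  set (d := csum (fun k => a k * (RtoC (INR k) * z ^ pred k))%C n) in *.
  replace (pser a (z + h) - pser a z - h * L)%C with
    ((c1 - c0 - h * d) - (c1 - pser a (z + h)) + (c0 - pser a z) + h * (d - L))%C by ring.
  eapply Rle_trans; [apply Cmod_triangle|]. eapply Rle_trans; [apply Rplus_le_compat_r, Cmod_triangle|].
  eapply Rle_trans; [apply Rplus_le_compat_r, Rplus_le_compat_r, Cmod_triangle_minus|]. rewrite Cmod_mult.
  assert (Cmod h * Cmod (d - L) <= eps / 3).
  { apply Rle_trans with (K / rho * Cmod h * (/ 2) ^ n); [|lra].
    replace (K / rho * Cmod h * (/ 2) ^ n) with (Cmod h * (K / rho * (/ 2) ^ n)) by ring. apply Rmult_le_compat_l; auto using Cmod_ge_0. }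
  lra.
Qed.

Lemma C_pseries_unique a z l m : is_pseries (K := C_AbsRing) (V := C_NormedModule) a z l ->
  is_pseries (K := C_AbsRing) (V := C_NormedModule) a z m -> l = m.
Proof.
  intros H1 H2. apply Ceq_of_close with 2. intros eps Heps.
  destruct (proj1 (is_pseries_C a z l) H1 eps Heps) as [N1 K1]. destruct (proj1 (is_pseries_C a z m) H2 eps Heps) as [N2 K2].
  specialize (K1 (N1 + N2)%nat ltac:(lia)). specialize (K2 (N1 + N2)%nat ltac:(lia)).
  match type of K1 with Cmod (?c - _)%C < _ => replace (l - m)%C with ((c - m) - (c - l))%C by ring end.
  eapply Rle_trans; [apply Cmod_triangle_minus|]. lra.
Qed.

Lemma pser_is_pseries a K A rho z : 0 <= K -> 0 < A -> 0 < rho -> A * rho <= / 16 -> (forall k, Cmod (a k) <= K * A ^ k) -> Cmod z <= rho ->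
  is_pseries (K := C_AbsRing) (V := C_NormedModule) a z (pser a z).
Proof.
  intros HK HA Hr HAr Ha Hz. apply is_pseries_C. intros eps Heps.
  destruct (half_pow_small K eps HK Heps) as [N HN]. exists N. intros n Hn.
  eapply Rle_lt_trans; [apply (pser_lim a K A rho); auto|]. auto.
Qed.

(** * Growth constants of the coefficient function *)

(** What the rest of the proof uses of phi: b < PI exceeds both vertical indicators
    and is a type in vertical strips, a is a type on the positive real axis. *)
Record tame (phi : C -> C) (K a b : R) : Prop := {
  tame_holo : forall z, holo phi z;
  tame_order : order1 phi;
  tame_type : 0 < b < PI;
  tame_right : ray_bound phi 0 a;
  tame_up : Rbar_lt (indicator phi (PI / 2)) b;
  tame_down : Rbar_lt (indicator phi (- (PI / 2))) b;
  tame_strip : strip_growth phi b;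
  tame_const : 0 < K;
  tame_half_plane : forall x y, 0 <= x -> Cmod (phi (x, y)) <= K * exp (a * x + b * Rabs y) }.

(** b lies between the vertical indicators and PI with room to spare, since the
    strip bound on the left costs an arbitrarily small part of the type. *)
Lemma tame_of_class phi : class_E3 phi ->
  Rbar_lt (indicator phi 0) p_infty -> Rbar_lt (indicator phi (PI / 2)) PI -> Rbar_lt (indicator phi (- (PI / 2))) PI ->
  exists K a b, tame phi K a b.
Proof.
  intros [He [Ho _]] H0 H1 H2. assert (Hpi := PI_RGT_0).
  assert (Hol : forall z, holo phi z) by (intros z; apply holo_differentiable, He).
  assert (Ho1 := order1_of_order phi Hol Ho).
  destruct (Rbar_lt_between _ _ H1) as [B1 [I1 L1]]. destruct (Rbar_lt_between _ _ H2) as [B2 [I2 L2]].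
  set (b0 := Rmax (PI / 2) (Rmax B1 B2)).
  assert (E1 : B1 <= b0) by (eapply Rle_trans; [apply Rmax_l|apply Rmax_r]).
  assert (E2 : B2 <= b0) by (eapply Rle_trans; [apply (Rmax_r B1)|apply Rmax_r]).
  assert (E0 : PI / 2 <= b0) by apply Rmax_l.
  assert (Lb : b0 < PI) by (unfold b0; repeat apply Rmax_lub_lt; lra).
  clearbody b0.
  assert (R1 : ray_bound phi (PI / 2) b0) by (apply ray_bound_weaken with B1; [lra|apply ray_bound_of_indicator; assumption]).
  assert (R2 : ray_bound phi (- (PI / 2)) b0) by (apply ray_bound_weaken with B2; [lra|apply ray_bound_of_indicator; assumption]).
  destruct (ray_bound_of_dom phi 0 Hol H0) as [a Ra].
  destruct (right_half_plane_bound phi a b0 Hol Ho1 ltac:(lra) Ra R1 R2) as [K [HK HB]].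
  set (b := (b0 + PI) / 2).
  assert (Hb : b0 < b < PI) by (unfold b; lra).
  assert (Im_ : forall x y, 0 <= x -> Cmod (phi (x, y)) <= K * exp (a * x + b * Rabs y)).
  { intros x y Hx. eapply Rle_trans; [apply HB; auto|]. apply Rmult_le_compat_l. lra. apply exp_le.
    assert (0 <= Rabs y) by apply Rabs_pos. nra. }
  exists K, a, b. split; auto.
  - lra.
  - eapply Rbar_lt_le_trans; [apply I1|]. simpl. lra.
  - eapply Rbar_lt_le_trans; [apply I2|]. simpl. lra.
  - intros m Hm.
    destruct (left_strip_bound phi b0 (b - b0) m Hol Ho1 ltac:(lra) ltac:(lra) Hm R1 R2) as [K' [HK' HB']].
    exists (K' + K * exp (Rabs a * m)). assert (P : 0 < exp (Rabs a * m)) by apply exp_pos.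
    split. nra. intros x y Hx. assert (P2 : 0 < exp (b * Rabs y)) by apply exp_pos.
    destruct (Rle_dec 0 x) as [Hx0|Hx0].
    + eapply Rle_trans; [apply Im_; auto|]. rewrite exp_plus.
      assert (exp (a * x) <= exp (Rabs a * m)).
      { apply exp_le. rewrite Rabs_pos_eq in Hx by auto. assert (Q := Rle_abs a). assert (Q' := Rabs_pos a).
        apply Rle_trans with (Rabs a * x). apply Rmult_le_compat_r; auto. apply Rmult_le_compat_l; auto. }
      rewrite Rmult_plus_distr_r. assert (0 < K' * exp (b * Rabs y)) by (apply Rmult_lt_0_compat; auto).
      assert (K * (exp (a * x) * exp (b * Rabs y)) <= K * (exp (Rabs a * m) * exp (b * Rabs y))).
      { apply Rmult_le_compat_l. lra. apply Rmult_le_compat_r; lra. }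
      lra.
    + specialize (HB' x y). replace (b0 + (b - b0)) with b in HB' by ring.
      assert (Hx' : - m <= x <= 0) by (apply Rabs_le_between in Hx; lra).
      eapply Rle_trans; [apply HB'; auto|]. apply Rmult_le_compat_r. lra. assert (0 < K * exp (Rabs a * m)) by (apply Rmult_lt_0_compat; auto). lra.
Qed.

Lemma tame_up_bound phi K a b : tame phi K a b -> ray_bound phi (PI / 2) b.
Proof. intros H. apply ray_bound_of_indicator; apply H. Qed.

(** By barnes_pseries and continuation_barnes this is f (- e^zeta) for |Im zeta| <
    PI - b. *)
Definition barnes (phi : C -> C) (zeta : C) : C := (- (/ 2 * Mell phi (- / 2) zeta))%C.

Lemma holo_barnes phi K a b zeta : tame phi K a b -> Rabs (Im zeta) < PI - b -> holo (barnes phi) zeta.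
Proof.
  intros H Hz. apply holo_opp, holo_mult. apply holo_const.
  apply (holo_Mell phi b zeta _ 0); try apply H; auto. lra.
Qed.

Lemma barnes_pseries phi K a b zeta : tame phi K a b -> Rabs (Im zeta) < PI - b -> Re zeta < - a ->
  is_pseries (K := C_AbsRing) (V := C_NormedModule) (fun n => phi (RtoC (INR n))) (- Cexp zeta)%C (barnes phi zeta).
Proof. intros H Hz Ha. apply (Mell_pseries phi K a b); auto; apply H. Qed.

Lemma barnes_plana phi K a b w s : tame phi K a b -> (s = 1 \/ s = - (1)) -> - (2 * PI - b) < s * Im w < - b ->
  barnes phi (- (RtoC (s * PI) * Ci) - w) = plana phi w.
Proof.
  intros H Hs Hw. apply (Mell_plana phi b w s a); try assumption; try apply H. eapply tame_up_bound; eauto.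
Qed.

Lemma Cexp_sign_PI s w : (s = 1 \/ s = - (1)) -> (- Cexp (- (RtoC (s * PI) * Ci) - w) = Cexp (- w))%C.
Proof.
  intros Hs. unfold Cminus. rewrite Cexp_add.
  replace (Cexp (- (RtoC (s * PI) * Ci))) with (- (1))%C. ring.
  unfold Cexp; simpl. replace (- (s * PI * 0 - 0 * 1)) with 0 by ring. replace (- (s * PI * 1 + 0 * 0)) with (- (s * PI)) by ring.
  rewrite exp_0, cos_neg, sin_neg. destruct Hs; subst. rewrite !Rmult_1_l, cos_PI, sin_PI. apply Ceq; simpl; ring.
  replace (- (1) * PI) with (- PI) by ring. rewrite cos_neg, sin_neg, cos_PI, sin_PI. apply Ceq; simpl; ring.
Qed.

(** * The analytic continuation *)

Definition coefs (phi : C -> C) (n : nat) : C := phi (RtoC (INR n)).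

(** The coefficients grow at most like e^(a n); the factor 1/16 is that of pow_gain. *)
Definition radius (a : R) : R := exp (- a) / 16.

Lemma radius_pos a : 0 < radius a.
Proof. unfold radius. assert (0 < exp (- a)) by apply exp_pos. lra. Qed.

Lemma coefs_bound phi K a b : tame phi K a b -> forall k, Cmod (coefs phi k) <= K * exp a ^ k.
Proof.
  intros H k. unfold coefs. change (RtoC (INR k)) with ((INR k, 0) : C).
  eapply Rle_trans; [apply H; apply pos_INR|]. rewrite Rabs_R0, Rmult_0_r, Rplus_0_r. right. f_equal.
  induction k. simpl. rewrite Rmult_0_r, exp_0; auto. rewrite S_INR, Rmult_plus_distr_l, exp_plus, IHk, Rmult_1_r. simpl; ring.
Qed.

Lemma exp_radius a : exp a * radius a <= / 16.
Proof.
  unfold radius. assert (E : exp a * exp (- a) = 1) by (rewrite <- exp_plus, <- exp_0; f_equal; ring). lra.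
Qed.

Lemma tame_pser phi K a b z : tame phi K a b -> Cmod z <= radius a ->
  is_pseries (K := C_AbsRing) (V := C_NormedModule) (coefs phi) z (pser (coefs phi) z).
Proof.
  intros H Hz. apply pser_is_pseries with K (exp a) (radius a); auto using radius_pos, exp_radius, exp_pos.
  apply Rlt_le, H. eapply coefs_bound; eauto.
Qed.

Lemma tame_pser_holo phi K a b z : tame phi K a b -> Cmod z < radius a -> holo (pser (coefs phi)) z.
Proof.
  intros H Hz. apply holo_pser with K (exp a) (radius a); auto using radius_pos, exp_radius, exp_pos.
  apply Rlt_le, H. eapply coefs_bound; eauto.
Qed.

Lemma radius_lt a x : exp (- x) < radius a -> a < x.
Proof.
  intros H. unfold radius in H. assert (0 < exp (- a)) by apply exp_pos.
  assert (- x < - a) by (apply exp_lt_inv; lra). lra.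
Qed.

Lemma good_real_ray phi a w : ray_bound phi 0 a -> a < Re w -> good_ray phi w 0.
Proof.
  intros [K [HK HB]] Hw. exists (Re w - a). split. lra. exists K. split; auto. intros t Ht.
  unfold twist. rewrite Cmod_mult, Cmod_Cexp. replace (Re (- w * polar t 0)) with (- (Re w * t)).
  - replace (- (Re w - a) * t) with (a * t + - (Re w * t)) by ring. rewrite exp_plus, <- Rmult_assoc.
    apply Rmult_le_compat_r. apply Rlt_le, exp_pos. auto.
  - rewrite polar_coord, cos_0, sin_0. destruct w; simpl; ring.
Qed.

Lemma tame_holo_plana phi K a b w th : tame phi K a b -> Rabs (Im w) < 2 * PI - b -> good_ray phi w th -> holo (plana phi) w.
Proof.
  intros H Hw G. apply (holo_plana phi b w th a); try assumption; try apply H. eapply tame_up_bound; eauto.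
Qed.

(** The two descriptions of f agree for large Re w: on the outer strips by the
    Mellin-Barnes integral, and then between them by the identity theorem. *)
Lemma pser_plana phi K a b w : tame phi K a b -> Rabs (Im w) < 2 * PI - b -> exp (- Re w) < radius a ->
  pser (coefs phi) (Cexp (- w)) = plana phi w.
Proof.
  intros H. assert (Hpi := PI_RGT_0). assert (Hb := tame_type _ _ _ _ H).
  assert (Outer : forall w, b < Rabs (Im w) < 2 * PI - b -> exp (- Re w) < radius a -> pser (coefs phi) (Cexp (- w)) = plana phi w).
  { clear w. intros w Hw Hr.
    assert (Ex : exists s, (s = 1 \/ s = - (1)) /\ - (2 * PI - b) < s * Im w < - b).
    { unfold Rabs in Hw. destruct (Rcase_abs (Im w)). exists 1. split; auto. lra. exists (- (1)). split; auto. lra. }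
    destruct Ex as [s [Hs Hsw]].
    rewrite <- (barnes_plana phi K a b w s H Hs Hsw), <- (Cexp_sign_PI s) by auto.
    set (zeta := (- (RtoC (s * PI) * Ci) - w)%C).
    apply (C_pseries_unique (coefs phi) (- Cexp zeta)%C).
    - apply tame_pser with K a b; auto. unfold zeta. rewrite Cexp_sign_PI, Cmod_Cexp by auto.
      replace (Re (- w)) with (- Re w) by (destruct w; auto). lra.
    - apply (barnes_pseries phi K a b); auto.
      + replace (Im zeta) with (- (s * PI) - Im w) by (unfold zeta; destruct w; simpl; ring).
        apply Rabs_lt_between. destruct Hs; subst s; lra.
      + replace (Re zeta) with (- Re w) by (unfold zeta; destruct w; simpl; ring). apply radius_lt in Hr. lra. }
  intros Hw Hr.
  destruct (Rlt_dec b (Rabs (Im w))) as [Hbw|Hbw]. { apply Outer; auto. }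
  set (D := fun w => (pser (coefs phi) (Cexp (- w)) - plana phi w)%C).
  assert (HD : forall w, Rabs (Im w) < 2 * PI - b -> exp (- Re w) < radius a -> holo D w).
  { intros w' Hw' Hr'. apply holo_minus.
    - apply (holo_comp (pser (coefs phi))); auto with hol. apply tame_pser_holo with K a b; auto.
      rewrite Cmod_Cexp. replace (Re (- w')) with (- Re w') by (destruct w'; auto). auto.
    - apply (tame_holo_plana phi K a b w' 0); auto. apply good_real_ray with a. apply H. apply radius_lt; auto. }
  assert (HR : exists d, 0 < d /\ forall y, Rabs (y - Re w) <= d -> exp (- y) < radius a).
  { exists ((Re w + ln (radius a)) / 2). assert (Q := radius_pos a).
    assert (- Re w < ln (radius a)) by (rewrite <- (ln_exp (- Re w)); apply ln_increasing; auto; apply exp_pos).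
    split. lra. intros y Hy. rewrite <- (exp_ln (radius a)) by auto. apply exp_increasing.
    apply Rabs_le_between in Hy. lra. }
  destruct HR as [d [Hd HRd]].
  apply Cminus_eq_0. change (D w = 0).
  assert (Hre : forall u, Im (- Ci * u) = - Re u) by (intros [p q]; simpl; ring).
  assert (Hrr : forall u, Re (- Ci * u) = Im u) by (intros [p q]; simpl; ring).
  assert (X := identity_rect (fun u => D (- Ci * u)%C) (- PI) PI (Re w) d Hd).
  replace w with (- Ci * (- Im w, Re w)%R)%C by (destruct w; apply Ceq; simpl; ring).
  apply Rnot_lt_le in Hbw. apply Rabs_le_between in Hbw.
  apply X; clear X.
  - intros u [U1 U2]. apply (holo_comp D); [|auto with hol]. apply HD.
    + rewrite Hre, Rabs_Ropp. apply Rle_lt_trans with PI; [|lra]. apply Rabs_le_between; auto.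
    + rewrite Hrr. apply HRd. apply Rabs_le; lra.
  - intros y Hy. unfold D. rewrite Outer. ring.
    rewrite Hre. simpl. rewrite Ropp_involutive, Rabs_pos_eq; lra.
    rewrite Hrr. simpl. apply HRd. apply Rabs_le; lra.
  - lra.
Qed.

Lemma Cexp_1_inv u : Cexp u = 1 -> exists k : Z, u = (RtoC (2 * PI * IZR k) * Ci)%C.
Proof.
  intros E. assert (M := f_equal Cmod E). rewrite Cmod_Cexp, Cmod_1 in M.
  assert (R0 : Re u = 0) by (apply exp_inv; rewrite exp_0; auto).
  assert (E1 := f_equal Re E). unfold Cexp in E1; simpl in E1. rewrite R0, exp_0, Rmult_1_l in E1.
  replace (Im u) with (2 * (Im u / 2)) in E1 by field. rewrite cos_2a_sin in E1.
  assert (S : sin (Im u / 2) = 0) by nra.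
  apply sin_eq_0_0 in S. destruct S as [k Hk]. exists k. apply Ceq; simpl; lra.
Qed.

Lemma Cexp_eq_inv u v : Cexp u = Cexp v -> exists k : Z, u = (v + RtoC (2 * PI * IZR k) * Ci)%C.
Proof.
  intros E. destruct (Cexp_1_inv (u - v)) as [k Hk].
  - unfold Cminus. rewrite Cexp_add, E, Cexp_opp. apply Cinv_r, Cexp_neq_0.
  - exists k. rewrite <- Hk. ring.
Qed.

Lemma Clog_Im z : - (PI / 2) < Im (Clog z) < PI / 2.
Proof. simpl. generalize (atan_bound (Im z / Re z)); lra. Qed.

Lemma Cexp_surj (z : C) : z <> 0 -> exists w, Cexp (- w) = z /\ Rabs (Im w) <= PI.
Proof.
  intros Hz. assert (Hpi := PI_RGT_0).
  assert (L : exists v, Cexp v = z /\ Rabs (Im v) <= PI).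
  { destruct (Rlt_dec 0 (Re z)) as [H|H].
    { exists (Clog z). split. apply Cexp_Clog; auto. apply Rabs_le. generalize (Clog_Im z); lra. }
    assert (T : forall s, (s = 1 \/ s = - (1)) -> forall v, Cexp v = (- z)%C -> Cexp (v + Ci * RtoC (s * PI)) = z).
    { intros s Hs v E. rewrite Cexp_add, E. replace (Cexp (Ci * RtoC (s * PI))) with (- (1))%C. ring.
      unfold Cexp; simpl. replace (0 * (s * PI) - 1 * 0) with 0 by ring. replace (0 * 0 + 1 * (s * PI)) with (s * PI) by ring.
      rewrite exp_0. destruct Hs; subst. rewrite !Rmult_1_l, cos_PI, sin_PI. apply Ceq; simpl; ring.
      replace (- (1) * PI) with (- PI) by ring. rewrite cos_neg, sin_neg, cos_PI, sin_PI. apply Ceq; simpl; ring. }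
    destruct (Req_dec (Re z) 0) as [H0|H0].
    - assert (Hi : Im z <> 0) by (intros Hi; apply Hz, Ceq; simpl; auto).
      assert (Q : forall s, (s = 1 \/ s = - (1)) -> 0 < s * Im z -> exists v, Cexp v = z /\ Rabs (Im v) <= PI).
      { intros s Hs Hp. exists (ln (s * Im z), s * (PI / 2)). split.
        - unfold Cexp; simpl. rewrite exp_ln by auto. apply Ceq; simpl; destruct Hs; subst s.
          rewrite !Rmult_1_l, cos_PI2; lra. replace (- (1) * (PI / 2)) with (- (PI / 2)) by ring. rewrite cos_neg, cos_PI2; lra.
          rewrite !Rmult_1_l, sin_PI2; lra. replace (- (1) * (PI / 2)) with (- (PI / 2)) by ring. rewrite sin_neg, sin_PI2; lra.
        - simpl. rewrite sign_abs by (auto; lra). lra. }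
      destruct (Rdichotomy _ _ Hi). apply (Q (- (1))); [auto|lra]. apply (Q 1); [auto|lra].
    - assert (Hm : 0 < Re (- z)) by (destruct (Rdichotomy _ _ H0); [change (Re (- z)) with (- Re z); lra|contradiction]).
      assert (E := Cexp_Clog _ Hm). assert (B := Clog_Im (- z)).
      destruct (Rle_dec 0 (Im (Clog (- z)))) as [Hs|Hs].
      + exists (Clog (- z) + Ci * RtoC (- (1) * PI))%C. split. apply T; auto.
        replace (Im (Clog (- z) + Ci * RtoC (- (1) * PI))) with (Im (Clog (- z)) - PI) by (simpl; ring). apply Rabs_le; lra.
      + exists (Clog (- z) + Ci * RtoC (1 * PI))%C. split. apply T; auto.
        replace (Im (Clog (- z) + Ci * RtoC (1 * PI))) with (Im (Clog (- z)) + PI) by (simpl; ring). apply Rabs_le; lra. }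
  destruct L as [v [E B]]. exists (- v)%C. split. rewrite <- E. f_equal. ring.
  replace (Im (- v)) with (- Im v) by (destruct v; auto). rewrite Rabs_Ropp. auto.
Qed.

(** Any solution w of e^(- w) = z with |Im w| <= PI; by plana_wrap any two of
    them give the same value of plana. *)
Definition neg_log (z : C) : C := epsilon (inhabits (RtoC 0)) (fun w => Cexp (- w) = z /\ Rabs (Im w) <= PI).

Lemma neg_log_spec (z : C) : z <> 0 -> Cexp (- neg_log z) = z /\ Rabs (Im (neg_log z)) <= PI.
Proof. intros Hz. apply (epsilon_spec (inhabits (RtoC 0)) (fun w => Cexp (- w) = z /\ Rabs (Im w) <= PI)), Cexp_surj, Hz. Qed.

(** Two logarithms in the range differ by 0 or by 2 PI i. In the second case they
    lie in the two strips of Mell_plana, and give the same Mellin-Barnes integral. *)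
Lemma plana_wrap phi K a b w w' : tame phi K a b -> Rabs (Im w) < 2 * PI - b -> Rabs (Im w') <= PI ->
  Cexp (- w) = Cexp (- w') -> plana phi w = plana phi w'.
Proof.
  intros H Hw Hw' E. assert (Hpi := PI_RGT_0). assert (Hb := tame_type _ _ _ _ H).
  apply Cexp_eq_inv in E. destruct E as [k Hk].
  assert (Ew : w' = (w + RtoC (2 * PI * IZR k) * Ci)%C).
  { replace w with (- - w)%C by ring. rewrite Hk. ring. }
  assert (Iw : Im w' = Im w + 2 * PI * IZR k) by (rewrite Ew; clear; destruct w; simpl; ring).
  apply Rabs_lt_between in Hw. apply Rabs_le_between in Hw'.
  assert (k1 : (-2 < k)%Z) by (apply lt_IZR; nra). assert (k2 : (k < 2)%Z) by (apply lt_IZR; nra).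
  assert (Hk' : k = 0%Z \/ k = 1%Z \/ k = (-1)%Z) by lia.
  destruct Hk' as [->|[->| ->]].
  - rewrite Ew. f_equal. rewrite Rmult_0_r. ring.
  - rewrite <- (barnes_plana phi K a b w 1 H (or_introl eq_refl)), <- (barnes_plana phi K a b w' (- (1)) H (or_intror eq_refl)) by lra.
    f_equal. rewrite Ew. apply Ceq; simpl; ring.
  - rewrite <- (barnes_plana phi K a b w (- (1)) H (or_intror eq_refl)), <- (barnes_plana phi K a b w' 1 H (or_introl eq_refl)) by lra.
    f_equal. rewrite Ew. apply Ceq; simpl; ring.
Qed.

Definition continuation (phi : C -> C) (r : R) (z : C) : C :=
  if Rlt_dec (Cmod z) r then pser (coefs phi) z else plana phi (neg_log z).

Lemma continuation_exp phi K a b w : tame phi K a b -> Rabs (Im w) < 2 * PI - b ->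
  continuation phi (radius a) (Cexp (- w)) = plana phi w.
Proof.
  intros H Hw. unfold continuation. destruct Rlt_dec as [Hr|Hr].
  - apply pser_plana with K a b; auto. rewrite Cmod_Cexp in Hr. destruct w; auto.
  - destruct (neg_log_spec (Cexp (- w)) (Cexp_neq_0 _)) as [E1 E2].
    symmetry. apply plana_wrap with K a b; auto.
Qed.

(** Near z with |z| >= radius a the function is plana composed with a local branch
    of the logarithm, and the point w = neg_log z is outside the conjugate diagram,
    so that some ray is good for it. *)
Theorem continuation_exists phi K a b : tame phi K a b -> is_continuation phi (continuation phi (radius a)).
Proof.
  intros H. assert (Hpi := PI_RGT_0). assert (Hb := tame_type _ _ _ _ H). assert (Hr := radius_pos a). split.
  - intros z Hz. apply holo_differentiable.
    destruct (Rlt_dec (Cmod z) (radius a)) as [Hzr|Hzr].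
    + apply holo_ext_loc with (pser (coefs phi)).
      * exists (radius a - Cmod z). split. lra. intros x Hx. unfold continuation.
        destruct Rlt_dec as [Hx'|Hx']; auto. exfalso. apply Hx'.
        replace x with ((x - z) + z)%C by ring. eapply Rle_lt_trans; [apply Cmod_triangle|]. lra.
      * apply tame_pser_holo with K a b; auto.
    + assert (Nz : z <> 0) by (intros ->; apply Hzr; rewrite Cmod_0; auto).
      destruct (neg_log_spec z Nz) as [E1 E2]. set (w0 := neg_log z) in *. clearbody w0.
      assert (Nd : ~ conj_diagram phi w0) by (intros Hd; apply Hz; exists w0; split; auto).
      destruct (good_ray_of_diagram phi w0 (tame_holo _ _ _ _ H) Nd) as [th Hth].
      set (l := fun x => (w0 - Clog (/ z * x))%C).
      assert (Hl : holo l z).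
      { unfold l. apply holo_minus; auto with hol. apply (holo_comp Clog). 2: auto with hol.
        exists (/ (/ z * z))%C. apply cderiv_Clog. replace (/ z * z)%C with (RtoC 1) by (field; auto). simpl; lra. }
      assert (Lz : l z = w0).
      { unfold l. replace (/ z * z)%C with (RtoC 1) by (field; auto).
        replace (Clog 1) with (RtoC 0). ring. unfold Clog; simpl.
        replace (1 * 1 + 0 * 0) with 1 by ring. replace (0 / 1) with 0 by field. rewrite ln_1, atan_0.
        apply Ceq; simpl; field. }
      assert (Hc := holo_ccont l z Hl (PI - b) ltac:(lra)). destruct Hc as [d [Hd Hc]].
      assert (Pz := proj1 (Cmod_gt_0 z) Nz).
      apply holo_ext_loc with (fun x => plana phi (l x)).
      * exists (Rmin d (Cmod z)). split. apply Rmin_pos; auto.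
        intros x Hx. symmetry. apply lt_Rmin in Hx. destruct Hx as [h1 h2].
        specialize (Hc _ h1). replace (z + (x - z))%C with x in Hc by ring. rewrite Lz in Hc.
        assert (Hp : 0 < Re (/ z * x)).
        { replace (/ z * x)%C with (1 + (x - z) / z)%C by (field; auto).
          assert (X : Cmod ((x - z) / z) < 1) by (rewrite Cmod_div by auto; apply Rlt_div_l; lra).
          assert (Y := re_le_Cmod ((x - z) / z)). apply Rabs_le_between in Y.
          change (Re (1 + (x - z) / z)) with (1 + Re ((x - z) / z)). lra. }
        replace x with (Cexp (- l x)) at 1.
        2:{ unfold l. replace (- (w0 - Clog (/ z * x)))%C with (- w0 + Clog (/ z * x))%C by ring.
            rewrite Cexp_add, Cexp_Clog, E1 by auto. field. auto. }
        apply continuation_exp with K b; auto.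
        apply Im_near with w0. lra.
      * apply (holo_comp (plana phi)); auto. rewrite Lz. apply tame_holo_plana with K a b th; auto. lra.
  - exists (radius a). split; auto. intros z Hz. unfold continuation. destruct Rlt_dec; [|lra].
    apply tame_pser with K a b; auto. lra.
Qed.

(** * The sector around the negative axis *)

(** The conditions at th = PI / 2 and th = - PI / 2 bound the imaginary part. *)
Lemma diagram_strip phi K a b q : tame phi K a b -> conj_diagram phi q -> Rabs (Im q) < b.
Proof.
  intros H [p [Hp ->]].
  assert (A1 := Rbar_le_lt_trans _ _ _ (Hp (PI / 2)) (tame_up _ _ _ _ H)).
  assert (A2 := Rbar_le_lt_trans _ _ _ (Hp (- (PI / 2))) (tame_down _ _ _ _ H)).
  assert (E : forall th, Re (p * Cexp (- (Ci * RtoC th))) = Re p * cos th + Im p * sin th).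
  { intros th. destruct p as [x y]. unfold Cexp; simpl.
    replace (- (0 * th - 1 * 0)) with 0 by ring. replace (- (0 * 0 + 1 * th)) with (- th) by ring.
    rewrite exp_0, cos_neg, sin_neg. ring. }
  rewrite E in A1, A2. rewrite cos_neg, sin_neg, cos_PI2, sin_PI2 in *. simpl in A1, A2.
  replace (Im (Cconj p)) with (- Im p) by (destruct p; auto). rewrite Rabs_Ropp. apply Rabs_lt_between. lra.
Qed.

Lemma sector_in_domain phi K a b zeta : tame phi K a b -> Rabs (Im zeta) < PI - b -> continuation_domain phi (- Cexp zeta).
Proof.
  intros H Hz [q [Hq E]]. assert (Hb := diagram_strip phi K a b q H Hq). assert (Hpi := PI_RGT_0).
  assert (E' : Cexp (- q) = Cexp (- (RtoC (1 * PI) * Ci) - (- zeta))).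
  { rewrite <- E. symmetry.
    replace (Cexp (- (RtoC (1 * PI) * Ci) - - zeta)) with (- (- Cexp (- (RtoC (1 * PI) * Ci) - - zeta)))%C by ring.
    rewrite (Cexp_sign_PI 1) by auto. do 2 f_equal. ring. }
  apply Cexp_eq_inv in E'. destruct E' as [k Hk].
  assert (I := f_equal Im Hk).
  replace (Im (- (RtoC (1 * PI) * Ci) - - zeta + RtoC (2 * PI * IZR k) * Ci)) with (- PI + Im zeta + 2 * PI * IZR k) in I
    by (destruct zeta; simpl; ring).
  replace (Im (- q)) with (- Im q) in I by (destruct q; auto).
  apply Rabs_lt_between in Hb. apply Rabs_lt_between in Hz.
  assert (k1 : (0 < k)%Z) by (apply lt_IZR; nra). assert (k2 : (k < 1)%Z) by (apply lt_IZR; nra). lia.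
Qed.

(** The points - e^zeta with |Im zeta| < PI - b form a sector in the domain that
    reaches 0, where both sides are sums of the same power series; the identity
    theorem, applied in the variable zeta, carries the equality through the strip. *)
Theorem continuation_barnes phi K a b f zeta : tame phi K a b -> is_continuation phi f -> Rabs (Im zeta) < PI - b ->
  f (- Cexp zeta)%C = barnes phi zeta.
Proof.
  intros H [Hf [r [Hr Hps]]] Hz.
  set (D := fun z => (f (- Cexp z) - barnes phi z)%C).
  assert (HD : forall z, Rabs (Im z) < PI - b -> holo D z).
  { intros z Hzz. apply holo_minus.
    - apply (holo_comp f); auto with hol. apply holo_differentiable, Hf. apply sector_in_domain with K a b; auto.
    - apply holo_barnes with K a b; auto. }
  set (d := (PI - b - Rabs (Im zeta)) / 2).
  set (x0 := Rmin (Rmin (- a) (ln r)) (Re zeta) - 1).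
  assert (B1 : x0 < - a). { unfold x0. assert (X := Rmin_l (Rmin (- a) (ln r)) (Re zeta)). assert (Y := Rmin_l (- a) (ln r)). lra. }
  assert (B2 : x0 < ln r). { unfold x0. assert (X := Rmin_l (Rmin (- a) (ln r)) (Re zeta)). assert (Y := Rmin_r (- a) (ln r)). lra. }
  assert (B3 : x0 < Re zeta). { unfold x0. assert (X := Rmin_r (Rmin (- a) (ln r)) (Re zeta)). lra. }
  clearbody x0.
  assert (Hd : 0 < d) by (unfold d; lra).
  assert (Hy : forall y, Im zeta - d <= y <= Im zeta + d -> Rabs y < PI - b).
  { intros y Hy. assert (Rabs (y - Im zeta) <= d) by (apply Rabs_le; lra).
    assert (T := Rabs_triang (y - Im zeta) (Im zeta)). replace (y - Im zeta + Im zeta) with y in T by ring. unfold d in *. lra. }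
  apply Cminus_eq_0. change (D zeta = 0).
  replace zeta with ((Re zeta, Im zeta) : C) by (destruct zeta; auto).
  apply (identity_rect D x0 (Re zeta + 1) (Im zeta) d Hd).
  - intros z [Z1 Z2]. apply HD. apply Hy; auto.
  - intros y Yy. unfold D.
    assert (E : f (- Cexp (x0, y))%C = barnes phi (x0, y)); [|rewrite E; ring].
    apply (C_pseries_unique (coefs phi) (- Cexp (x0, y))%C).
    + apply Hps. rewrite Cmod_opp, Cmod_Cexp. simpl. rewrite <- (exp_ln r) by auto. apply exp_increasing; auto.
    + apply (barnes_pseries phi K a b); [exact H|apply Hy; exact Yy|exact B1].
  - lra.
Qed.

(** * The subtracted function f_N *)

(** Moving the line to the left of -1/2 picks up the terms with negative index. *)
Lemma Mell_negative_partial phi b zeta (m : nat) : (forall z, holo phi z) -> strip_growth phi b -> Rabs (Im zeta) < PI - b ->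
  sum_n_m (G := C_AbelianGroup) (fun n => phi (- RtoC (INR n)) * / (- Cexp zeta) ^ n)%C 1 m =
   (/ 2 * Mell phi (- / 2) zeta - / 2 * Mell phi (- INR m - / 2) zeta)%C.
Proof.
  intros Hol HG Hz. induction m.
  - rewrite sum_n_m_zero by lia. simpl INR. replace (- 0 - / 2) with (- / 2) by ring.
    change (RtoC 0 = / 2 * Mell phi (- / 2) zeta - / 2 * Mell phi (- / 2) zeta)%C. ring.
  - rewrite sum_n_Sm by lia. rewrite IHm.
    assert (E := Mell_shift_pole phi b zeta (- Z.of_nat (S m)) Hol HG Hz). rewrite opp_IZR, <- INR_IZR_INZ in E.
    replace (- INR (S m) + / 2) with (- INR m - / 2) in E by (rewrite S_INR; field).
    assert (I : (/ (- Cexp zeta) ^ S m = RtoC (cos (PI * - INR (S m))) * Cexp (RtoC (- INR (S m)) * zeta))%C).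
    { rewrite neg_exp_pow. replace (PI * - INR (S m)) with (- (PI * INR (S m))) by ring. rewrite cos_neg.
      assert (Q := cos_PI_IZR_sq (Z.of_nat (S m))). rewrite <- INR_IZR_INZ in Q. set (c := cos (PI * INR (S m))) in *.
      replace (RtoC (- INR (S m)) * zeta)%C with (- (RtoC (INR (S m)) * zeta))%C by (rewrite RtoC_opp; ring).
      rewrite Cexp_opp. set (e := Cexp (RtoC (INR (S m)) * zeta)). assert (He : e <> 0) by apply Cexp_neq_0.
      assert (Hc : RtoC c <> 0) by (apply RtoC_neq_0; intros X; rewrite X in Q; lra).
      apply Cmult_reg_l with (RtoC c * e)%C. apply Cmult_neq_0; auto.
      rewrite Cinv_r by (apply Cmult_neq_0; auto).
      replace (RtoC c * e * (RtoC c * / e))%C with ((RtoC c * RtoC c) * (e * / e))%C by ring.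
      rewrite <- RtoC_mult, Q, Cinv_r by auto. ring. }
    rewrite I, <- RtoC_opp.
    change (/ 2 * Mell phi (- / 2) zeta - / 2 * Mell phi (- INR m - / 2) zeta + phi (RtoC (- INR (S m))) * (RtoC (cos (PI * - INR (S m))) * Cexp (RtoC (- INR (S m)) * zeta)) =
     / 2 * Mell phi (- / 2) zeta - / 2 * Mell phi (- INR (S m) - / 2) zeta)%C.
    replace (phi (RtoC (- INR (S m))) * (RtoC (cos (PI * - INR (S m))) * Cexp (RtoC (- INR (S m)) * zeta)))%C with
     (/ 2 * (Mell phi (- INR m - / 2) zeta - Mell phi (- INR (S m) - / 2) zeta))%C. ring.
    rewrite E. field.
Qed.

Lemma barnes_minus_partial phi K a b zeta (N : Z) : tame phi K a b -> Rabs (Im zeta) < PI - b ->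
  (barnes phi zeta - S_ phi N (- Cexp zeta) = - (/ 2 * Mell phi (IZR N - / 2) zeta))%C.
Proof.
  intros H Hz. unfold barnes. destruct N as [|m|m].
  - unfold S_. replace (IZR 0 - / 2) with (- / 2) by ring. ring.
  - unfold S_. rewrite (Mell_partial phi b) by (auto; apply H).
    replace (IZR (Z.pos m) - / 2) with (INR (pred (Pos.to_nat m)) + / 2). ring.
    rewrite <- (positive_nat_Z m), <- INR_IZR_INZ.
    assert (P := Pos2Nat.is_pos m). destruct (Pos.to_nat m); [lia|]. simpl pred. rewrite S_INR. field.
  - unfold S_. rewrite (Mell_negative_partial phi b) by (auto; apply H).
    replace (IZR (Z.neg m) - / 2) with (- INR (Pos.to_nat m) - / 2). ring.
    change (Z.neg m) with (- Z.pos m)%Z. rewrite opp_IZR, <- (positive_nat_Z m), <- INR_IZR_INZ. auto.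
Qed.

Lemma Mell_same phi b zeta c c' (n : Z) : (forall z, holo phi z) -> strip_growth phi b -> Rabs (Im zeta) < PI - b ->
  IZR n - 1 < c < IZR n -> IZR n - 1 < c' < IZR n -> Mell phi c zeta = Mell phi c' zeta.
Proof.
  intros Hol HG Hz Hc Hc'. destruct (Rtotal_order c c') as [H|[->|H]]; [|reflexivity|].
  - symmetry. apply (Mell_shift_free phi b zeta c c' n Hol HG Hz); lra.
  - apply (Mell_shift_free phi b zeta c' c n Hol HG Hz); lra.
Qed.

(** * A primitive of the Mellin integrand *)

Lemma exp_decay_bounded_mult f g M : (forall t, 0 <= t -> rcont f t) -> 0 <= M -> (forall t, 0 <= t -> Cmod (f t) <= M) ->
  exp_decay g -> exp_decay (fun t => f t * g t)%C.
Proof.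
  intros Hf HM HB [Hc [K [e [HK [He Hg]]]]]. split.
  - intros t Ht. apply rcont_mult; auto.
  - exists (M * K), e. split. apply Rmult_le_pos; auto. split; auto. intros t Ht. rewrite Cmod_mult, Rmult_assoc.
    apply Rmult_le_compat; auto using Cmod_ge_0.
Qed.

(** e^((v - u) z) / (v - u) is a primitive of e^((v - u) z); the two half-lines are
    those of vline_int. *)
Definition half_primitive (phi : C -> C) (u : C) (c s : R) (z : C) : C :=
  (Cexp ((RtoC c - u) * z) *
   HInt (fun t => phi (line_point c s t) / Csin (RtoC PI * line_point c s t) / (line_point c s t - u) * Cexp (RtoC s * Ci * RtoC t * z)))%C.

Definition primitive (phi : C -> C) (u : C) (c : R) (z : C) : C :=
  (half_primitive phi u c 1 z + half_primitive phi u c (- (1)) z)%C.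

Lemma line_point_far c s t u : c <> Re u -> (line_point c s t - u)%C <> 0 /\ Cmod (/ (line_point c s t - u)) <= / Rabs (c - Re u).
Proof.
  intros H. assert (P : 0 < Rabs (c - Re u)) by (apply Rabs_pos_lt; lra).
  assert (L : Rabs (c - Re u) <= Cmod (line_point c s t - u)) by apply (re_le_Cmod (line_point c s t - u)).
  assert (N : (line_point c s t - u)%C <> 0) by (apply Cmod_gt_0; lra).
  split; auto. rewrite Cmod_inv by auto. apply Rinv_le_contravar; auto.
Qed.

Lemma half_primitive_decay phi b u z c (n : Z) s : (forall z, holo phi z) -> strip_growth phi b -> Rabs (Im z) < PI - b ->
  IZR n - 1 < c < IZR n -> (s = 1 \/ s = - (1)) -> c <> Re u ->
  exp_decay (fun t => phi (line_point c s t) / Csin (RtoC PI * line_point c s t) / (line_point c s t - u) * Cexp (RtoC s * Ci * RtoC t * z))%C.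
Proof.
  intros Hol HG Hz Hc Hs Hu.
  apply exp_decay_ext with (fun t => / (line_point c s t - u) * (phi (line_point c s t) / Csin (RtoC PI * line_point c s t) * Cexp (RtoC s * Ci * RtoC t * z)))%C.
  intros t. unfold Cdiv. ring.
  apply exp_decay_bounded_mult with (/ Rabs (c - Re u)).
  - intros t Ht. apply (rcont_line_point (fun v => / (v - u))%C). apply holo_ccont, holo_inv; auto with hol. apply line_point_far; auto.
  - apply Rlt_le, Rinv_0_lt_compat, Rabs_pos_lt; lra.
  - intros t Ht. apply line_point_far; auto.
  - apply half_integrand_decay with b n; auto.
Qed.

Lemma half_primitive_deriv phi b u z c (n : Z) s : (forall z, holo phi z) -> strip_growth phi b -> Rabs (Im z) < PI - b ->
  IZR n - 1 < c < IZR n -> (s = 1 \/ s = - (1)) -> c <> Re u ->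
  cderiv (half_primitive phi u c s) z (Cexp (- u * z) * HInt (fun t => kern phi z (line_point c s t)))%C.
Proof.
  intros Hol HG Hz Hc Hs Hu.
  set (q := fun t => (phi (line_point c s t) / Csin (RtoC PI * line_point c s t) / (line_point c s t - u))%C).
  set (E := fun t => Cexp (RtoC s * Ci * RtoC t * z)).
  assert (Dq : exp_decay (fun t => q t * E t)%C) by (apply half_primitive_decay with b n; auto).
  assert (Dk : exp_decay (fun t => phi (line_point c s t) / Csin (RtoC PI * line_point c s t) * E t)%C) by (apply half_integrand_decay with b n; auto).
  assert (NS : forall t, Csin (RtoC PI * line_point c s t) <> 0) by (intros t; apply Csin_PI_neq_0_between with n; simpl; auto).
  assert (Rel : forall t, (phi (line_point c s t) / Csin (RtoC PI * line_point c s t) * E t = (RtoC c - u) * (q t * E t) + RtoC s * Ci * RtoC t * (q t * E t))%C).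
  { intros t. destruct (line_point_far c s t u Hu) as [N _].
    replace ((RtoC c - u) * (q t * E t) + RtoC s * Ci * RtoC t * (q t * E t))%C with ((line_point c s t - u) * (q t * E t))%C.
    unfold q. field. split; auto.
    rewrite (line_point_eq c s t). ring. }
  assert (Dt : exp_decay (fun t => RtoC s * Ci * RtoC t * (q t * E t))%C).
  { apply exp_decay_ext with (fun t => phi (line_point c s t) / Csin (RtoC PI * line_point c s t) * E t + (- (RtoC c - u)) * (q t * E t))%C.
    intros t. rewrite Rel. ring. apply exp_decay_plus; auto using exp_decay_cmul. }
  assert (C1 := cderiv_HInt_param q (RtoC s * Ci) z).
  assert (C1' := C1 ltac:(intros t Ht; apply (rcont_line_point (fun v => phi v / Csin (RtoC PI * v) / (v - u))%C);
     apply holo_ccont, holo_div; [apply line_point_far; exact Hu|apply holo_div; auto with hol|auto with hol]) Dq). clear C1.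
  assert (C2 : cderiv (fun z => Cexp ((RtoC c - u) * z))%C z ((RtoC c - u) * Cexp ((RtoC c - u) * z))%C).
  { apply cderiv_Cexp_scal. }
  assert (C3 := cderiv_mult _ _ z _ _ C2 C1'). cbv beta in C3.
  replace (Cexp (- u * z) * HInt (fun t => kern phi z (line_point c s t)))%C with
    ((RtoC c - u) * Cexp ((RtoC c - u) * z) * HInt (fun t => q t * Cexp (RtoC s * Ci * RtoC t * z)) +
     Cexp ((RtoC c - u) * z) * HInt (fun t => RtoC s * Ci * RtoC t * (q t * Cexp (RtoC s * Ci * RtoC t * z))))%C.
  exact C3.
  fold E.
  change (HInt (fun t => q t * Cexp (RtoC s * Ci * RtoC t * z))%C) with (HInt (fun t => q t * E t)%C).
  change (HInt (fun t => RtoC s * Ci * RtoC t * (q t * Cexp (RtoC s * Ci * RtoC t * z)))%C) with (HInt (fun t => RtoC s * Ci * RtoC t * (q t * E t))%C).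
  transitivity (Cexp ((RtoC c - u) * z) * ((RtoC c - u) * HInt (fun t => q t * E t) + HInt (fun t => RtoC s * Ci * RtoC t * (q t * E t))))%C. ring.
  rewrite <- HInt_cmul, <- HInt_plus by auto using exp_decay_cmul.
  replace ((RtoC c - u) * z)%C with (- u * z + RtoC c * z)%C by ring. rewrite Cexp_add, <- Cmult_assoc. f_equal.
  rewrite (HInt_ext _ (fun t => phi (line_point c s t) / Csin (RtoC PI * line_point c s t) * E t)%C) by (auto using exp_decay_plus, exp_decay_cmul).
  rewrite <- HInt_cmul by auto. apply HInt_ext. apply exp_decay_cmul; auto. intros t _. rewrite kern_line_point. auto.
Qed.

Lemma primitive_deriv phi b u z c (n : Z) : (forall z, holo phi z) -> strip_growth phi b -> Rabs (Im z) < PI - b ->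
  IZR n - 1 < c < IZR n -> c <> Re u -> cderiv (primitive phi u c) z (Cexp (- u * z) * Mell phi c z)%C.
Proof.
  intros Hol HG Hz Hc Hu.
  unfold Mell, vline_int. rewrite Cmult_plus_distr_l. apply cderiv_plus; apply half_primitive_deriv with b n; auto.
Qed.

Lemma real_small b t : 0 < b < PI -> Rabs (Im (RtoC t)) < PI - b.
Proof. intros H. simpl. rewrite Rabs_R0. lra. Qed.

Lemma Cmod_unit_phase s x t : Cmod (Cexp (RtoC s * Ci * RtoC x * RtoC t)) = 1.
Proof.
  rewrite Cmod_Cexp. replace (Re (RtoC s * Ci * RtoC x * RtoC t)) with 0 by (simpl; ring). apply exp_0.
Qed.

Lemma half_primitive_bound phi b u c (n : Z) s : (forall z, holo phi z) -> strip_growth phi b -> 0 < b < PI ->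
  IZR n - 1 < c < IZR n -> (s = 1 \/ s = - (1)) -> c <> Re u ->
  exists M, 0 <= M /\ forall t : R, Cmod (half_primitive phi u c s (RtoC t)) <= M * exp ((c - Re u) * t).
Proof.
  intros Hol HG Hb Hc Hs Hu.
  destruct (half_primitive_decay phi b u (RtoC 0) c n s Hol HG (real_small b 0 Hb) Hc Hs Hu) as [_ [K [e [HK [He HB]]]]].
  exists (K / e). split. apply Rdiv_le_0_compat; auto. intros t.
  unfold half_primitive. rewrite Cmod_mult, Cmod_Cexp, Rmult_comm.
  replace (Re ((c - u) * t)) with ((c - Re u) * t) by (destruct u; simpl; ring).
  apply Rmult_le_compat_r. apply Rlt_le, exp_pos.
  apply HInt_bound; auto. apply (half_primitive_decay phi b u (RtoC t) c n s); auto. apply real_small; auto.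
  intros x Hx. specialize (HB x Hx). rewrite Cmod_mult, Cmod_unit_phase in HB |- *. auto.
Qed.

(** On the line Re v = c the modulus of e^((v - u) t) is e^((c - Re u) t), so a line
    to the left of u gives a primitive that vanishes at + oo, and a line to the
    right of u one that vanishes at - oo. *)
Lemma primitive_bound phi b u c (n : Z) : (forall z, holo phi z) -> strip_growth phi b -> 0 < b < PI ->
  IZR n - 1 < c < IZR n -> c <> Re u ->
  exists M, 0 <= M /\ forall t : R, Cmod (primitive phi u c (RtoC t)) <= M * exp ((c - Re u) * t).
Proof.
  intros Hol HG Hb Hc Hu.
  destruct (half_primitive_bound phi b u c n 1) as [M1 [H1 B1]]; auto.
  destruct (half_primitive_bound phi b u c n (- (1))) as [M2 [H2 B2]]; auto.
  exists (M1 + M2). split. lra. intros t. rewrite Rmult_plus_distr_r.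
  eapply Rle_trans; [apply Cmod_triangle|]. apply Rplus_le_compat; auto.
Qed.

Lemma Mell_real_bound phi b c (n : Z) : (forall z, holo phi z) -> strip_growth phi b -> 0 < b < PI ->
  IZR n - 1 < c < IZR n -> exists M, 0 <= M /\ forall t : R, Cmod (Mell phi c (RtoC t)) <= M * exp (c * t).
Proof.
  intros Hol HG Hb Hc.
  assert (Half : forall s, (s = 1 \/ s = - (1)) -> exists M, 0 <= M /\ forall t : R, Cmod (HInt (fun x => kern phi (RtoC t) (line_point c s x))) <= M * exp (c * t)).
  { intros s Hs. destruct (half_integrand_decay phi b (RtoC 0) c n s Hol HG (real_small b 0 Hb) Hc Hs) as [_ [K [e [HK [He HB]]]]].
    exists (K / e). split. apply Rdiv_le_0_compat; auto. intros t.
    replace (K / e * exp (c * t)) with ((K * exp (c * t)) / e) by (field; lra). assert (P := exp_pos (c * t)).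
    apply HInt_bound; auto. nra. apply (kern_exp_decay phi b (RtoC t) c n s); auto. apply real_small; auto.
    intros x Hx. specialize (HB x Hx). rewrite kern_line_point, Cmod_mult, Cmod_Cexp. rewrite Cmod_mult, Cmod_unit_phase in HB |- *.
    replace (Re (c * t)) with (c * t) by (simpl; ring). rewrite (Rmult_comm K), Rmult_assoc. apply Rmult_le_compat_l; auto. lra. }
  destruct (Half 1) as [M1 [H1 B1]]; auto. destruct (Half (- (1))) as [M2 [H2 B2]]; auto.
  exists (M1 + M2). split. lra. intros t. rewrite Rmult_plus_distr_r.
  eapply Rle_trans; [apply Cmod_triangle|]. apply Rplus_le_compat; auto.
Qed.

(** Cauchy's formula for the strip between two lines enclosing u. *)
Lemma primitive_jump phi b u c1 c2 (n : Z) : (forall z, holo phi z) -> strip_growth phi b -> 0 < b < PI ->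
  IZR n - 1 < c1 -> c1 < Re u -> Re u < c2 -> c2 < IZR n ->
  (primitive phi u c2 0 - primitive phi u c1 0 = 2 * PI * (phi u / Csin (RtoC PI * u)))%C.
Proof.
  intros Hol HG Hb H1 H2 H3 H4.
  set (F := fun v => (phi v / Csin (RtoC PI * v) / (v - u))%C).
  assert (Hz0 : Rabs (Im (RtoC 0)) < PI - b) by (apply real_small; auto).
  assert (V : forall c, IZR n - 1 < c < IZR n -> c <> Re u -> primitive phi u c 0 = vline_int F c).
  { assert (V1 : forall c s, IZR n - 1 < c < IZR n -> c <> Re u -> (s = 1 \/ s = - (1)) ->
      half_primitive phi u c s 0 = HInt (fun t => F (line_point c s t))).
    { intros c s Hc Hu Hs. unfold half_primitive. rewrite Cmult_0_r, Cexp_0, (Cmult_1_l (HInt _)). apply HInt_ext.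
      - exact (half_primitive_decay phi b u 0 c n s Hol HG Hz0 Hc Hs Hu).
      - intros t _. rewrite Cmult_0_r, Cexp_0, Cmult_1_r. reflexivity. }
    intros c Hc Hu. unfold primitive, vline_int. rewrite !V1 by auto. reflexivity. }
  rewrite !V by lra.
  destruct (kern_decay phi b 0 (Rabs c1 + Rabs c2) HG Hz0) as [K [e [HK [He HB]]]].
  { generalize (Rabs_pos c1) (Rabs_pos c2); lra. }
  assert (NS : forall v, c1 <= Re v <= c2 -> Csin (RtoC PI * v) <> 0) by (intros v Hv; apply Csin_PI_neq_0_between with n; lra).
  apply (residue_strip F _ c1 c2 u (1 + Rabs (Im u)) K e); auto.
  - intros z Hz N. unfold F. apply holo_div. apply Cminus_eq_contra; auto. apply holo_div; auto with hol. auto with hol.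
  - assert (R := residue_quotient (fun v => phi v / Csin (RtoC PI * v))%C (fun v => v - u)%C 1 u).
    intros eps Heps. destruct R with eps as [dl [Hd R']]; auto.
    + apply holo_ccont, holo_div; auto with hol. apply NS; lra.
    + ring.
    + apply cderiv_shift.
    + apply RtoC_neq_0; lra.
    + exists dl. split; auto. intros z N Hz. specialize (R' z N Hz). unfold F.
      replace (phi u / Csin (PI * u) / 1)%C with (phi u / Csin (PI * u))%C in R'. auto. field. apply NS; lra.
  - intros x y Hx Hy. assert (Pu := Rabs_pos (Im u)).
    specialize (HB x y). assert (Hxx : Rabs x <= Rabs c1 + Rabs c2).
    { apply Rabs_le_sum; exact Hx. }
    specialize (HB Hxx ltac:(lra)). unfold kern in HB. rewrite Cmult_0_r, Cexp_0, Cmult_1_r in HB.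
    assert (D : 1 <= Cmod ((x, y) - u)).
    { eapply Rle_trans; [|apply Im_le_Cmod]. change (Im ((x, y) - u)) with (y - Im u).
      assert (T := Rabs_triang (y - Im u) (Im u)). replace (y - Im u + Im u) with y in T by ring. lra. }
    assert (N : ((x, y) - u)%C <> 0) by (apply Cmod_gt_0; lra).
    unfold F. rewrite Cmod_div by auto.
    eapply Rle_trans; [|apply HB]. assert (Q := Cmod_ge_0 (phi (x, y) / Csin (PI * (x, y)))).
    apply Rle_div_l. lra. nra.
Qed.

(** * Absolutely convergent integrals over (0, oo) *)

Lemma is_RInt_power d C a b : d <> 0 -> 0 < a <= b -> is_RInt (fun x => C * exp (d * ln x) / x) a b (C / d * (exp (d * ln b) - exp (d * ln a))).
Proof.
  intros Hd Hab. replace (C / d * (exp (d * ln b) - exp (d * ln a))) with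
   (minus (G := R_AbelianGroup) (C / d * exp (d * ln b)) (C / d * exp (d * ln a))) by (unfold minus, plus, opp; simpl; ring).
  apply (is_RInt_derive (V := R_CompleteNormedModule) (fun x => C / d * exp (d * ln x))); intros x Hx; rewrite Rmin_left, Rmax_right in Hx by lra.
  - auto_derive. lra. field. split; lra.
  - apply (ex_derive_continuous (K := R_AbsRing) (V := R_NormedModule)). auto_derive. split; [lra|split; [lra|auto]].
Qed.

(** The negative exponent d1 controls g at oo, the positive exponent d2 controls it
    at 0. *)
Record power_dominated (g : R -> C) (M d1 d2 : R) : Prop := {
  pd_neg : d1 < 0;
  pd_pos : 0 < d2;
  pd_const : 0 <= M;
  pd_cont : forall x, 0 < x -> rcont g x;
  pd_infty : forall x, 0 < x -> Cmod (g x) <= M * exp (d1 * ln x) / x;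
  pd_zero : forall x, 0 < x -> Cmod (g x) <= M * exp (d2 * ln x) / x }.

Definition abs_integral (g : R -> C) (a b : R) : R := RInt (fun x => Cmod (g x)) a b.

Lemma half_line_ex g M d1 d2 a b : power_dominated g M d1 d2 -> 0 < a <= b -> ex_RInt (fun x => Cmod (g x)) a b.
Proof.
  intros HP H. apply (ex_RInt_continuous (V := R_CompleteNormedModule)). intros x Hx. rewrite Rmin_left, Rmax_right in Hx by lra.
  apply rcont_Cmod, HP. lra.
Qed.

Lemma half_line_pos g M d1 d2 a b : power_dominated g M d1 d2 -> 0 < a <= b -> 0 <= abs_integral g a b.
Proof.
  intros HP H. apply RInt_ge_0; [lra|eapply half_line_ex; eauto|]. intros; apply Cmod_ge_0.
Qed.

Lemma half_line_upper g M d1 d2 b : power_dominated g M d1 d2 -> 1 <= b -> abs_integral g 1 b <= M / - d1.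
Proof.
  intros HP Hb. pose proof HP as [Hd1 Hd2 HM Hc B1 B2].
  apply Rle_trans with (M / d1 * (exp (d1 * ln b) - exp (d1 * ln 1))).
  - apply is_RInt_le with (fun x => Cmod (g x)) (fun x => M * exp (d1 * ln x) / x) 1 b; auto.
    apply (RInt_correct (V := R_CompleteNormedModule)), (half_line_ex g M d1 d2); [exact HP|lra]. apply is_RInt_power; lra. intros; apply B1; lra.
  - rewrite ln_1, Rmult_0_r, exp_0. assert (P := exp_pos (d1 * ln b)).
    replace (M / d1 * (exp (d1 * ln b) - 1)) with (M / - d1 * (1 - exp (d1 * ln b))) by (field; lra).
    assert (0 <= M / - d1) by (apply Rdiv_le_0_compat; lra). nra.
Qed.

Lemma half_line_lower g M d1 d2 a : power_dominated g M d1 d2 -> 0 < a <= 1 -> abs_integral g a 1 <= M / d2.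
Proof.
  intros HP Ha. pose proof HP as [Hd1 Hd2 HM Hc B1 B2].
  apply Rle_trans with (M / d2 * (exp (d2 * ln 1) - exp (d2 * ln a))).
  - apply is_RInt_le with (fun x => Cmod (g x)) (fun x => M * exp (d2 * ln x) / x) a 1; try lra.
    apply (RInt_correct (V := R_CompleteNormedModule)), (half_line_ex g M d1 d2); [exact HP|lra]. apply is_RInt_power; lra. intros; apply B2; lra.
  - rewrite ln_1, Rmult_0_r, exp_0. assert (P := exp_pos (d2 * ln a)).
    assert (0 <= M / d2) by (apply Rdiv_le_0_compat; lra). nra.
Qed.

Lemma half_line_Chasles g M d1 d2 a b c : power_dominated g M d1 d2 -> 0 < a -> a <= b -> b <= c -> abs_integral g a b + abs_integral g b c = abs_integral g a c.
Proof. intros HP ? ? ?. apply (RInt_Chasles (V := R_CompleteNormedModule)); apply (half_line_ex g M d1 d2); try exact HP; lra. Qed.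

Lemma half_line_abs_converges g M d1 d2 : power_dominated g M d1 d2 -> ex_RInt_gen (fun x => Cmod (g x)) (at_right 0) (Rbar_locally p_infty).
Proof.
  intros HP. destruct (completeness (fun v => exists b, 1 <= b /\ v = abs_integral g 1 b)) as [L1 [U1 V1]].
  { exists (M / - d1). intros v [b [Hb ->]]. apply half_line_upper with d2; auto. }
  { exists (abs_integral g 1 1), 1. split; auto. lra. }
  destruct (completeness (fun v => exists a, 0 < a <= 1 /\ v = abs_integral g a 1)) as [L0 [U0 V0]].
  { exists (M / d2). intros v [a [Ha ->]]. apply half_line_lower with d1; auto. }
  { exists (abs_integral g 1 1), 1. split; auto. lra. }
  assert (W1 : forall eps, 0 < eps -> exists b, 1 <= b /\ L1 - eps < abs_integral g 1 b).
  { intros eps He. apply NNPP. intros N. assert (L1 <= L1 - eps); [|lra]. apply V1. intros v [b [Hb ->]].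
    apply Rnot_lt_le. intros Hlt. apply N. exists b; auto. }
  assert (W0 : forall eps, 0 < eps -> exists a, 0 < a <= 1 /\ L0 - eps < abs_integral g a 1).
  { intros eps He. apply NNPP. intros N. assert (L0 <= L0 - eps); [|lra]. apply V0. intros v [b [Hb ->]].
    apply Rnot_lt_le. intros Hlt. apply N. exists b; auto. }
  exists (L0 + L1). intros P [eps HE].
  destruct (W1 (eps / 2)) as [b0 [Hb0 Hb0']]. apply is_pos_div_2. destruct (W0 (eps / 2)) as [a0 [Ha0 Ha0']]. apply is_pos_div_2.
  apply (Filter_prod _ _ _ (fun a => 0 < a < a0) (fun b => b0 < b)).
  - exists (mkposreal a0 (proj1 Ha0)). intros y Hy Hy0. split; auto.
    change (Rabs (y - 0) < a0) in Hy. rewrite Rminus_0_r, Rabs_pos_eq in Hy; lra.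
  - exists b0. auto.
  - intros a b Ha Hb. simpl. exists (abs_integral g a b). split.
    + apply (RInt_correct (V := R_CompleteNormedModule)), (half_line_ex g M d1 d2); [exact HP|lra].
    + apply HE. change (Rabs (abs_integral g a b - (L0 + L1)) < eps).
      rewrite <- (half_line_Chasles g M d1 d2 a 1 b) by (try exact HP; lra).
      assert (X1 : abs_integral g 1 b <= L1) by (apply U1; exists b; split; auto; lra).
      assert (X0 : abs_integral g a 1 <= L0) by (apply U0; exists a; split; auto; lra).
      assert (Y1 := half_line_Chasles g M d1 d2 1 b0 b HP ltac:(lra) ltac:(lra) ltac:(lra)).
      assert (Y0 := half_line_Chasles g M d1 d2 a a0 1 HP ltac:(lra) ltac:(lra) ltac:(lra)).
      assert (Z1 := half_line_pos g M d1 d2 b0 b HP ltac:(lra)). assert (Z0 := half_line_pos g M d1 d2 a a0 HP ltac:(lra)).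
      apply Rabs_lt_between. lra.
Qed.

(** The two primitives differ by a constant; one of them controls the integral
    near oo and the other one near 0. *)
Lemma half_line_integral g M d1 d2 (G1 G2 : R -> C) : power_dominated g M d1 d2 ->
  (forall x, 0 < x -> rderiv G1 x (g x)) -> (forall x, 0 < x -> rderiv G2 x (g x)) ->
  (forall x, 0 < x -> Cmod (G1 x) <= M * exp (d1 * ln x)) -> (forall x, 0 < x -> Cmod (G2 x) <= M * exp (d2 * ln x)) ->
  is_integral_0_infty g (G2 1 - G1 1)%C.
Proof.
  intros HP D1 D2 E1 E2. split. apply half_line_abs_converges with M d1 d2; auto. destruct HP as [Hd1 Hd2 HM Hc B1 B2].
  intros P [eps HE].
  destruct (exp_neg_small M (- d1) (eps / 4)) as [T1 [HT1 S1]]; auto; try lra. { generalize (cond_pos eps); lra. }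
  destruct (exp_neg_small M d2 (eps / 4)) as [T2 [HT2 S2]]; auto. { generalize (cond_pos eps); lra. }
  assert (Ea : exp (- T2) <= 1) by (apply exp_le_1; lra).
  assert (Eb : 1 <= exp T1) by (rewrite <- exp_0; apply exp_le; lra).
  apply (Filter_prod _ _ _ (fun a => 0 < a < exp (- T2)) (fun b => exp T1 < b)).
  - exists (mkposreal _ (exp_pos (- T2))). intros y Hy Hy0. split; auto.
    change (Rabs (y - 0) < exp (- T2)) in Hy. rewrite Rminus_0_r, Rabs_pos_eq in Hy; lra.
  - exists (exp T1). auto.
  - intros a b Ha Hb. simpl.
    assert (Cg : forall p q, 0 < p -> cont_seg g p q) by (intros p q Hp t Ht; apply Hc; lra).
    exists (CInt g a b). split. apply CInt_correct; [lra|apply Cg; lra].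
    apply HE. apply (norm_compat1 (V := C_R_NormedModule)). rewrite <- Cmod_norm.
    change (Cmod (CInt g a b - (G2 1 - G1 1)) < eps).
    rewrite (CInt_FTC G1) by (try lra; try (apply Cg; lra); intros; apply D1; lra).
    assert (F1 := CInt_FTC G1 g a 1 ltac:(lra) ltac:(intros; apply D1; lra) ltac:(apply Cg; lra)).
    assert (F2 := CInt_FTC G2 g a 1 ltac:(lra) ltac:(intros; apply D2; lra) ltac:(apply Cg; lra)).
    replace (G1 b - G1 a - (G2 1 - G1 1))%C with (G1 b - G2 a + ((G1 1 - G1 a) - (G2 1 - G2 a)))%C by ring.
    rewrite <- F1, <- F2. replace (G1 b - G2 a + (CInt g a 1 - CInt g a 1))%C with (G1 b - G2 a)%C by ring.
    eapply Rle_lt_trans; [apply Cmod_triangle_minus|].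
    assert (L1 : T1 <= ln b). { rewrite <- (ln_exp T1). left; apply ln_increasing; auto. apply exp_pos. }
    assert (L2 : T2 <= - ln a). { assert (ln a < - T2); [|lra]. rewrite <- (ln_exp (- T2)). apply ln_increasing; lra. }
    specialize (E1 b ltac:(lra)). specialize (E2 a ltac:(lra)). specialize (S1 _ L1). specialize (S2 _ L2).
    replace (- - d1 * ln b) with (d1 * ln b) in S1 by ring. replace (- d2 * - ln a) with (d2 * ln a) in S2 by ring.
    generalize (cond_pos eps); lra.
Qed.

Lemma rcont_ext_pos f g x : 0 < x -> (forall y, 0 < y -> f y = g y) -> rcont f x -> rcont g x.
Proof.
  intros Hx E H eps He. destruct (H eps He) as [d [Hd H']]. exists (Rmin d x). split. apply Rmin_pos; auto.
  intros h Hh. apply lt_Rmin in Hh. destruct Hh as [h1 h2]. rewrite <- !E; auto.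
  apply Rabs_lt_between in h2. lra.
Qed.

Lemma rderiv_ln x : 0 < x -> rderiv (fun x => RtoC (ln x)) x (RtoC (/ x)).
Proof. intros H. apply (rderiv_pair ln (fun _ => 0)); auto_derive; auto. field; lra. Qed.

Lemma Rcpow_minus_1 x s : 0 < x -> (Rcpow x (s - 1) = RtoC (/ x) * Cexp (s * RtoC (ln x)))%C.
Proof.
  intros Hx. unfold Rcpow. replace ((s - 1) * ln x)%C with (s * ln x + RtoC (- ln x))%C by (rewrite RtoC_opp; ring).
  rewrite Cexp_add, Cexp_RtoC, exp_Ropp, exp_ln by auto. ring.
Qed.

Lemma Csin_opp z : Csin (- z) = (- Csin z)%C.
Proof. unfold Csin, Cdiv. replace (Ci * - z)%C with (- (Ci * z))%C by ring. replace (- - (Ci * z))%C with (Ci * z)%C by ring. ring. Qed.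

(** With x = e^t and u = - s the integrand f_N (- x) x^(s - 1) dx becomes - 1/2 e^(-
    u t) Mell phi c t dt for every c between N - 1 and N. A line c1 < Re u gives a
    primitive that is small at oo, a line c2 > Re u one that is small at 0, and the
    integral is their difference, a residue at u. *)
Theorem mellin_transform phi K a b f (N : Z) s : tame phi K a b -> is_continuation phi f -> - IZR N < Re s < - IZR N + 1 ->
  is_integral_0_infty
         (fun x : R => ((f (RtoC (- x)) - S_ phi N (RtoC (- x))) * Rcpow x (s - 1))%C)
         (RtoC PI / Csin (RtoC PI * s) * phi (- s))%C.
Proof.
  intros H Hf Hs. assert (Hb := tame_type _ _ _ _ H). assert (Hol := tame_holo _ _ _ _ H). assert (HG := tame_strip _ _ _ _ H).
  set (u := (- s)%C). assert (Hu : Re u = - Re s) by (unfold u; destruct s; auto).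
  set (c1 := (IZR N - 1 + Re u) / 2). set (c2 := (Re u + IZR N) / 2).
  assert (H1 : IZR N - 1 < c1) by (unfold c1; lra). assert (H2 : c1 < Re u) by (unfold c1; lra).
  assert (H3 : Re u < c2) by (unfold c2; lra). assert (H4 : c2 < IZR N) by (unfold c2; lra).
  set (g := fun x : R => ((f (RtoC (- x)) - S_ phi N (RtoC (- x))) * Rcpow x (s - 1))%C).
  (* the same integrand, represented on either line *)
  assert (Eg : forall c x, IZR N - 1 < c < IZR N -> 0 < x -> g x = (RtoC (/ x) * (- / 2 * (Cexp (- u * RtoC (ln x)) * Mell phi c (RtoC (ln x)))))%C).
  { intros c x Hc Hx. unfold g. assert (Hz := real_small b (ln x) Hb).
    replace (RtoC (- x)) with (- Cexp (RtoC (ln x)))%C by (rewrite Cexp_RtoC, exp_ln, RtoC_opp; auto).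
    rewrite (continuation_barnes phi K a b f), (barnes_minus_partial phi K a b) by auto.
    rewrite (Mell_same phi b (RtoC (ln x)) c (IZR N - / 2) N) by (auto; lra).
    rewrite Rcpow_minus_1 by auto. replace (- u)%C with s by (unfold u; ring). ring. }
  destruct (primitive_bound phi b u c1 N) as [M1 [P1 B1]]; auto; try lra.
  destruct (primitive_bound phi b u c2 N) as [M2 [P2 B2]]; auto; try lra.
  destruct (Mell_real_bound phi b c1 N) as [M3 [P3 B3]]; auto; try lra.
  destruct (Mell_real_bound phi b c2 N) as [M4 [P4 B4]]; auto; try lra.
  set (M := M1 + M2 + M3 + M4).
  set (G := fun c x => (- / 2 * primitive phi u c (RtoC (ln x)))%C).
  assert (Mh : Cmod (- / 2) = / 2) by (rewrite Cmod_opp, Cmod_inv, Cmod_R, Rabs_pos_eq; auto using C2_neq_0; lra).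
  assert (DG : forall c x, IZR N - 1 < c < IZR N -> c <> Re u -> 0 < x -> rderiv (G c) x (g x)).
  { intros c x Hc Hcu Hx. rewrite (Eg c x Hc Hx). unfold G.
    apply (rderiv_comp (fun z => - / 2 * primitive phi u c z)%C (fun x => RtoC (ln x))); [|apply rderiv_ln; auto].
    exact (cderiv_scal (- / 2) _ _ _ (primitive_deriv phi b u (RtoC (ln x)) c N Hol HG (real_small b _ Hb) Hc Hcu)). }
  assert (Bg : forall c M0 x, IZR N - 1 < c < IZR N -> 0 <= M0 <= M -> (forall t : R, Cmod (Mell phi c (RtoC t)) <= M0 * exp (c * t)) ->
    0 < x -> Cmod (g x) <= M * exp ((c - Re u) * ln x) / x).
  { intros c M0 x Hc HM0 HB Hx. rewrite (Eg c x Hc Hx), !Cmod_mult, Mh, Cmod_Cexp, Cmod_R, Rabs_pos_eq by (apply Rlt_le, Rinv_0_lt_compat; auto).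
    unfold Rdiv. rewrite (Rmult_comm (/ x)). apply Rmult_le_compat_r. apply Rlt_le, Rinv_0_lt_compat; auto.
    replace (Re (- u * ln x)) with (- Re u * ln x) by (destruct u; simpl; ring).
    replace ((c - Re u) * ln x) with (- Re u * ln x + c * ln x) by ring. rewrite exp_plus.
    assert (A1 := exp_pos (- Re u * ln x)). assert (A2 := exp_pos (c * ln x)). specialize (HB (ln x)).
    apply Rle_trans with (1 * (exp (- Re u * ln x) * (M * exp (c * ln x)))); [|right; ring].
    apply Rmult_le_compat; try lra. apply Rmult_le_pos; [lra|apply Cmod_ge_0].
    apply Rmult_le_compat_l. lra. eapply Rle_trans; [apply HB|]. apply Rmult_le_compat_r; lra. }
  assert (BG : forall c M0 x, 0 <= M0 <= M -> (forall t : R, Cmod (primitive phi u c (RtoC t)) <= M0 * exp ((c - Re u) * t)) ->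
    0 < x -> Cmod (G c x) <= M * exp ((c - Re u) * ln x)).
  { intros c M0 x HM0 HB Hx. unfold G. rewrite Cmod_mult, Mh. specialize (HB (ln x)). assert (A2 := exp_pos ((c - Re u) * ln x)).
    assert (Q := Cmod_ge_0 (primitive phi u c (ln x))).
    apply Rle_trans with (M0 * exp ((c - Re u) * ln x)). lra. apply Rmult_le_compat_r; lra. }
  replace (RtoC PI / Csin (RtoC PI * s) * phi u)%C with (G c2 1 - G c1 1)%C.
  - apply (half_line_integral g M (c1 - Re u) (c2 - Re u) (G c1) (G c2)); [constructor; try lra| | | | ]; unfold M in *; try lra.
    + intros x Hx. apply (rcont_ext_pos (fun x => RtoC (/ x) * (- / 2 * (Cexp (- u * RtoC (ln x)) * Mell phi c1 (RtoC (ln x)))))%C); auto.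
      * intros y Hy. symmetry. apply Eg; auto; lra.
      * apply rcont_mult. apply rcont_RtoC, continuous_Rinv; lra.
        apply (rcont_comp (fun z => - / 2 * (Cexp (- u * z) * Mell phi c1 z))%C (fun x => RtoC (ln x))).
        apply holo_ccont, holo_mult; [apply holo_const|apply holo_mult; [auto with hol|]].
        apply (holo_Mell phi b _ c1 N); [exact Hol|exact HG|apply real_small; exact Hb|lra].
        eapply rderiv_rcont, rderiv_ln; auto.
    + intros x Hx. apply (Bg c1 M3); auto; lra.
    + intros x Hx. apply (Bg c2 M4); auto; lra.
    + intros x Hx. apply DG; auto; lra.
    + intros x Hx. apply DG; auto; lra.
    + intros x Hx. apply (BG c1 M1); auto; lra.
    + intros x Hx. apply (BG c2 M2); auto; lra.
  - unfold G. rewrite ln_1.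
    transitivity (- / 2 * (primitive phi u c2 0 - primitive phi u c1 0))%C. ring.
    rewrite (primitive_jump phi b u c1 c2 N) by auto.
    assert (NS : Csin (RtoC PI * u) <> 0) by (apply Csin_PI_neq_0_between with N; lra).
    fold u. replace (PI * s)%C with (- (PI * u))%C by (unfold u; ring). rewrite Csin_opp. field. auto.
Qed.

Theorem mainTheorem5 (phi : C -> C)
  (hphi : class_E3 phi)
  (hdom : forall theta : R, - (PI / 2) <= theta <= PI / 2 ->
     Rbar_lt (indicator phi theta) p_infty)
  (hplus : Rbar_lt (indicator phi (PI / 2)) PI)
  (hminus : Rbar_lt (indicator phi (- (PI / 2))) PI) :
  (forall x : R, x <= 0 -> continuation_domain phi (RtoC x)) /\
  (exists f : C -> C, is_continuation phi f) /\
  (forall f : C -> C, is_continuation phi f ->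
     forall (N : Z) (s : C), - IZR N < Re s < - IZR N + 1 ->
       is_integral_0_infty
         (fun x : R =>
            ((f (RtoC (- x)) - S_ phi N (RtoC (- x))) * Rcpow x (s - 1))%C)
         (RtoC PI / Csin (RtoC PI * s) * phi (- s))%C).
Proof.
  assert (Hpi := PI_RGT_0).
  destruct (tame_of_class phi hphi (hdom 0 ltac:(lra)) hplus hminus) as [K [a [b H]]].
  split; [|split].
  - intros x [Hx|Hx].
    + replace (RtoC x) with (- Cexp (RtoC (ln (- x))))%C.
      * apply sector_in_domain with K a b; [exact H|]. apply real_small. apply H.
      * rewrite Cexp_RtoC, exp_ln by lra. rewrite RtoC_opp. ring.
    + subst x. intros [q [_ E]]. apply (Cexp_neq_0 (- q)). symmetry. exact E.
  - exists (continuation phi (radius a)). apply continuation_exists with K b. exact H.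
  - intros f Hf N s Hs. apply mellin_transform with K a b; assumption.
Qed.
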